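(* Let assumptions (A1)--(A6) of the context be valid and let $q\in L^2(\mathcal D^\ell)$ vanish for $r\in\mathcal R^\ell\setminus\mathcal R$. Then the Galerkin problem: find $(w_h^+,w_h^-)\in\mathbb W_h^+\times\mathbb V_h^-$ such that $$(\mathcal C w_h^+,v_h^+)_{\mathcal D^\ell}+(w_h^+,v_h^+)_{\partial\mathcal D^\ell}-(w_h^-,s\cdot\nabla v_h^+)_{\mathcal D^\ell}=(q^+,v_h^+)_{\mathcal D^\ell}\quad\forall v_h^+\in\mathbb W_h^+,$$ $$(s\cdot\nabla w_h^+,v_h^-)_{\mathcal D^\ell}+(\mathcal C w_h^-,v_h^-)_{\mathcal D^\ell}=(q^-,v_h^-)_{\mathcal D^\ell}\quad\forall v_h^-\in\mathbb V_h^-,$$ has a unique solution, and $$|||(w_h^+,w_h^-)|||\le C_D\|q\|_{L^2(\mathcal D)},$$ where $C_D$ is the same constant (depending at most linearly on $\gamma^{-1}$ and $\Gamma$) as in the a-priori bound $|||(w^+,w^-)|||\le C_D\|q\|_{L^2(\mathcal D)}$ for the solution $(w^+,w^-)$ of the continuous problem given in the context. Moreover, $$|||(w^+-w_h^+,w^--w_h^-)|||\le C_D'\inf|||(w^+-v_h^+,w^--v_h^-)|||,$$ where the infimum is taken over all $(v_h^+,v_h^-)\in\mathbb W_h^+\times\mathbb V_h^-$. The constant $C_D'$ again depends at most linearly on $\gamma^{-1}$ and $\Gamma$.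
   Context: Assumptions. (A1) $\mathcal R\subset\mathbb R^3$ is a bounded convex domain, $\mathcal S=\mathbb S^2$ is the unit sphere in $\mathbb R^3$, $\mathcal D=\mathcal R\times\mathcal S$. (A2) $\mu\in L^\infty(\mathcal R)$ with $0\le\mu(r)\le\overline\mu$. (A3) $k\in L^\infty(\mathcal R\times(-1,1))$ with $0\le k(r,\theta)\le\overline k$ and $\int_{\mathcal S}k(r,s\cdot s')\,ds'\le\mu(r)$. (A4) For given numbers $\ell,\eta>0$, $\mathcal R^\ell\subset\mathbb R^3$ is a bounded convex domain with $\overline{\mathcal R}\subset\mathcal R^\ell$ compactly embedded, and, with $\mathcal D^\ell=\mathcal R^\ell\times\mathcal S$ and $\partial\mathcal D^\ell=\partial\mathcal R^\ell\times\mathcal S$: $\ell(r,s)\ge\ell$ for a.e. $(r,s)\in\partial\mathcal D^\ell$, and $\ell(r,s)=\infty$ for a.e. $(r,s)\in\partial\mathcal D^\ell$ with $s\cdot n(r)\le\eta$; here $\ell(r,s)=\inf\{l>0:\ r-ls\in\mathcal R\}$ ($=\infty$ if the set is empty) and $n(r)$ is the outer unit normal on $\partial\mathcal R^\ell$. (A5) There are $\gamma,\Gamma>0$ with $\gamma\|v\|^2_{L^2(\mathcal D^\ell)}\le(\mathcal Cv,v)_{\mathcal D^\ell}\le\Gamma\|v\|^2_{L^2(\mathcal D^\ell)}$ for all $v\in L^2(\mathcal D^\ell)$. (A6) $\mathbb W_h^+\subset\mathbb W^+$ and $\mathbb V_h^-\subset\mathbb V^-$ are finite-dimensional subspaces and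 $\{s\cdot\nabla w_h^+:w_h^+\in\mathbb W_h^+\}\subset\mathbb V_h^-$. Coefficients. For $a>0$: $\mu^{\ell,a}=\mu$, $k^\ell=k$ for $r\in\mathcal R$ and $\mu^{\ell,a}=a$, $k^\ell=0$ for $r\in\mathcal R^\ell\setminus\mathcal R$. $(K^\ell u)(r,s)=\int_{\mathcal S}k^\ell(r,s\cdot s')u(r,s')ds'$. Total collision operator: $\mathcal Cv=\mu^{\ell,a}v-K^\ell v$ on $L^2(\mathcal D^\ell)$. Notation. $(u,v)_M=\int_M uv\,dM$. $W^2(\mathcal D^\ell)=\{u\in L^2(\mathcal D^\ell):s\cdot\nabla u\in L^2(\mathcal D^\ell)\}$ with $s\cdot\nabla$ the weak derivative in $r$ in direction $s$. Even and odd parts: $v^\pm(r,s)=\frac12(v(r,s)\pm v(r,-s))$. $\mathbb W^+$ is the space of functions $v^+\in W^2(\mathcal D^\ell)$ even in $s$ with $v^+|_{\partial\mathcal D^\ell}\in L^2(\partial\mathcal D^\ell)$; $\mathbb V^-$ is the space of functions in $L^2(\mathcal D^\ell)$ odd in $s$. Norm on $\mathbb W^+\times\mathbb V^-$: $|||(u^+,u^-)|||^2=\|s\cdot\nabla u^+\|^2_{L^2(\mathcal D^\ell)}+\|u^+\|^2_{L^2(\partial\mathcal D^\ell)}+\|u^+\|^2_{L^2(\mathcal D^\ell)}+\|u^-\|^2_{L^2(\mathcal D^\ell)}$. Continuous problem. $(w^+,w^-)\in\mathbb W^+\times\mathbb V^-$ denotes the unique solution of $(w^+,v^+)_{\partial\mathcal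 D^\ell}+(\mathcal C w^+,v^+)_{\mathcal D^\ell}-(w^-,s\cdot\nabla v^+)_{\mathcal D^\ell}=(q^+,v^+)_{\mathcal D^\ell}$ and $(s\cdot\nabla w^+,v^-)_{\mathcal D^\ell}+(\mathcal C w^-,v^-)_{\mathcal D^\ell}=(q^-,v^-)_{\mathcal D^\ell}$ for all $v^+\in\mathbb W^+$, $v^-\in\mathbb V^-$; it satisfies $|||(w^+,w^-)|||\le C_D\|q\|_{L^2(\mathcal D)}$ with $C_D$ depending at most linearly on $\gamma^{-1}$ and $\Gamma$. *)

(* Defs.v *)
From HB Require Import structures.
From mathcomp Require Import all_boot all_order all_algebra.
From mathcomp Require Import all_classical all_reals all_analysis.
From mathcomp Require Import measurable_realfun lra.

Set Implicit Arguments.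
Unset Strict Implicit.
Unset Printing Implicit Defensive.
Import Order.TTheory GRing.Theory Num.Theory.
Import numFieldNormedType.Exports.
Local Open Scope classical_set_scope.
Local Open Scope ring_scope.

Notation R3 R := (R * R * R)%type.

(* The norm that the library puts on a product is the sup norm, whence the
   explicit Euclidean structure. *)
Definition dot (R : realType) (x y : R3 R) : R :=
  x.1.1 * y.1.1 + x.1.2 * y.1.2 + x.2 * y.2.

Definition enorm (R : realType) (x : R3 R) : R := Num.sqrt (dot x x).

Definition sphere (R : realType) : set (R3 R) := [set s | enorm s = 1].

Definition boundary (T : topologicalType) (A : set T) : set T :=
  closure A `\` A°.

(* Lebesgue measure on R itself: the library puts it on the alias
   [measurableTypeR R], which hides the topology of R. *)
Definition leb (R : realType) (A : set R) : \bar R := lebesgue_measure A.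

Lemma leb0 (R : realType) : @leb R set0 = 0%E.
Proof. exact: measure0. Qed.

Lemma leb_ge0 (R : realType) (A : set R) : (0 <= leb A)%E.
Proof. exact: measure_ge0. Qed.

Lemma leb_sigma_additive (R : realType) : semi_sigma_additive (@leb R).
Proof. exact: (@measure_semi_sigma_additive _ _ _ (@lebesgue_measure R)). Qed.

HB.instance Definition _ (R : realType) := isMeasure.Build _ _ _ (@leb R)
  (@leb0 R) (@leb_ge0 R) (@leb_sigma_additive R).

Lemma leb_sigma_finite (R : realType) : sigma_finite setT (@leb R).
Proof. exact: (sigma_finiteT (@lebesgue_measure R)). Qed.

HB.instance Definition _ (R : realType) := Measure_isSigmaFinite.Build _ _ _
  (@leb R) (@leb_sigma_finite R).

Lemma product_sigma_finite d1 d2 (T1 : measurableType d1)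
    (T2 : measurableType d2) (R : realType)
    (m1 : {sigma_finite_measure set T1 -> \bar R})
    (m2 : {sigma_finite_measure set T2 -> \bar R}) :
  sigma_finite setT (m1 \x m2)%E.
Proof.
have /sigma_finiteP[F [TF ndF Foo]] := sigma_finiteT m1.
have /sigma_finiteP[G [TG ndG Goo]] := sigma_finiteT m2.
exists (fun n => F n `*` G n).
  rewrite -setXTT TF TG predeqE => -[x y]; split.
    move=> [/= [n _ Fnx] [k _ Gky]]; exists (maxn n k) => //; split.
    - by move: x Fnx; exact/subsetPset/ndF/leq_maxl.
    - by move: y Gky; exact/subsetPset/ndG/leq_maxr.
  by move=> [n _ []/= ? ?]; split; exists n.
move=> k; have [? ?] := Foo k; have [? ?] := Goo k.
split; first exact: measurableX.
by rewrite product_measure1E// lte_mul_pinfty// ge0_fin_numE.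
Qed.

Definition vol2 (R : realType) : set (R * R)%type -> \bar R :=
  (@leb R \x @leb R)%E.

HB.instance Definition _ (R : realType) := Measure.on (@vol2 R).
HB.instance Definition _ (R : realType) := Measure_isSigmaFinite.Build _ _ _
  (@vol2 R) (product_sigma_finite (@leb R) (@leb R)).

Definition vol3 (R : realType) : set (R3 R) -> \bar R :=
  (@vol2 R \x @leb R)%E.

HB.instance Definition _ (R : realType) := Measure.on (@vol3 R).
HB.instance Definition _ (R : realType) := Measure_isSigmaFinite.Build _ _ _
  (@vol3 R) (product_sigma_finite (@vol2 R) (@leb R)).

Definition unit_dir (R : realType) (x : R3 R) : R3 R := (enorm x)^-1 *: x.

Definition punctured_ball (R : realType) : set (R3 R) :=
  [set x | 0 < enorm x <= 1].

(* The surface measure of the unit sphere of R^3, as three times the volume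
   of the cone over a set; it is carried by the sphere. *)
Definition sphere_measure (R : realType) (A : set (R3 R)) : \bar R :=
  (3%:E * vol3 (@punctured_ball R `&` @unit_dir R @^-1` A))%E.

Lemma measurable_dot (R : realType) :
  measurable_fun setT (fun x : R3 R => dot x x).
Proof.
have m11 : measurable_fun setT (fun x : R3 R => x.1.1).
  exact: (measurableT_comp measurable_fst measurable_fst).
have m12 : measurable_fun setT (fun x : R3 R => x.1.2).
  exact: (measurableT_comp measurable_snd measurable_fst).
have m2 : measurable_fun setT (fun x : R3 R => x.2) by exact: measurable_snd.
by apply: measurable_funD; [apply: measurable_funD|]; exact: measurable_funM.
Qed.

Lemma measurable_enorm (R : realType) : measurable_fun setT (@enorm R).
Proof.
apply: (measurableT_comp (continuous_measurable_fun (@sqrt_continuous R))).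
exact: measurable_dot.
Qed.

Lemma measurable_unit_dir (R : realType) : measurable_fun setT (@unit_dir R).
Proof.
have mV : measurable_fun setT (fun x : R3 R => (enorm x)^-1).
  rewrite [X in measurable_fun _ X](_ : _ = fun x => (enorm x) `^ (-1)).
    exact: (measurableT_comp (measurable_powR _) (@measurable_enorm R)).
  by apply/funext => x; rewrite powR_inv1 ?sqrtr_ge0.
have m11 : measurable_fun setT (fun x : R3 R => x.1.1).
  exact: (measurableT_comp measurable_fst measurable_fst).
have m12 : measurable_fun setT (fun x : R3 R => x.1.2).
  exact: (measurableT_comp measurable_snd measurable_fst).
have m2 : measurable_fun setT (fun x : R3 R => x.2) by exact: measurable_snd.
apply: measurable_fun_pair; [apply: measurable_fun_pair|];
  exact: measurable_funM.
Qed.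

Lemma measurable_punctured_ball (R : realType) :
  measurable (@punctured_ball R).
Proof.
rewrite (_ : @punctured_ball R = setT `&` @enorm R @^-1` `]0, 1]).
  exact: measurable_enorm.
by apply/seteqP; split => x /=; rewrite in_itv/=; [|case].
Qed.

Lemma measurable_cone (R : realType) (A : set (R3 R)) : measurable A ->
  measurable (@punctured_ball R `&` @unit_dir R @^-1` A).
Proof.
move=> mA; apply: measurableI; first exact: measurable_punctured_ball.
by rewrite -[X in measurable X]setTI; exact: measurable_unit_dir.
Qed.

Lemma sphere_measure0 (R : realType) : @sphere_measure R set0 = 0%E.
Proof. by rewrite /sphere_measure preimage_set0 setI0 measure0 mule0. Qed.

Lemma sphere_measure_ge0 (R : realType) (A : set (R3 R)) :
  (0 <= sphere_measure A)%E.
Proof. by rewrite mule_ge0 ?lee_fin. Qed.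

Lemma sphere_measure_sigma_additive (R : realType) :
  semi_sigma_additive (@sphere_measure R).
Proof.
move=> F mF tF mUF; rewrite /sphere_measure.
rewrite [X in X @ \oo --> _](_ : _ = fun n => (3%:E *
  \sum_(0 <= i < n) vol3 (@punctured_ball R `&` @unit_dir R @^-1` F i))%E).
  apply: cvgeZl => //.
  rewrite preimage_bigcup setI_bigcupr.
  apply: measure_semi_sigma_additive.
  - by move=> i; exact: measurable_cone.
  - apply/trivIsetP => i j _ _ ij.
    rewrite -subset0 => x [[_ Fix] [_ Fjx]].
    have : (F i `&` F j) (unit_dir x) by [].
    by move/trivIsetP : tF => /(_ i j Logic.I Logic.I ij) ->.
  - rewrite -setI_bigcupr -preimage_bigcup; exact: measurable_cone.
by apply/funext => n; rewrite ge0_sume_distrr.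
Qed.

HB.instance Definition _ (R : realType) := isMeasure.Build _ _ _
  (@sphere_measure R) (@sphere_measure0 R) (@sphere_measure_ge0 R)
  (@sphere_measure_sigma_additive R).

Lemma vol3_ball_lty (R : realType) : (vol3 (@punctured_ball R) < +oo)%E.
Proof.
have sub : @punctured_ball R `<=` (`[-1, 1] `*` `[-1, 1]) `*` `[-1, 1].
  move=> x /andP[_ x1].
  have d1 : dot x x <= 1.
    have d0 : 0 <= dot x x by rewrite !addr_ge0 // -expr2 sqr_ge0.
    by rewrite -(sqr_sqrtr d0) -/(enorm x) expr_le1 ?sqrtr_ge0.
  have le1 (a b c : R) : a * a + b * b + c * c <= 1 -> -1 <= a <= 1.
    move=> h; rewrite -ler_norml -(@expr_le1 _ 2) // real_normK ?num_real //.
    apply: le_trans h; rewrite expr2 -addrA lerDl addr_ge0 // -expr2; exact: sqr_ge0.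
  split; [split|]; rewrite /= in_itv/=.
  - exact: le1 d1.
  - by apply: (@le1 _ x.1.1 x.2); rewrite [x.1.2 * _ + _]addrC.
  - by apply: (@le1 _ x.1.1 x.1.2); rewrite -addrA addrC.
apply: le_lt_trans (le_measure _ _ _ sub) _; rewrite ?inE.
- exact: measurable_punctured_ball.
- by apply: measurableX => //; exact: measurableX.
have mI : measurable (`[-1, 1]%classic : set R) by exact: measurable_itv.
pose I : set R := `[-1, 1]%classic.
rewrite [ltLHS](_ : _ = leb I * leb I * leb I)%E.
  by rewrite /leb /I lebesgue_measure_itv/= lte_fin ltrNl opprK; case: ifPn => _;
    rewrite -?EFinD -?EFinM ?mule0 ltry.
transitivity (vol2 (I `*` I) * leb I)%E.
  by apply: product_measure1E => //; exact: measurableX.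
by congr (_ * _)%E; exact: product_measure1E.
Qed.

Lemma sphere_measure_fin_num (R : realType) : fin_num_fun (@sphere_measure R).
Proof.
move=> A mA; rewrite ge0_fin_numE ?measure_ge0//.
apply: lte_mul_pinfty => //.
apply: le_lt_trans (vol3_ball_lty R).
apply: le_measure; rewrite ?inE; last exact: subIsetl.
  exact: measurable_cone.
exact: measurable_punctured_ball.
Qed.

HB.instance Definition _ (R : realType) := Measure_isFinite.Build _ _ _
  (@sphere_measure R) (@sphere_measure_fin_num R).

Definition ediam (R : realType) (A : set (R3 R)) : \bar R :=
  ereal_sup ([set 0%E] `|` [set (enorm (x - y))%:E | x in A & y in A]).

Definition hausdorff_gauge (R : realType) (delta : R) (A : set (R3 R)) :
    \bar R :=
  if (ediam A <= delta%:E)%E then ((pi / 4)%:E * ediam A ^+ 2)%E else +oo%E.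

(* The two-dimensional Hausdorff outer measure, normalized so as to be the
   area on planes. [mu_ext] takes countable covers by Borel sets, which is no
   restriction, as a set and its closure have the same diameter. *)
Definition hausdorff2 (R : realType) (A : set (R3 R)) : \bar R :=
  ereal_sup [set mu_ext (hausdorff_gauge delta) A
            | delta in [set delta : R | 0 < delta]].

Lemma hausdorff_gauge0 (R : realType) (delta : R) : 0 < delta ->
  hausdorff_gauge delta set0 = 0%E.
Proof.
move=> d0; rewrite /hausdorff_gauge (_ : ediam _ = 0%E).
  by rewrite lee_fin ltW // expe2 mule0 mule0.
rewrite /ediam (_ : [set _ | _ in _ & _ in _] = set0) ?setU0 ?ereal_sup1 //.
by rewrite -subset0 => _ [x []].
Qed.

Lemma hausdorff_gauge_ge0 (R : realType) (delta : R) (A : set (R3 R)) :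
  (0 <= hausdorff_gauge delta A)%E.
Proof.
have d0 : (0 <= ediam A)%E by apply: ereal_sup_ubound; left.
rewrite /hausdorff_gauge; case: ifPn => // _.
by rewrite mule_ge0 ?expe_ge0 // lee_fin divr_ge0 // pi_ge0.
Qed.

Lemma hausdorff2_0 (R : realType) : @hausdorff2 R set0 = 0%E.
Proof.
apply/eqP; rewrite eq_le; apply/andP; split.
  apply: ge_ereal_sup => _ [delta d0 <-].
  by rewrite mu_ext0 ?hausdorff_gauge0 // => A; exact: hausdorff_gauge_ge0.
apply: (@le_trans _ _ (mu_ext (hausdorff_gauge (1 : R)) set0)).
  by apply: mu_ext_ge0 => A; exact: hausdorff_gauge_ge0.
by apply: ereal_sup_ubound; exists 1 => /=.
Qed.

Lemma hausdorff2_ge0 (R : realType) (A : set (R3 R)) : (0 <= hausdorff2 A)%E.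
Proof.
apply: (@le_trans _ _ (mu_ext (hausdorff_gauge (1 : R)) A)).
  by apply: mu_ext_ge0 => B; exact: hausdorff_gauge_ge0.
by apply: ereal_sup_ubound; exists 1 => /=.
Qed.

Lemma le_hausdorff2 (R : realType) :
  {homo @hausdorff2 R : A B / A `<=` B >-> (A <= B)%E}.
Proof.
move=> A B AB; apply: ge_ereal_sup => _ [delta d0 <-].
apply: (@le_trans _ _ (mu_ext (hausdorff_gauge delta) B)).
  exact: le_mu_ext.
by apply: ereal_sup_ubound; exists delta.
Qed.

Lemma hausdorff2_sigma_subadditive (R : realType) :
  sigma_subadditive (@hausdorff2 R).
Proof.
move=> F; apply: ge_ereal_sup => _ [delta d0 <-].
apply: (@le_trans _ _
    (\sum_(n <oo) mu_ext (hausdorff_gauge delta) (F n))%E).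
  by apply: mu_ext_sigma_subadditive => A; exact: hausdorff_gauge_ge0.
apply: lee_nneseries => [n _|n _].
  by move=> _; apply: mu_ext_ge0 => A; exact: hausdorff_gauge_ge0.
by apply: ereal_sup_ubound; exists delta.
Qed.

HB.instance Definition _ (R : realType) := isOuterMeasure.Build R (R3 R)
  (@hausdorff2 R) (@hausdorff2_0 R) (@hausdorff2_ge0 R) (@le_hausdorff2 R)
  (@hausdorff2_sigma_subadditive R).

Lemma le_hausdorff_gauge (R : realType) (d1 d2 : R) (A : set (R3 R)) :
  d1 <= d2 -> (hausdorff_gauge d2 A <= hausdorff_gauge d1 A)%E.
Proof.
move=> d12; rewrite /hausdorff_gauge.
case: (boolP (ediam A <= d1%:E)%E) => [h1|_]; last exact: leey.
by rewrite (le_trans h1) ?lee_fin.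
Qed.

Lemma ediam_ge (R : realType) (A : set (R3 R)) x y : A x -> A y ->
  ((enorm (x - y))%:E <= ediam A)%E.
Proof. by move=> Ax Ay; apply: ereal_sup_ubound; right; exists x => //; exists y. Qed.

Lemma hausdorff2_metric (R : realType) (A B : set (R3 R)) (c : R) : 0 < c ->
  (forall x y, A x -> B y -> c <= enorm (x - y)) ->
  (hausdorff2 A + hausdorff2 B <= hausdorff2 (A `|` B))%E.
Proof.
move=> c0 AB.
have ge0 (d : R) C : (0 <= mu_ext (hausdorff_gauge d) C)%E.
  by apply: mu_ext_ge0 => D; exact: hausdorff_gauge_ge0.
have key (d1 d2 : R) : 0 < d1 -> 0 < d2 ->
    (mu_ext (hausdorff_gauge d1) A + mu_ext (hausdorff_gauge d2) B <=
     hausdorff2 (A `|` B))%E.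
  move=> d10 d20; pose d := Num.min (Num.min d1 d2) (c / 2).
  have d0 : 0 < d by rewrite !lt_min d10 d20 divr_gt0.
  have dd1 : d <= d1 by rewrite !ge_min lexx.
  have dd2 : d <= d2 by rewrite !ge_min lexx orbT.
  have dc : d < c.
    by rewrite gt_min [X in _ || X](_ : _ = true) ?orbT // gtr_pMr // invf_lt1 // ltr1n.
  apply: (@le_trans _ _ (mu_ext (hausdorff_gauge d) (A `|` B))); last first.
    by apply: ereal_sup_ubound; exists d.
  apply: le_ereal_inf_tmp => _ [F [mF ABF] <-].
  pose G (C : set (R3 R)) k := if pselect (C `&` F k !=set0) then F k else set0.
  have mG C k : measurable (G C k).
    by rewrite /G; case: pselect => h; [exact: mF|exact: measurable0].
  have covG C : C `<=` A `|` B -> C `<=` \bigcup_k G C k.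
    move=> CAB x Cx; have [k _ Fkx] := ABF _ (CAB _ Cx); exists k => //.
    by rewrite /G; case: pselect => // h; case: h; exists x.
  have Gle C e : 0 < e -> d <= e -> C `<=` A `|` B ->
      (mu_ext (hausdorff_gauge e) C <=
       \sum_(k <oo) hausdorff_gauge d (G C k))%E.
    move=> e0 de CAB.
    apply: (@le_trans _ _ (\sum_(k <oo) hausdorff_gauge e (G C k))%E).
      by apply: ereal_inf_lbound; exists (G C) => //; split => //; exact: covG.
    apply: lee_nneseries => [k _ _|k _]; first exact: hausdorff_gauge_ge0.
    exact: le_hausdorff_gauge.
  apply: (le_trans (leeD (Gle A _ d10 dd1 _) (Gle B _ d20 dd2 _))).
  - exact: subsetUl.
  - exact: subsetUr.
  rewrite -nneseriesD; last 2 first.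
  - by move=> k _ _; exact: hausdorff_gauge_ge0.
  - by move=> k _ _; exact: hausdorff_gauge_ge0.
  apply: lee_nneseries => [k _ _|k _].
    by apply: adde_ge0; exact: hausdorff_gauge_ge0.
  rewrite /G; case: pselect => [[x [Ax Fx]]|nA]; last first.
    rewrite hausdorff_gauge0 // add0e.
    case: pselect => // nB; rewrite hausdorff_gauge0 //.
    exact: hausdorff_gauge_ge0.
  case: pselect => [[y [By Fy]]|nB]; last by rewrite hausdorff_gauge0 // adde0.
  rewrite [leRHS](_ : _ = +oo%E) ?leey // /hausdorff_gauge ifF //.
  apply/negbTE; rewrite -ltNge; apply: lt_le_trans (ediam_ge Fx Fy).
  by rewrite lte_fin (lt_le_trans dc) // AB.
have [->|] := eqVneq (hausdorff2 (A `|` B)) +oo%E; first exact: leey.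
move=> fin; have {}fin : hausdorff2 (A `|` B) \is a fin_num.
  by rewrite ge0_fin_numE ?hausdorff2_ge0 // lt_neqAle fin leey.
have finle (x y z : \bar R) : (0 <= x)%E -> (0 <= y)%E -> z \is a fin_num ->
    (x + y <= z -> y \is a fin_num)%E.
  move=> x0 y0 zfin xyz; rewrite ge0_fin_numE //.
  apply: (@le_lt_trans _ _ z); last by rewrite ltey_eq zfin.
  by apply: le_trans xyz; rewrite leeDr.
have finB d : 0 < d -> mu_ext (hausdorff_gauge d) B \is a fin_num.
  by move=> d0; apply: (finle _ _ _ _ _ fin (key d d d0 d0)).
have step d2 : 0 < d2 ->
    (hausdorff2 A + mu_ext (hausdorff_gauge d2) B <= hausdorff2 (A `|` B))%E.
  move=> d20; rewrite -leeBrDr ?finB //.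
  apply: ge_ereal_sup => _ [d1 d10 <-].
  by rewrite leeBrDr ?finB // key.
have finA : hausdorff2 A \is a fin_num.
  have := step 1 ltr01; rewrite addeC => h.
  by apply: (finle _ _ _ _ _ fin h) => //; exact: hausdorff2_ge0.
rewrite addeC -leeBrDr //; apply: ge_ereal_sup => _ [d2 d20 <-].
by rewrite leeBrDr // addeC step.
Qed.

Lemma hausdorff2_halfspace (R : realType) (f : R3 R -> R) (a : R) :
  (forall x y, f x - f y <= enorm (x - y)) ->
  caratheodory_measurable (@hausdorff2 R) [set x | a < f x].
Proof.
move=> lip; apply: le_caratheodory_measurable => X.
set E := [set x | a < f x].
suff h : (hausdorff2 (X `&` E) + hausdorff2 (X `&` ~` E) <= hausdorff2 X)%E.
  exact: h.
have [->|] := eqVneq (hausdorff2 X) +oo%E; first exact: leey.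
move=> fin; have {fin} Xoo : (hausdorff2 X < +oo)%E.
  by rewrite lt_neqAle fin leey.
pose e (n : nat) : R := n.+1%:R^-1.
have e0 n : 0 < e n by rewrite invr_gt0.
have eS m n : (m < n)%N -> e n < e m.
  by move=> mn; rewrite ltf_pV2 ?posrE // ltr_nat.
have ele m n : (m <= n)%N -> e n <= e m.
  by move=> mn; rewrite lef_pV2 ?posrE // ler_nat.
pose P n := X `&` [set x | a + e n <= f x].
pose Q n := X `&` [set x | a + e n.+1 <= f x < a + e n].
pose S b N := [set x | exists k, [/\ (k < N)%N, odd k = b & Q k x]].
have S0 b : S b 0%N = set0 by rewrite -subset0 => x [k []].
have SN b N : odd N = ~~ b -> S b N.+1 = S b N.
  move=> oN; apply/seteqP; split => x [k [kN ok Qk]]; exists k; split => //.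
    rewrite ltn_neqAle -ltnS kN andbT; apply: contraPneq ok => ->.
    by rewrite oN; case: (b).
  exact: ltnW.
have SS N : (hausdorff2 (S (odd N) N) + hausdorff2 (Q N) <=
    hausdorff2 (S (odd N) N.+1))%E.
  apply: (@le_trans _ _ (hausdorff2 (S (odd N) N `|` Q N))).
    case: N => [|N]; first by rewrite S0 set0U hausdorff2_0 add0e.
    apply: (@hausdorff2_metric _ _ _ (e N - e N.+1)).
      by rewrite subr_gt0 eS.
    move=> x y [k [kN ok [_ /andP[fx _]]]] [_ /andP[_ fy]].
    apply: le_trans (lip x y).
    have kN' : (k.+1 < N.+1)%N.
      rewrite ltn_neqAle kN andbT; apply: contraPneq ok => <- /=.
      by case: (odd k).
    by have := ele k.+1 N kN'; lra.
  apply: le_hausdorff2 => x [[k [kN ok Qk]]|QN].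
    by exists k; split => //; exact: ltnW.
  by exists N; split.
have sumQ N : (\sum_(k < N) hausdorff2 (Q k) <=
    hausdorff2 (S true N) + hausdorff2 (S false N))%E.
  elim: N => [|N IH]; first by rewrite big_ord0 adde_ge0 ?hausdorff2_ge0.
  rewrite big_ord_recr /=; apply: le_trans (leeD2r _ IH) _.
  have := SS N; case: (boolP (odd N)) => oN SSN.
    by rewrite (SN false) ?oN // addeAC leeD2r.
  by rewrite (SN true) ?(negbTE oN) // -addeA leeD2l.
have sumX : (\sum_(k <oo) hausdorff2 (Q k) < +oo)%E.
  apply: (@le_lt_trans _ _ (hausdorff2 X + hausdorff2 X)%E); last first.
    by rewrite lte_add_pinfty.
  apply: lime_le; first by apply: is_cvg_nneseries => *; exact: hausdorff2_ge0.
  near=> N; rewrite big_mkord; apply: le_trans (sumQ N) _.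
  by apply: leeD; apply: le_hausdorff2 => x [k [_ _ []]].
have QE n : (hausdorff2 (X `&` E) <=
    hausdorff2 (P n) + \sum_(n <= k <oo) hausdorff2 (Q k))%E.
  rewrite -nneseries_addn; last by move=> *; exact: hausdorff2_ge0.
  apply: (@le_trans _ _ (hausdorff2 (P n `|` \bigcup_k Q (k + n)%N))).
    apply: le_hausdorff2 => x [Xx /= ax].
    have [Pn|nPn] := leP (a + e n) (f x); [by left|right].
    have exk : exists k, a + e (k + n).+1 <= f x.
      have [k ek] : exists k, e k < f x - a.
        have fa : 0 < f x - a by rewrite subr_gt0.
        exists (Num.truncn (f x - a)^-1); rewrite /e invf_plt ?posrE //.
        exact: truncnS_gt.
      exists k; have := ele k (k + n).+1 (ltnW (leq_addr _ _)); lra.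
    case: (ex_minnP exk) => k ak mink; exists k => //; split => //=.
    rewrite ak /=; case: k ak mink => [//|k] _ mink.
    by rewrite addSn ltNge; apply: contraT => /negPn /mink; rewrite ltnn.
  apply: le_trans (outer_measureU2 _ _ _) _; apply: leeD2l.
  exact: outer_measure_sigma_subadditive.
have PX n : (hausdorff2 (P n) + hausdorff2 (X `&` ~` E) <=
    hausdorff2 X)%E.
  apply: (@le_trans _ _ (hausdorff2 (P n `|` X `&` ~` E))).
    apply: (hausdorff2_metric (e0 n)) => x y [_ /= fx] [_ /= /negP].
    by rewrite -leNgt => fy; apply: le_trans (lip x y); lra.
  by apply: le_hausdorff2 => x [[]|[]].
apply/lee_addgt0Pr => eps eps0.
have tail := nneseries_tail_cvg sumX (fun k _ => hausdorff2_ge0 (Q k)).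
have [n tn] : exists n, (\sum_(n <= k <oo) hausdorff2 (Q k) <= eps%:E)%E.
  have /fine_cvgP[tfin /cvgrPdist_le /(_ eps eps0) tle] := tail.
  have [n _ /(_ n (leqnn n)) [/= nfin nle]] := filterI tfin tle.
  exists n; rewrite -(fineK nfin) lee_fin.
  by move: nle; rewrite sub0r normrN; apply: le_trans; exact: ler_norm.
apply: le_trans (leeD2r _ (QE n)) _.
by rewrite addeAC; apply: leeD => //; exact: PX.
Unshelve. all: by end_near.
Qed.

Lemma borel_caratheodory (R : realType) (A : set (R3 R)) :
  measurable A -> caratheodory_measurable (@hausdorff2 R) A.
Proof.
move=> mA.
have coord (f : caratheodory_type (@hausdorff2 R) -> R) :
    (forall x y : R3 R, f x - f y <= enorm (x - y)) -> measurable_fun setT f.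
  move=> lip.
  refine (@measurability _ _ _ _ _ _ _ (RGenOInfty.measurableE R) _).
  move=> _ [_ [a ->] <-]; rewrite setTI.
  suff -> : f @^-1` `]a, +oo[ = [set x : R3 R | a < f x].
    exact: hausdorff2_halfspace.
  by apply/seteqP; split => x /=; rewrite in_itv/= andbT.
have le_sqrt (u c : R) : u * u <= c -> u <= Num.sqrt c.
  move=> uc; apply: le_trans (ler_norm u) _.
  by rewrite -sqrtr_sqr ler_wsqrtr // expr2.
have mid : measurable_fun setT
    (fun x : caratheodory_type (@hausdorff2 R) => (x : R3 R)).
  apply/measurable_fun_pairP; split; first (apply/measurable_fun_pairP; split);
    apply: coord => x y; apply: le_sqrt; rewrite /dot /= -!expr2;
    have := sqr_ge0 (x.1.1 - y.1.1); have := sqr_ge0 (x.1.2 - y.1.2);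
    have := sqr_ge0 (x.2 - y.2); lra.
by have := mid measurableT A mA; rewrite setTI.
Qed.

(* [hausdorff2] again, under a name that carries a measure structure on the
   Borel sets. *)
Definition surf (R : realType) (A : set (R3 R)) : \bar R := hausdorff2 A.

Lemma surf_sigma_additive (R : realType) : semi_sigma_additive (@surf R).
Proof.
move=> F mF tF mU.
apply: (@caratheodory_measure_sigma_additive _ _ (@hausdorff2 R)) => //.
- by move=> i; exact: borel_caratheodory.
- exact: borel_caratheodory.
Qed.

HB.instance Definition _ (R : realType) := isMeasure.Build _ _ _ (@surf R)
  (@hausdorff2_0 R) (@hausdorff2_ge0 R) (@surf_sigma_additive R).

Definition phase_measure (R : realType) : set (R3 R * R3 R) -> \bar R :=
  (@vol3 R \x @sphere_measure R)%E.

HB.instance Definition _ (R : realType) := Measure.on (@phase_measure R).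
HB.instance Definition _ (R : realType) := Measure_isSigmaFinite.Build _ _ _
  (@phase_measure R) (product_sigma_finite (@vol3 R) (@sphere_measure R)).

Definition bd_measure (R : realType) : set (R3 R * R3 R) -> \bar R :=
  (@surf R \x @sphere_measure R)%E.

HB.instance Definition _ (R : realType) := Measure.on (@bd_measure R).

Definition phase (R : realType) (Om : set (R3 R)) : set (R3 R * R3 R) :=
  Om `*` @sphere R.

Definition bd_phase (R : realType) (Om : set (R3 R)) : set (R3 R * R3 R) :=
  boundary Om `*` @sphere R.

Definition L2 d (T : measurableType d) (R : realType)
    (mu : {measure set T -> \bar R}) (D : set T) : set (T -> R) :=
  [set u : T -> R | measurable_fun D u /\
    (\int[mu]_(x in D) (u x ^+ 2)%:E < +oo)%E].

Definition ip d (T : measurableType d) (R : realType)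
    (mu : {measure set T -> \bar R}) (D : set T) (u v : T -> R) : R :=
  \int[mu]_(x in D) (u x * v x).

Definition l2norm d (T : measurableType d) (R : realType)
    (mu : {measure set T -> \bar R}) (D : set T) (u : T -> R) : R :=
  Num.sqrt (ip mu D u u).

Notation L2_phase Om := (L2 (@phase_measure _) (phase Om)).
Notation ip_phase Om := (ip (@phase_measure _) (phase Om)).
Notation l2norm_phase Om := (l2norm (@phase_measure _) (phase Om)).
Notation L2_bd Om := (L2 (@bd_measure _) (bd_phase Om)).
Notation ip_bd Om := (ip (@bd_measure _) (bd_phase Om)).
Notation l2norm_bd Om := (l2norm (@bd_measure _) (bd_phase Om)).

Definition ae_phase_eq (R : realType) (Om : set (R3 R))
    (u v : R3 R * R3 R -> R) : Prop :=
  {ae @phase_measure R, forall x, phase Om x -> u x = v x}.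

Definition even_fun (R : realType) (Om : set (R3 R)) (v : R3 R * R3 R -> R) :=
  ae_phase_eq Om (fun x => v (x.1, - x.2)) v.

Definition odd_fun (R : realType) (Om : set (R3 R)) (v : R3 R * R3 R -> R) :=
  ae_phase_eq Om (fun x => v (x.1, - x.2)) (fun x => - v x).

Definition even_part (R : realType) (v : R3 R * R3 R -> R) :
    R3 R * R3 R -> R := fun x => (v x + v (x.1, - x.2)) / 2.

Definition odd_part (R : realType) (v : R3 R * R3 R -> R) :
    R3 R * R3 R -> R := fun x => (v x - v (x.1, - x.2)) / 2.

(* Test functions on Om x S: only derivatives in the position variable enter
   the weak derivative, and C^1 test functions determine the same one as smooth
   test functions. *)
Definition test_fun (R : realType) (Om : set (R3 R))
    (phi : R3 R * R3 R -> R) : Prop :=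
  [/\ continuous phi,
      forall x v, derivable phi x (v, 0),
      forall v, continuous (fun x => 'D_(v, 0) phi x) &
      exists K : set (R3 R), [/\ compact K, K `<=` Om &
        forall x, ~ K x.1 -> phi x = 0]].

(* d is the weak derivative of u in the position variable in direction s. *)
Definition is_sgrad (R : realType) (Om : set (R3 R))
    (u d : R3 R * R3 R -> R) : Prop :=
  forall phi, test_fun Om phi ->
    ip_phase Om u (fun x => 'D_(x.2, 0) phi x) = - ip_phase Om d phi.

Definition W2 (R : realType) (Om : set (R3 R)) : set (R3 R * R3 R -> R) :=
  [set u | L2_phase Om u /\ exists d, L2_phase Om d /\ is_sgrad Om u d].

Definition sgrad (R : realType) (Om : set (R3 R)) (u : R3 R * R3 R -> R) :
    R3 R * R3 R -> R :=
  xget (fun=> 0) [set d | L2_phase Om d /\ is_sgrad Om u d].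

(* Boundary values along characteristics: for almost every boundary point (r, s)
   the line through r in direction s enters the domain on one side e = 1 or
   e = -1, and g (r, s) is the limit, in the mean, of u on that side. *)
Definition is_trace (R : realType) (Om : set (R3 R))
    (u g : R3 R * R3 R -> R) : Prop :=
  {ae @bd_measure R, forall x, bd_phase Om x ->
    exists e : R, [/\ e = 1 \/ e = -1,
      \forall t \near 0^'+, Om (x.1 + (e * t) *: x.2) &
      (((t : R)^-1)%:E * \int[@leb R]_(tau in `]0%R, t[)
         `|u (x.1 + (e * tau) *: x.2, x.2) - g x|%:E)%E @[t --> 0^'+]
        --> 0%E]}.

Definition trace (R : realType) (Om : set (R3 R)) (u : R3 R * R3 R -> R) :
    R3 R * R3 R -> R :=
  xget (fun=> 0) [set g | L2_bd Om g /\ is_trace Om u g].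

Definition Wplus (R : realType) (Om : set (R3 R)) : set (R3 R * R3 R -> R) :=
  [set u | [/\ W2 Om u, even_fun Om u &
    exists g, L2_bd Om g /\ is_trace Om u g]].

Definition Vminus (R : realType) (Om : set (R3 R)) : set (R3 R * R3 R -> R) :=
  [set v | L2_phase Om v /\ odd_fun Om v].

Definition tnorm (R : realType) (Om : set (R3 R))
    (up um : R3 R * R3 R -> R) : R :=
  Num.sqrt (l2norm_phase Om (sgrad Om up) ^+ 2 + l2norm_bd Om (trace Om up) ^+ 2
    + l2norm_phase Om up ^+ 2 + l2norm_phase Om um ^+ 2).

Definition fin_dim_subspace (T : Type) (R : realType) (V : set (T -> R)) :=
  exists (n : nat) (b : 'I_n -> T -> R),
    V = [set v : T -> R | exists c : 'I_n -> R, v = fun x => \sum_(i < n) c i * b i x].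

Definition bounded_convex_domain (R : realType) (Om : set (R3 R)) : Prop :=
  [/\ open Om, Om !=set0, bounded_set Om &
      convex_set (Om : set (convex_lmodType (R3 R)))].

Definition absorption_ok (R : realType) (Om : set (R3 R)) (mu : R3 R -> R)
    (mubar : R) : Prop :=
  measurable_fun Om mu /\
  {ae @vol3 R, forall r, Om r -> 0 <= mu r <= mubar}.

Definition kernel_dom (R : realType) (Om : set (R3 R)) : set (R3 R * R) :=
  Om `*` `]-1, 1[%classic.

Definition scattering_ok (R : realType) (Om : set (R3 R)) (mu : R3 R -> R)
    (k : R3 R -> R -> R) (kbar : R) : Prop :=
  [/\ measurable_fun (kernel_dom Om) (fun x => k x.1 x.2),
      {ae (@vol3 R \x @leb R)%E, forall x,
        kernel_dom Om x -> 0 <= k x.1 x.2 <= kbar} &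
      {ae @phase_measure R, forall x, phase Om x ->
        (\int[@sphere_measure R]_(s in @sphere R) (k x.1 (dot x.2 s))%:E
          <= (mu x.1)%:E)%E}].

Definition entry_length (R : realType) (Om : set (R3 R)) (r s : R3 R) :
    \bar R :=
  ereal_inf [set l%:E | l in [set l : R | 0 < l /\ Om (r - l *: s)]].

Definition outer_unit_normal (R : realType) (Om : set (R3 R)) (r n : R3 R) :=
  enorm n = 1 /\ forall y, Om y -> dot (y - r) n <= 0.

(* The outer unit normal of a convex domain is unique at almost every boundary
   point. *)
Definition extended_domain (R : realType) (Om Oml : set (R3 R)) (l eta : R) :
    Prop :=
  [/\ bounded_convex_domain Oml, compact (closure Om), closure Om `<=` Oml,
      {ae @bd_measure R, forall x, bd_phase Oml x ->
        (l%:E <= entry_length Om x.1 x.2)%E} &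
      {ae @bd_measure R, forall x, bd_phase Oml x ->
        forall n, outer_unit_normal Oml x.1 n -> dot x.2 n <= eta ->
        entry_length Om x.1 x.2 = +oo%E}].

Definition absorption_ext (R : realType) (Om : set (R3 R)) (a : R)
    (mu : R3 R -> R) (r : R3 R) : R := if r \in Om then mu r else a.

Definition scattering_ext (R : realType) (Om : set (R3 R))
    (k : R3 R -> R -> R) (r : R3 R) (t : R) : R :=
  if r \in Om then k r t else 0.

Definition scattering (R : realType) (Om : set (R3 R)) (k : R3 R -> R -> R)
    (u : R3 R * R3 R -> R) : R3 R * R3 R -> R :=
  fun x => \int[@sphere_measure R]_(s in @sphere R)
    (scattering_ext Om k x.1 (dot x.2 s) * u (x.1, s)).

Definition collision (R : realType) (Om : set (R3 R)) (a : R) (mu : R3 R -> R)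
    (k : R3 R -> R -> R) (v : R3 R * R3 R -> R) : R3 R * R3 R -> R :=
  fun x => absorption_ext Om a mu x.1 * v x - scattering Om k v x.

Definition collision_bounds (R : realType) (Oml : set (R3 R))
    (C : (R3 R * R3 R -> R) -> R3 R * R3 R -> R) (gamma Gamma : R) : Prop :=
  forall v, L2_phase Oml v ->
    gamma * l2norm_phase Oml v ^+ 2 <= ip_phase Oml (C v) v
      <= Gamma * l2norm_phase Oml v ^+ 2.

(* The mixed variational problem with trial and test space W x V: the
   continuous problem for W = Wplus and V = Vminus, the Galerkin problem for
   their finite-dimensional subspaces. *)
Definition mixed_solution (R : realType) (Om : set (R3 R))
    (C : (R3 R * R3 R -> R) -> R3 R * R3 R -> R) (q : R3 R * R3 R -> R)
    (W V : set (R3 R * R3 R -> R)) (wp wm : R3 R * R3 R -> R) : Prop :=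
  [/\ W wp, V wm,
      forall vp, W vp ->
        ip_phase Om (C wp) vp + ip_bd Om (trace Om wp) (trace Om vp)
        - ip_phase Om wm (sgrad Om vp) = ip_phase Om (even_part q) vp &
      forall vm, V vm ->
        ip_phase Om (sgrad Om wp) vm + ip_phase Om (C wm) vm
        = ip_phase Om (odd_part q) vm].

Definition galerkin_spaces (R : realType) (Om : set (R3 R))
    (Wh Vh : set (R3 R * R3 R -> R)) : Prop :=
  [/\ fin_dim_subspace Wh, Wh `<=` Wplus Om,
      fin_dim_subspace Vh, Vh `<=` Vminus Om &
      forall w, Wh w -> exists2 v, Vh v & ae_phase_eq Om v (sgrad Om w)].

Definition at_most_linear (R : realType) (C : R -> R -> R) : Prop :=
  exists c : R, forall gamma Gamma, 0 < gamma -> 0 < Gamma ->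
    C gamma Gamma <= c * (1 + gamma^-1 + Gamma).

(* Main.v *)
(* Write a(u, v) = (C u, v), a symmetric form on L^2 that lies between
   gamma |.|^2 and Gamma |.|^2. Testing the mixed problem with its own solution
   bounds the energy E^2 = a(w^+, w^+) + a(w^-, w^-) + |w^+|^2_{boundary} by
   |q| |w|, hence E by 2 gamma^{-1/2} |q|; testing the second equation with
   s.grad w^+, which the compatibility condition allows, gives
   |s.grad w^+| <= |q| + Gamma^{1/2} E. The factor (Gamma / gamma)^{1/2}
   that arises is at most (Gamma + gamma^{-1}) / 2: this is why Cauchy-Schwarz
   is used for a and not for C. Galerkin orthogonality turns the same two tests,
   applied to v_h - w_h, into quasi-optimality.

   Behind these estimates are: the symmetry of a, by Fubini; the uniqueness of
   the weak derivative, by approximating indicators of boxes by test functions;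
   its oddness for even functions; and the uniqueness of boundary values, by
   convexity, as a line enters the domain at a boundary point from one side
   only. *)

Require Import Defs.
From HB Require Import structures.
From mathcomp Require Import all_boot all_order all_algebra.
From mathcomp Require Import all_classical all_reals all_analysis.
From mathcomp Require Import measurable_realfun ring lra.

Set Implicit Arguments.
Unset Strict Implicit.
Unset Printing Implicit Defensive.
Import Order.TTheory GRing.Theory Num.Theory.
Import numFieldNormedType.Exports.
Local Open Scope classical_set_scope.
Local Open Scope ring_scope.

(** * Square-integrable functions *)

(** Elements of the spaces are genuine functions, and [sgrad] and [trace] choose representatives, so
    that identities between them hold only almost everywhere. The estimates are therefore carried
    out in an abstract module, with forms that are merely semidefinite on prescribed subsets:
    elements of norm zero replace 0, and the gradient is linear only after pairing with an element
    of [L]. The collision operator enters only through its form. Trial and test spaces are a generic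
    pair [X], [Y]. One proof thus covers the discrete and the full spaces, and both a-priori bounds
    get literally the same constant. Existence is linear algebra with a matrix that may be singular,
    as the generating families may be dependent; it rests on the fact that the data vanish on
    elements of energy zero. Adding the bounds on the four parts of the norm and applying the
    arithmetic-geometric mean inequality to 1, [Gamma^(1/2)] and [gamma^(-1/2)] leaves 6 as the
    largest coefficient for stability and 12.5, rounded up to 13, for quasi-optimality. *)

Section L2_theory.
Context d (T : measurableType d) (R : realType).
Variables (mu : {measure set T -> \bar R}) (D : set T).
Hypothesis mD : measurable D.
Implicit Types u v w : T -> R.

Lemma L2_mul_integrable u v : L2 mu D u -> L2 mu D v ->
  mu.-integrable D (EFin \o (fun x => u x * v x)).
Proof.
move=> [mu_ u2] [mv v2].
have mu2 : measurable_fun D (fun x => (u x ^+ 2)%:E).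
  by apply/measurable_EFinP; exact: measurable_funX.
have mv2 : measurable_fun D (fun x => (v x ^+ 2)%:E).
  by apply/measurable_EFinP; exact: measurable_funX.
have iu : mu.-integrable D (fun x => (u x ^+ 2)%:E).
  apply/integrableP; split => //.
  by under eq_integral do rewrite gee0_abs ?lee_fin ?sqr_ge0 //.
have iv : mu.-integrable D (fun x => (v x ^+ 2)%:E).
  apply/integrableP; split => //.
  by under eq_integral do rewrite gee0_abs ?lee_fin ?sqr_ge0 //.
apply: (le_integrable mD _ _ (integrableD mD iu iv)).
  by apply/measurable_EFinP; exact: measurable_funM.
move=> x _ /=; rewrite lee_fin.
rewrite [leRHS]ger0_norm ?addr_ge0 ?sqr_ge0 // normrM.
have := sqr_ge0 (`|u x| - `|v x|); rewrite -(real_normK (num_real (u x))).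
rewrite -(real_normK (num_real (v x))).
have := sqr_ge0 (`|u x|); have := sqr_ge0 (`|v x|).
by rewrite !expr2; nra.
Qed.

Lemma L2_lin c u v : L2 mu D u -> L2 mu D v ->
  L2 mu D (fun x => c * u x + v x).
Proof.
move=> Lu Lv; have [mu_ _] := Lu; have [mv _] := Lv.
have mcu : measurable_fun D (fun x => c * u x + v x).
  by apply: measurable_funD => //; exact: measurable_funM.
split => //.
have iuu := L2_mul_integrable Lu Lu; have ivv := L2_mul_integrable Lv Lv.
have iuv := L2_mul_integrable Lu Lv.
have : mu.-integrable D (fun x => (c ^+ 2)%:E * (u x * u x)%:E +
    ((2 * c)%:E * (u x * v x)%:E + (v x * v x)%:E))%E.
  apply: integrableD => //; first exact: integrableZl.
  by apply: integrableD => //; exact: integrableZl.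
move/integrableP => [_]; apply: le_lt_trans; apply: ge0_le_integral => //.
- by move=> x _; rewrite lee_fin sqr_ge0.
- by apply/measurable_EFinP; exact: measurable_funX.
- apply/measurable_EFinP; apply: measurableT_comp => //.
  apply: measurable_funD; first by do ![apply: measurable_funM => //].
  by apply: measurable_funD; do ![apply: measurable_funM => //].
- move=> x _; rewrite lee_fin; apply: le_trans (ler_norm _).
  by rewrite le_eqVlt; apply/orP; left; apply/eqP; ring.
Qed.

Lemma L2_0 : L2 mu D (fun=> 0).
Proof.
split; first exact: measurable_cst.
by under eq_integral do rewrite expr0n; rewrite integral0.
Qed.

Lemma L2_scale c u : L2 mu D u -> L2 mu D (fun x => c * u x).
Proof.
move=> Lu; have := L2_lin c Lu L2_0.
by congr L2; apply/funext => x; rewrite addr0.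
Qed.

Lemma L2_sub u v : L2 mu D u -> L2 mu D v -> L2 mu D (u \- v).
Proof.
move=> Lu Lv; have := L2_lin (-1) Lv Lu.
by congr L2; apply/funext => x /=; ring.
Qed.

Lemma ipC u v : ip mu D u v = ip mu D v u.
Proof. by rewrite /ip; under eq_Rintegral do rewrite mulrC. Qed.

Lemma ip_linl c u v w : L2 mu D u -> L2 mu D v -> L2 mu D w ->
  ip mu D (fun x => c * u x + v x) w = c * ip mu D u w + ip mu D v w.
Proof.
move=> Lu Lv Lw; rewrite /ip -RintegralZl //; last exact: L2_mul_integrable.
rewrite -RintegralD //; last exact: L2_mul_integrable.
- by apply: eq_Rintegral => x _; ring.
- rewrite (_ : _ \o _ = fun x => (c%:E * (u x * w x)%:E)%E) //.
  by apply: integrableZl => //; exact: L2_mul_integrable.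
Qed.

Lemma ip_linr c u v w : L2 mu D u -> L2 mu D v -> L2 mu D w ->
  ip mu D w (fun x => c * u x + v x) = c * ip mu D w u + ip mu D w v.
Proof. by move=> Lu Lv Lw; rewrite ipC ip_linl // !(ipC _ w). Qed.

Lemma ip_ge0 u : 0 <= ip mu D u u.
Proof. by apply: Rintegral_ge0 => x _; rewrite -expr2 sqr_ge0. Qed.

Lemma l2norm_sqr u : l2norm mu D u ^+ 2 = ip mu D u u.
Proof. by rewrite /l2norm sqr_sqrtr // ip_ge0. Qed.

Lemma l2norm_ge0 u : 0 <= l2norm mu D u.
Proof. exact: sqrtr_ge0. Qed.

Lemma ip_aeq u u' v v' : L2 mu D u -> L2 mu D u' -> L2 mu D v -> L2 mu D v' ->
  {ae mu, forall x, D x -> u x = u' x} -> {ae mu, forall x, D x -> v x = v' x} ->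
  ip mu D u v = ip mu D u' v'.
Proof.
move=> Lu Lu' Lv Lv' uu' vv'; congr fine; apply: ae_eq_integral => //.
- by have /measurable_int := L2_mul_integrable Lu Lv.
- by have /measurable_int := L2_mul_integrable Lu' Lv'.
- by apply: filterS2 uu' vv' => x ux vx Dx; rewrite ux // vx.
Qed.

Lemma ip_eq0_ae u : L2 mu D u -> ip mu D u u = 0 ->
  {ae mu, forall x, D x -> u x = 0}.
Proof.
move=> Lu u0.
have iu := L2_mul_integrable Lu Lu.
have : (\int[mu]_(x in D) `|(u x * u x)%:E| = 0)%E.
  under eq_integral do rewrite gee0_abs ?lee_fin -?expr2 ?sqr_ge0 //.
  rewrite -(@fineK _ (\int[mu]_(x in D) _)%E); last first.
    have := integrable_fin_num mD iu; rewrite /=.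
    by under eq_integral do rewrite -expr2.
  move: u0; rewrite /ip /Rintegral; under eq_integral do rewrite -expr2.
  by move=> ->.
move/(ae_eq_integral_abs _ mD (measurable_int _ iu)).
apply: filterS => x /= h Dx.
by have /eqP := h Dx; rewrite eqe mulf_eq0 orbb => /eqP.
Qed.

End L2_theory.

(** A vanishing leading coefficient is allowed, so that Cauchy-Schwarz follows for forms that are
    only semidefinite. *)
Lemma discriminant_le (R : realFieldType) (a b c : R) : 0 <= a ->
  (forall t, 0 <= t ^+ 2 * a + 2 * t * b + c) -> b ^+ 2 <= a * c.
Proof.
move=> a0 h; have [a_eq0|a_neq0] := eqVneq a 0.
  move: h; rewrite a_eq0 mul0r; have [->|b0] := eqVneq b 0.
    by move=> _; rewrite expr0n.
  (* With [a = 0] the polynomial is affine of slope [2 * b]; at this point its value would be -1. *)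
  move=> /(_ (- (c + 1) / (2 * b))).
  rewrite (_ : _ + _ = -1); first by rewrite lerNr oppr0 ler10.
  by field.
have {}a0 : 0 < a by rewrite lt_neqAle eq_sym a_neq0.
have := h (- b / a).
rewrite (_ : _ + _ = (a * c - b ^+ 2) / a); last by field.
by rewrite pmulr_lge0 ?invr_gt0 // subr_ge0.
Qed.

Lemma cauchy_schwarz_L2 d (T : measurableType d) (R : realType)
    (mu : {measure set T -> \bar R}) (D : set T) (mD : measurable D)
    (u v : T -> R) : L2 mu D u -> L2 mu D v ->
  `|ip mu D u v| <= l2norm mu D u * l2norm mu D v.
Proof.
move=> Lu Lv.
rewrite -ler_sqr ?nnegrE ?mulr_ge0 ?l2norm_ge0 //.
rewrite real_normK ?num_real // exprMn !l2norm_sqr.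
apply: discriminant_le (ip_ge0 _ _ _) _ => t.
have := ip_ge0 mu D (fun x => t * u x + v x).
rewrite ip_linl // ?ip_linr //; try exact: L2_lin.
by rewrite (ipC _ _ v u); congr (_ <= _); ring.
Qed.

(** * Phase space *)

Lemma bigcup_countType_measurable d (T : measurableType d) (I : countType)
    (P : set I) (F : I -> set T) : (forall i, P i -> measurable (F i)) ->
  measurable (\bigcup_(i in P) F i).
Proof.
move=> mF; rewrite bigcup_mkcond; apply: countable_bigcupT_measurable => //.
by move=> i; case: ifPn => // /set_mem; exact: mF.
Qed.

(* The sets [B i] of the family need not be open; their parts [A i] already
   cover every open set, so one may take [A i] open and [B i] compact. *)
Definition countable_base (T : topologicalType) (I : Type) (A B : I -> set T) :=
  forall (U : set T) x, open U -> U x -> exists i, A i x /\ B i `<=` U.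

Lemma countable_base_prod (T1 T2 : topologicalType) (I1 I2 : Type)
    (A1 B1 : I1 -> set T1) (A2 B2 : I2 -> set T2) :
  countable_base A1 B1 -> countable_base A2 B2 ->
  countable_base (fun i : I1 * I2 => A1 i.1 `*` A2 i.2)
    (fun i : I1 * I2 => B1 i.1 `*` B2 i.2).
Proof.
move=> b1 b2 U [x y] oU Uxy.
have /= := open_nbhs_nbhs (conj oU Uxy).
move=> [[/= P Q] [/= nP nQ] PQU].
have [i [Ai Bi]] := b1 P° x (open_interior P) nP.
have [j [Aj Bj]] := b2 Q° y (open_interior Q) nQ.
exists (i, j); split; first by split.
move=> -[u v] [/= Bu Bv]; apply: PQU; split => /=.
  by apply: interior_subset; exact: Bi.
by apply: interior_subset; exact: Bj.
Qed.

Section boxes.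
Variable R : realType.

Definition oitv (i : rat * rat) : set R := `]ratr i.1, ratr i.2[%classic.
Definition citv (i : rat * rat) : set R := `[ratr i.1, ratr i.2]%classic.

Lemma countable_base_R : countable_base oitv citv.
Proof.
move=> U x oU Ux.
have /nbhs_ballP[e /= e0 eU] := open_nbhs_nbhs (conj oU Ux).
have [a] : exists a : rat, ratr a \in `]x - e, x[ by apply: rat_in_itvoo; lra.
rewrite in_itv /= => /andP[ea ax].
have [b] : exists b : rat, ratr b \in `]x, x + e[ by apply: rat_in_itvoo; lra.
rewrite in_itv /= => /andP[xb be].
exists (a, b); split; first by rewrite /oitv /= in_itv/= ax.
move=> y; rewrite /citv /= in_itv/= => /andP[ay yb].
apply: eU; rewrite /ball /= ltr_norml; lra.
Qed.

Local Notation box_index := (((rat * rat) * (rat * rat)) * (rat * rat))%type.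

Definition obox (i : box_index) : set (R3 R) :=
  (oitv i.1.1 `*` oitv i.1.2) `*` oitv i.2.
Definition cbox (i : box_index) : set (R3 R) :=
  (citv i.1.1 `*` citv i.1.2) `*` citv i.2.

Lemma countable_base_R3 : countable_base obox cbox.
Proof.
exact: countable_base_prod (countable_base_prod countable_base_R
  countable_base_R) countable_base_R.
Qed.

Lemma measurable_obox i : measurable (obox i).
Proof. by do ![apply: measurableX]; exact: measurable_itv. Qed.

Lemma obox_cbox i : obox i `<=` cbox i.
Proof.
move=> x [[/= x1 x2] x3].
by split; [split|]; exact: subset_itv_oo_cc.
Qed.

Lemma compact_cbox i : compact (cbox i).
Proof.
by do ![apply: compact_setX]; exact: segment_compact.
Qed.

(** The sigma-algebra of a product is generated by rectangles, not by open sets; the countability of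
    the boxes with rational corners bridges the gap. *)
Lemma open_measurable_R3 (U : set (R3 R)) : open U -> measurable U.
Proof.
move=> oU; rewrite (_ : U = \bigcup_(i in [set i | cbox i `<=` U]) obox i).
  apply: bigcup_countType_measurable => i _; exact: measurable_obox.
apply/seteqP; split => [x Ux|x [i /= iU /obox_cbox]]; last exact: iU.
by have [i [ix iU]] := countable_base_R3 oU Ux; exists i.
Qed.

Lemma open_measurable_R3R3 (U : set (R3 R * R3 R)) : open U -> measurable U.
Proof.
move=> oU.
rewrite (_ : U = \bigcup_(i in [set i | cbox i.1 `*` cbox i.2 `<=` U])
  (obox i.1 `*` obox i.2)).
  apply: bigcup_countType_measurable => i _; apply: measurableX; exact: measurable_obox.
apply/seteqP; split => [x Ux|x [i /= iU [ix1 ix2]]]; last first.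
  by apply: iU; split; exact: obox_cbox.
have [i [ix iU]] := countable_base_prod countable_base_R3 countable_base_R3 oU Ux.
by exists i.
Qed.

Lemma closed_measurable_R3 (U : set (R3 R)) : closed U -> measurable U.
Proof.
move=> cU; rewrite -(setCK U); apply: measurableC; apply: open_measurable_R3.
exact: closed_openC.
Qed.

Lemma continuous_measurable_R3R3 (f : R3 R * R3 R -> R) : continuous f ->
  measurable_fun setT f.
Proof.
move=> /continuousP cf; refine (@measurability _ _ _ _ _ _ _ (RGenOInfty.measurableE R) _).
move=> _ [_ [a ->] <-]; rewrite setTI; apply: open_measurable_R3R3.
by apply: cf; exact: interval_open.
Qed.

Lemma continuous_enorm : continuous (@enorm R).
Proof.
move=> x; apply: (@continuous_comp _ _ _ (fun x : R3 R => dot x x) Num.sqrt).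
  by rewrite /dot; do ![apply: cvgD | apply: cvgM];
    try exact: cvg_snd;
    (apply: (@cvg_comp _ _ _ fst); [exact: cvg_fst|]);
    (exact: cvg_fst || exact: cvg_snd).
exact: sqrt_continuous.
Qed.

Lemma closed_sphere : closed (@sphere R).
Proof.
rewrite (_ : @sphere R = @enorm R @^-1` [set 1]) //.
apply: closed_comp; last exact: closed_eq.
by move=> x _; exact: continuous_enorm.
Qed.

Lemma measurable_sphere : measurable (@sphere R).
Proof. exact: closed_measurable_R3 closed_sphere. Qed.

Lemma measurable_phase (Om : set (R3 R)) : open Om -> measurable (phase Om).
Proof.
by move=> oO; apply: measurableX;
  [exact: open_measurable_R3|exact: measurable_sphere].
Qed.

Lemma measurable_bd_phase (Om : set (R3 R)) : measurable (bd_phase Om).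
Proof.
apply: measurableX; last exact: measurable_sphere.
apply: measurableD.
  by apply: closed_measurable_R3; exact: closed_closure.
by apply: open_measurable_R3; exact: open_interior.
Qed.

Lemma sphere_le1 (s : R3 R) : sphere s ->
  [/\ `|s.1.1| <= 1, `|s.1.2| <= 1 & `|s.2| <= 1].
Proof.
rewrite /sphere /= /enorm => s1.
have d0 : 0 <= dot s s by rewrite !addr_ge0 // -expr2 sqr_ge0.
have : dot s s = 1 by rewrite -(sqr_sqrtr d0) s1 expr1n.
rewrite /dot -!expr2 => ss.
have := sqr_ge0 s.1.1; have := sqr_ge0 s.1.2; have := sqr_ge0 s.2.
have le1 (u : R) : u ^+ 2 <= 1 -> `|u| <= 1.
  by move=> h; rewrite -(@expr_le1 _ 2) // real_normK ?num_real.
by move=> *; split; apply: le1; lra.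
Qed.

Lemma compact_sphere : compact (@sphere R).
Proof.
apply: (@subclosed_compact _ _ (cbox ((-1, 1), (-1, 1), (-1, 1)))).
- exact: closed_sphere.
- exact: compact_cbox.
- move=> s /sphere_le1[]; rewrite !ler_norml => s1 s2 s3.
  by split; [split|]; rewrite /citv /= in_itv/= rmorphN /= rmorph1.
Qed.

End boxes.

Lemma vol3_cbox_lty (R : realType) i : (vol3 (@cbox R i) < +oo)%E.
Proof.
have mc j : measurable (@citv R j) by exact: measurable_itv.
have fc j : leb (@citv R j) \is a fin_num.
  rewrite /leb lebesgue_measure_itv/=; by case: ifPn.
rewrite /cbox [ltLHS](_ : _ = leb (@citv R i.1.1) * leb (@citv R i.1.2) *
  leb (@citv R i.2))%E.
  by rewrite -(fineK (fc _)) -(fineK (fc i.1.2)) -(fineK (fc i.2)) -!EFinM ltry.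
transitivity (vol2 (@citv R i.1.1 `*` @citv R i.1.2) * leb (@citv R i.2))%E.
  by apply: product_measure1E => //; exact: measurableX.
by congr (_ * _)%E; exact: product_measure1E.
Qed.

Lemma bounded_subset_cbox (R : realType) (Om : set (R3 R)) :
  bounded_set Om -> exists i, Om `<=` @cbox R i.
Proof.
move=> [M [_ MO]].
pose n := (Num.truncn (`|M|)).+1.
have Mn : M < n%:R by apply: le_lt_trans (ler_norm M) _; exact: truncnS_gt.
pose J : rat * rat := (- n%:R, n%:R).
exists (J, J, J) => x /(MO _ Mn) xn.
have h (t : R) : `|t| <= `|x| -> @citv R J t.
  move=> tx; rewrite /citv /= in_itv/= rmorphN /= !ratr_nat.
  by rewrite -ler_norml (le_trans tx).
split; [split|]; apply: h; rewrite /= prod_normE /=.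
- by rewrite le_max prod_normE /= le_max lexx.
- by rewrite le_max prod_normE /= le_max lexx orbT.
- by rewrite le_max lexx orbT.
Qed.

Lemma vol3_bounded_lty (R : realType) (Om : set (R3 R)) :
  open Om -> bounded_set Om -> (vol3 Om < +oo)%E.
Proof.
move=> oO /bounded_subset_cbox[i Oi].
apply: le_lt_trans (vol3_cbox_lty R i).
apply: le_measure => //; rewrite inE; first exact: open_measurable_R3.
by do ![apply: measurableX]; exact: measurable_itv.
Qed.

Lemma phase_measureX (R : realType) (A B : set (R3 R)) :
  measurable A -> measurable B ->
  phase_measure (A `*` B) = (vol3 A * sphere_measure B)%E.
Proof. by move=> mA mB; exact: product_measure1E. Qed.

Lemma phase_measure_lty (R : realType) (Om : set (R3 R)) :
  open Om -> bounded_set Om -> (phase_measure (phase Om) < +oo)%E.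
Proof.
move=> oO bO; rewrite phase_measureX; [|exact: open_measurable_R3|exact: measurable_sphere].
have s : sphere_measure (@sphere R) \is a fin_num.
  by apply: fin_num_measure; exact: measurable_sphere.
have v : vol3 Om \is a fin_num by rewrite ge0_fin_numE // vol3_bounded_lty.
by rewrite -(fineK s) -(fineK v) -EFinM ltry.
Qed.

(** The push-forward of the product measure takes the product values on rectangles, and these
    determine the product measure. *)
Lemma product_measure_invariant d1 d2 (T1 : measurableType d1)
    (T2 : measurableType d2) (R : realType)
    (m1 : {sigma_finite_measure set T1 -> \bar R})
    (m2 : {sigma_finite_measure set T2 -> \bar R})
    (f1 : T1 -> T1) (f2 : T2 -> T2) :
  measurable_fun setT f1 -> measurable_fun setT f2 ->
  (forall A, measurable A -> m1 (f1 @^-1` A) = m1 A) ->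
  (forall A, measurable A -> m2 (f2 @^-1` A) = m2 A) ->
  forall A, measurable A ->
  (m1 \x m2)%E ((fun x => (f1 x.1, f2 x.2)) @^-1` A) = (m1 \x m2)%E A.
Proof.
move=> mf1 mf2 inv1 inv2 A mA.
pose f : T1 * T2 -> T1 * T2 := fun x => (f1 x.1, f2 x.2).
have mf : measurable_fun setT f.
  by apply: measurable_fun_pair; apply: measurableT_comp.
apply/esym; apply: (@product_measure_unique _ _ _ _ _ m1 m2
  (measure_function_pushforward__canonical__measure_function_Measure _ mf)) => //.
move=> B C mB mC.
have mB' : measurable (f1 @^-1` B) by rewrite -[X in measurable X]setTI; exact: mf1.
have mC' : measurable (f2 @^-1` C) by rewrite -[X in measurable X]setTI; exact: mf2.
rewrite -(inv1 B mB) -(inv2 C mC) -product_measure1E //.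
Qed.

(** The integral of a signed function is by definition the difference of those of its positive and
    negative parts, and to each of these the change of variables for a push-forward applies. *)
Lemma eq_integral_invariant d (T : measurableType d) (R : realType)
    (m : {measure set T -> \bar R}) (f : T -> T) (g : T -> \bar R) (D : set T) :
  measurable D -> f @^-1` D = D ->
  measurable_fun setT f -> (forall A, measurable A -> m (f @^-1` A) = m A) ->
  measurable_fun D g ->
  (\int[m]_(x in D) g (f x) = \int[m]_(x in D) g x)%E.
Proof.
move=> mD fD mf inv mg.
have ge0 (h : T -> \bar R) : measurable_fun D h -> (forall y, 0 <= h y)%E ->
    (\int[m]_(x in D) h (f x) = \int[m]_(x in D) h x)%E.
  move=> mh h0; rewrite -{1}fD -(@ge0_integral_pushforward _ _ _ _ _ f mf) //.
  by apply: eq_measure_integral => A mA _; rewrite -inv.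
rewrite integralE [RHS]integralE; congr (_ - _)%E.
- rewrite -(ge0 (g^\+)%E) //; last exact: measurable_funepos.
  by apply: eq_integral => x _; rewrite !funeposE.
- rewrite -(ge0 (g^\-)%E) //; last exact: measurable_funeneg.
  by apply: eq_integral => x _; rewrite !funenegE.
Qed.

(** * Reflection of the direction variable *)

Definition opp3 (R : realType) (x : R3 R) : R3 R := - x.

Lemma measurable_opp3 (R : realType) : measurable_fun setT (@opp3 R).
Proof.
rewrite (_ : @opp3 R = fun x => (- x.1.1, - x.1.2, - x.2)) //.
by apply: measurable_fun_pair; [apply: measurable_fun_pair|];
  apply: measurableT_comp => //;
  (exact: (measurableT_comp measurable_fst measurable_fst) ||
   exact: (measurableT_comp measurable_snd measurable_fst)).
Qed.

Lemma vol3_opp (R : realType) (A : set (R3 R)) : measurable A ->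
  vol3 (@opp3 R @^-1` A) = vol3 A.
Proof.
move=> mA.
have mN : measurable_fun setT (-%R : R -> R) by exact: oppr_measurable.
have invN (B : set R) : measurable B -> leb (-%R @^-1` B) = leb B.
  by move=> mB; exact: (lebesgue_measureN mB).
have inv2 (B : set (R * R)) : measurable B ->
    vol2 ((fun x => (- x.1, - x.2)) @^-1` B) = vol2 B.
  exact: (product_measure_invariant mN mN invN invN).
apply: (product_measure_invariant _ mN inv2 invN mA).
by apply: measurable_fun_pair; apply: measurableT_comp.
Qed.

Lemma enorm_opp (R : realType) (x : R3 R) : enorm (- x) = enorm x.
Proof. by rewrite /enorm /dot /= !mulrNN. Qed.

(** The cone over the reflected set is the reflected cone, and volume is invariant under
    reflection. *)
Lemma sphere_measure_opp (R : realType) (A : set (R3 R)) : measurable A ->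
  sphere_measure (@opp3 R @^-1` A) = sphere_measure A.
Proof.
move=> mA; rewrite /sphere_measure -[in RHS]vol3_opp; last exact: measurable_cone.
congr (_ * vol3 _)%E; rewrite preimage_setI; congr (_ `&` _).
  by apply/seteqP; split => x; rewrite /punctured_ball /= /opp3 enorm_opp.
apply/seteqP; split => x; rewrite /= /unit_dir /opp3 /= enorm_opp scalerN //.
Qed.

Definition flip (R : realType) (x : R3 R * R3 R) : R3 R * R3 R := (x.1, - x.2).

Lemma measurable_flip (R : realType) : measurable_fun setT (@flip R).
Proof.
apply: measurable_fun_pair => //.
exact: (measurableT_comp (@measurable_opp3 R) measurable_snd).
Qed.

Lemma phase_measure_flip (R : realType) (A : set (R3 R * R3 R)) :
  measurable A -> phase_measure (@flip R @^-1` A) = phase_measure A.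
Proof.
apply: (@product_measure_invariant _ _ _ _ _ _ _ id (@opp3 R)) => //.
- exact: measurable_opp3.
- exact: sphere_measure_opp.
Qed.

Lemma flip_phase (R : realType) (Om : set (R3 R)) :
  @flip R @^-1` (phase Om) = phase Om.
Proof.
by apply/seteqP; split => -[r s] [/= Or]; rewrite /sphere /= ?enorm_opp => h;
  split; rewrite //= /sphere /= ?enorm_opp.
Qed.

Lemma integral_flip (R : realType) (Om : set (R3 R))
    (g : R3 R * R3 R -> \bar R) : open Om -> measurable_fun (phase Om) g ->
  (\int[@phase_measure R]_(x in phase Om) g (flip x) =
   \int[@phase_measure R]_(x in phase Om) g x)%E.
Proof.
move=> oO mg.
exact: (@eq_integral_invariant _ _ _ (@phase_measure R) (@flip R) g _
  (measurable_phase oO) (flip_phase Om) (@measurable_flip R)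
  (@phase_measure_flip R) mg).
Qed.

Lemma flipK (R : realType) : involutive (@flip R).
Proof. by move=> [r s]; rewrite /flip /= opprK. Qed.

Lemma measurable_fun_flip (R : realType) (Om : set (R3 R))
    (u : R3 R * R3 R -> R) : open Om -> measurable_fun (phase Om) u ->
  measurable_fun (phase Om) (u \o @flip R).
Proof.
move=> oO mu; apply: (measurable_comp (measurable_phase oO)) => //.
- by move=> _ [x Dx <-]; have : (@flip R @^-1` (phase Om)) x by rewrite flip_phase.
- by apply: (@measurable_funTS _ _ _ _ (phase Om)); exact: measurable_flip.
Qed.

Lemma L2_flip (R : realType) (Om : set (R3 R)) (u : R3 R * R3 R -> R) :
  open Om -> L2_phase Om u -> L2_phase Om (u \o @flip R).
Proof.
move=> oO [mu u2]; split; first exact: measurable_fun_flip.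
rewrite (@integral_flip _ _ (fun x => (u x ^+ 2)%:E)) //.
by apply/measurable_EFinP; exact: measurable_funX.
Qed.

Lemma ip_flip (R : realType) (Om : set (R3 R)) (u v : R3 R * R3 R -> R) :
  open Om -> L2_phase Om u -> L2_phase Om v ->
  ip_phase Om (u \o @flip R) (v \o @flip R) = ip_phase Om u v.
Proof.
move=> oO [mu _] [mv _]; congr fine.
rewrite (@integral_flip _ _ (fun x => (u x * v x)%:E)) //.
by apply/measurable_EFinP; exact: measurable_funM.
Qed.

(** * The cosine of the angle and null sets *)

Lemma negligible_bigcup_countType d (T : measurableType d) (R : realType)
    (mu : {measure set T -> \bar R}) (I : countType) (F : I -> set T) :
  (forall i, mu.-negligible (F i)) -> mu.-negligible (\bigcup_i F i).
Proof.
move=> F0; pose G k := if unpickle k is Some i then F i else set0.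
apply: (@negligibleS _ _ _ _ (\bigcup_k G k)).
  by move=> x [i _ Fix]; exists (pickle i) => //; rewrite /G pickleK.
apply: negligible_bigcup => k; rewrite /G; case: unpickle => // .
exact: negligible_set0.
Qed.

Section null_preimage.
Variable R : realType.
Local Notation lm := (@lebesgue_measure R).
Local Notation oml := ((wlength idfun)^* : set R -> \bar R)%mu.

(** A quantitative substitute for a nonzero derivative at [z]. A single integer controls both the
    radius and the expansion constant, so that countably many cases exhaust all points. *)
Definition locally_expanding_at (f : R -> R) (z : R) (n : nat) :=
  forall w, `|w - z| < n.+1%:R^-1 -> `|w - z| <= n.+1%:R * `|f w - f z|.

(** [S] lies in the interval of radius [delta] about any of its points, whence the factor 2. *)
Lemma outer_measure_diameter (S : set R) (delta : R) : 0 <= delta ->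
  (forall x y, S x -> S y -> `|x - y| <= delta) -> (oml S <= (2 * delta)%:E)%E.
Proof.
move=> d0; have [->|/set0P[x Sx] Sd] := eqVneq S set0.
  by rewrite outer_measure0 lee_fin mulr_ge0.
apply: (@le_trans _ _ (oml `[x - delta, x + delta]%classic)).
  apply: le_outer_measure => y Sy; rewrite /= in_itv/= -ler_distlC.
  exact: Sd.
rewrite (_ : oml _ = lm `[x - delta, x + delta]%classic) //.
rewrite lebesgue_measure_itv /= lte_fin; case: ifPn => _.
  by rewrite -EFinB lee_fin; lra.
by rewrite lee_fin mulr_ge0.
Qed.

(* On a piece of diameter less than [1 / (n + 1)], a cover of [N] by intervals
   of total length [e] pulls back to a cover by sets of diameters at most
   [n + 1] times the lengths of these intervals. *)
Lemma locally_expanding_preimage_null (f : R -> R) (D N : set R) :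
  (forall z, D z -> exists n, locally_expanding_at f z n) ->
  lm.-negligible N -> lm.-negligible (D `&` f @^-1` N).
Proof.
move=> Df N0.
(* Half the radius: two points of a piece are then close enough for the expansion at one of them to
   apply to the other. *)
pose S (i : nat * rat) := D `&` f @^-1` N `&`
  [set z | locally_expanding_at f z i.1 /\
           `|z - ratr i.2| < i.1.+1%:R^-1 / 2].
suff S0 i : lm.-negligible (S i).
  have cover : D `&` f @^-1` N `<=` \bigcup_i (S i).
    move=> z [Dz Nz]; have [n fn] := Df _ Dz.
    have [q] : exists q : rat, ratr q \in `]z - n.+1%:R^-1 / 2, z + n.+1%:R^-1 / 2[.
      apply: rat_in_itvoo.
      have k0 : 0 < n.+1%:R^-1 / 2 :> R by rewrite divr_gt0 // invr_gt0.
      by rewrite ltrBlDr -addrA ltrDl addr_gt0.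
    rewrite in_itv /= => qz; exists (n, q) => //; split => //; split => //=.
    by rewrite distrC ltr_distl.
  apply: negligibleS; first exact: cover.
  by apply: negligible_bigcup_countType; exact: S0.
case: i => n q; rewrite negligible_outer_measure; apply/eqP.
rewrite eq_le outer_measure_ge0 andbT; apply/lee_addgt0Pr => e e0; rewrite add0e.
have n0 : 0 < (n.+1%:R : R) by [].
(* Pulling back an interval of the cover costs a factor [n.+1] for the expansion and 2 for passing
   from diameter to outer measure. *)
have e0' : 0 < e / (2 * n.+1%:R) by rewrite divr_gt0 // mulr_gt0.
have [F [Fitv NF] Fe] : exists2 F : nat -> set R, open_itv_cover N F &
    (\sum_(0 <= k <oo) wlength idfun (F k) <= (e / (2 * n.+1%:R))%:E)%E.
  move: N0; rewrite negligible_outer_measure outer_measure_open_itv_cover => N0.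
  have fin : ereal_inf [set (\sum_(0 <= k <oo) wlength (@idfun R) (F k))%E | F in open_itv_cover N]
    \is a fin_num by rewrite N0.
  have [_ [/= F NF <-]] := lb_ereal_inf_adherent e0' fin.
  by rewrite N0 add0e => /ltW Fe; exists F.
have Sle k : (oml (S (n, q) `&` f @^-1` (F k)) <=
    (2 * n.+1%:R)%:E * wlength idfun (F k))%E.
  have [[a b] /= Fk] := Fitv k; rewrite Fk wlength_itv /= lte_fin.
  case: ifPn => [ab|nab]; last first.
    rewrite mule0 (_ : S (n, q) `&` _ = set0) ?outer_measure0 //.
    rewrite -subset0 => z [_] /=; rewrite in_itv/= => /andP[az zb].
    by move: nab; rewrite (lt_trans az zb).
  rewrite -EFinB -EFinM -mulrA; apply: outer_measure_diameter.
    by rewrite mulr_ge0 // subr_ge0 ltW.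
  move=> x y [[_ [_ /= xq]] /= fx] [[_ [yexp /= yq]] /= fy].
  apply: (le_trans (yexp x _)).
    apply: (@le_lt_trans _ _ (`|x - ratr q| + `|y - ratr q|)); last first.
      by rewrite [ltRHS]splitr; exact: ltrD.
    by rewrite (distrC y) (le_trans _ (ler_normD _ _)) // addrA subrK.
  rewrite ler_pM2l //.
  move: fx fy; rewrite /= !in_itv/= => /andP[? ?] /andP[? ?].
  by rewrite ler_norml; lra.
apply: (@le_trans _ _ (\sum_(0 <= k <oo) oml (S (n, q) `&` f @^-1` (F k)))%E).
  apply: le_trans (outer_measure_sigma_subadditive _ _).
  apply: le_outer_measure => z Sz; have [[_ Nz] _] := Sz.
  by have [k _ Fk] := NF _ Nz; exists k.
apply: (@le_trans _ _ (\sum_(0 <= k <oo) (2 * n.+1%:R)%:E * wlength idfun (F k))%E).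
  by apply: lee_nneseries => // k _ _; exact: outer_measure_ge0.
rewrite nneseriesZl; last by move=> *; exact: wlength_ge0.
apply: (@le_trans _ _ ((2 * n.+1%:R)%:E * (e / (2 * n.+1%:R))%:E)%E).
  by rewrite lee_pmul2l // lte_fin mulr_gt0.
by rewrite -EFinM lee_fin mulrC divfK // mulf_neq0 // pnatr_eq0.
Qed.

End null_preimage.

Section sphere_dot.
Variable R : realType.
Local Notation lm := (@leb R).

Lemma product_measure_sections_null d1 d2 (T1 : measurableType d1)
    (T2 : measurableType d2) (m1 : {measure set T1 -> \bar R})
    (m2 : {sigma_finite_measure set T2 -> \bar R}) (A : set (T1 * T2)) :
  measurable A -> {ae m1, forall x, m2 (xsection A x) = 0%E} ->
  (m1 \x m2)%E A = 0%E.
Proof.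
move=> mA A0; rewrite /product_measure1.
transitivity (\int[m1]_x (cst 0 x : \bar R))%E; last by rewrite integral0.
apply: ae_eq_integral => //.
- exact: measurable_fun_xsection.
- by apply: filterS A0 => x.
Qed.

Lemma leb_expanding_null (f : R -> R) (D N : set R) :
  (forall z, D z -> exists n, locally_expanding_at f z n) ->
  lm.-negligible N -> lm.-negligible (D `&` f @^-1` N).
Proof. exact: locally_expanding_preimage_null. Qed.

Lemma leb_null_sub (A B : set R) : A `<=` B -> measurable A ->
  lm.-negligible B -> leb A = 0%E.
Proof.
move=> AB mA B0; have A0 := negligibleS AB B0.
by apply/(@negligibleP _ _ _ lm).
Qed.

Lemma leb_set1_negligible (x : R) : lm.-negligible [set x].
Proof. apply/negligibleP => //; exact: lebesgue_measure_set1. Qed.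

Lemma vol2_line_null (c d : R) : (c, d) != (0, 0) ->
  vol2 [set p : R * R | c * p.1 + d * p.2 = 0] = 0%E.
Proof.
move=> cd; apply: product_measure_sections_null.
  rewrite (_ : mkset _ = setT `&` (fun p : R * R => c * p.1 + d * p.2) @^-1` [set 0]).
    apply: measurable_funD => //; by apply: measurable_funM.
  by rewrite setTI.
have mS x : measurable (xsection [set p : R * R | c * p.1 + d * p.2 = 0] x).
  apply: measurable_xsection.
  rewrite (_ : mkset _ = setT `&` (fun p : R * R => c * p.1 + d * p.2) @^-1` [set 0]).
    apply: measurable_funD => //; by apply: measurable_funM.
  by rewrite setTI.
have [d0|d0] := eqVneq d 0.
  have c0 : c != 0 by apply: contraNneq cd => ->; rewrite d0.
  apply: (negligibleS _ (leb_set1_negligible 0)) => x /= h; apply: contrapT => x0.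
  apply: h; rewrite (_ : xsection _ _ = set0) ?measure0 //.
  rewrite -subset0 => y; rewrite /xsection /= inE /= d0 mul0r addr0 => /eqP.
  by rewrite mulf_eq0 (negbTE c0) => /eqP.
apply: aeW => x; apply: (@leb_null_sub _ [set - (c * x) / d]) => //.
  move=> y; rewrite /xsection /= inE /= => /eqP; rewrite addrC addr_eq0 => /eqP <-.
  by field.
exact: leb_set1_negligible.
Qed.

(** The cosine of the angle between a unit vector [s] and the point [(p, z)], as a function of the
    height [z] on the vertical line over [p]: [a] is the scalar product of [p] with the first two
    components of [s], [b] is the square of the length of [p], and [c = s.2]. *)
Definition dot_pencil (a b c : R) (z : R) := (a + c * z) / Num.sqrt (b + z ^+ 2).

(* The square of [dot_pencil] has the difference quotient below, whose value on
   the diagonal vanishes at two points at most; as [dot_pencil] is bounded, its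
   increments control those of its square. *)
Lemma dot_pencil_expanding (a b c z : R) : 0 < b ->
  (forall w, (a + c * w) ^+ 2 <= b + w ^+ 2) ->
  (a + c * z) * (b * c - a * z) != 0 ->
  exists n, locally_expanding_at (dot_pencil a b c) z n.
Proof.
move=> b0 le1 nz.
have Q0 w : 0 < b + w ^+ 2 by rewrite ltr_wpDr // sqr_ge0.
pose K w := (b * c * (2 * a + c * (w + z)) - a * (a * (z + w) + 2 * c * w * z))
  / ((b + w ^+ 2) * (b + z ^+ 2)).
have Kz : K z != 0.
  rewrite /K mulf_neq0 //; last by rewrite invr_neq0 // mulf_neq0 // gt_eqF.
  rewrite (_ : _ - _ = 2 * ((a + c * z) * (b * c - a * z))); last by ring.
  by rewrite mulf_neq0 // pnatr_eq0.
have f2 w : dot_pencil a b c w ^+ 2 = (a + c * w) ^+ 2 / (b + w ^+ 2).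
  by rewrite /dot_pencil expr_div_n sqr_sqrtr // ltW.
have fle1 w : `|dot_pencil a b c w| <= 1.
  rewrite -(@expr_le1 _ 2) // real_normK ?num_real // f2.
  by rewrite ler_pdivrMr // mul1r.
have fK w : dot_pencil a b c w ^+ 2 - dot_pencil a b c z ^+ 2 = (w - z) * K w.
  rewrite !f2 /K; field; apply/andP; split; rewrite gt_eqF //.
have cK : {for z, continuous K}.
  rewrite /K /continuous_at; apply: cvgM.
    apply: cvgB; last first.
      apply: cvgMr; apply: cvgD; first by apply: cvgMr; apply: cvgD => //; exact: cvg_cst.
      by apply: cvgMl; apply: cvgMr.
    by apply: cvgMr; apply: cvgD; [exact: cvg_cst|apply: cvgMr; apply: cvgD => //; exact: cvg_cst].
  apply: cvgV; first by rewrite mulf_neq0 // gt_eqF.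
  apply: cvgMl; apply: cvgD; first exact: cvg_cst.
  by rewrite expr2; apply: cvgM.
have K20 : 0 < `|K z| / 2 by rewrite divr_gt0 // normr_gt0.
have /cvgrPdist_lt /(_ _ K20) /nbhs_ballP[e /= e0 eK] := cK.
(* The first entry keeps [w] in the ball where [K w] stays close to [K z]; the second is the
   expansion constant, from [|w - z| |K z| / 2 <= |f w ^ 2 - f z ^ 2| <= 2 |f w - f z|] for [f] the
   pencil. *)
pose m := Num.max e^-1 (4 / `|K z|).
exists (Num.truncn m) => w.
set n1 : R := (Num.truncn m).+1%:R.
have mn : m < n1 by exact: truncnS_gt.
have n10 : 0 < n1 by [].
have en : n1^-1 < e.
  rewrite invf_plt ?posrE //; apply: le_lt_trans mn.
  by rewrite le_max lexx.
move=> wz; have {}eK : `|K z - K w| < `|K z| / 2.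
  by apply: eK; rewrite /ball /= distrC (lt_trans wz).
have Kw : `|K z| / 2 <= `|K w|.
  have := ler_normD (K z - K w) (K w); rewrite subrK; lra.
have h1 : `|w - z| * (`|K z| / 2) <= 2 * `|dot_pencil a b c w - dot_pencil a b c z|.
  apply: (@le_trans _ _ (`|w - z| * `|K w|)); first by rewrite ler_wpM2l.
  rewrite -normrM -fK subr_sqr normrM mulrC ler_wpM2r //.
  by apply: le_trans (ler_normD _ _) _; have := fle1 w; have := fle1 z; lra.
have Kz0 : 0 < `|K z| by rewrite normr_gt0.
apply: (@le_trans _ _ (4 / `|K z| * `|dot_pencil a b c w - dot_pencil a b c z|)).
  rewrite mulrAC ler_pdivlMr //; lra.
rewrite ler_wpM2r // ltW //; apply: le_lt_trans mn.
by rewrite le_max lexx orbT.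
Qed.

Lemma dot_cs (x y : R3 R) : dot x y ^+ 2 <= dot x x * dot y y.
Proof.
case: x y => [[x1 x2] x3] [[y1 y2] y3]; rewrite /dot /=.
rewrite -subr_ge0 (_ : _ - _ = (x1 * y2 - x2 * y1) ^+ 2 +
  (x1 * y3 - x3 * y1) ^+ 2 + (x2 * y3 - x3 * y2) ^+ 2); last by ring.
by rewrite !addr_ge0 ?sqr_ge0.
Qed.

Lemma dotss (s : R3 R) : sphere s -> dot s s = 1.
Proof.
rewrite /sphere /= /enorm => s1.
have d0 : 0 <= dot s s by rewrite !addr_ge0 // -expr2 sqr_ge0.
by rewrite -(sqr_sqrtr d0) s1 expr1n.
Qed.

Lemma measurable_dotr (s : R3 R) : measurable_fun setT (fun x : R3 R => dot s x).
Proof.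
rewrite /dot; apply: measurable_funD; first apply: measurable_funD;
  apply: measurable_funM => //.
- exact: (measurableT_comp measurable_fst measurable_fst).
- exact: (measurableT_comp measurable_snd measurable_fst).
Qed.

(** The cone over the set is cut by vertical lines. On almost every line the cosine is locally
    expanding off two heights, so each section is null. *)
Lemma sphere_dot_null (s : R3 R) (N : set R) : sphere s -> measurable N ->
  leb N = 0%E -> sphere_measure [set x : R3 R | N (dot s x)] = 0%E.
Proof.
move=> s1 mN N0; rewrite /sphere_measure.
have mE : measurable (@punctured_ball R `&` @unit_dir R @^-1` [set x | N (dot s x)]).
  apply: measurable_cone; rewrite -[X in measurable X]setTI.
  exact: measurable_dotr.
rewrite /vol3 product_measure_sections_null ?mule0 //.
have lN : lm.-negligible N by apply/negligibleP.
pose c := s.2; pose A (p : R * R) := s.1.1 * p.1 + s.1.2 * p.2.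
pose B (p : R * R) := p.1 ^+ 2 + p.2 ^+ 2.
(* Bad lines are the one through the origin, where the cosine jumps, and those with [c = A p = 0],
   on which the cosine is identically 0. *)
pose good p := 0 < B p /\ (c != 0 \/ A p != 0).
suff gd : {ae (@vol2 R), forall p, good p}.
  apply: filterS gd => p [Bp cAp].
  (* The zero of the cosine along the line and its critical point, the two places where the
     derivative of its square vanishes. If a denominator is 0, so is the quotient by convention,
     which only adds a point to a null set. *)
  pose F := [set - A p / c] `|` [set B p * c / A p].
  pose D := ~` F.
  have F0 : lm.-negligible F by apply: negligibleU; exact: leb_set1_negligible.
  apply: (@leb_null_sub _ (F `|` (D `&` dot_pencil (A p) (B p) c @^-1` N))).
  - move=> z; rewrite /xsection /= inE => -[_ /= Nz].
    have [Fz|nFz] := pselect (F z); [by left|right; split => //].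
    move: Nz; rewrite /= /dot_pencil /unit_dir /dot /= mulrA; congr N.
    rewrite /enorm /dot /B /A /c /= !expr2.
    by rewrite /GRing.scale /=; ring.
  - exact: measurable_xsection.
  - apply: negligibleU => //; apply: leb_expanding_null => // z Dz.
    apply: dot_pencil_expanding => // [w|].
      have := dot_cs s (p, w); rewrite dotss // mul1r /dot /= -/c.
      by rewrite /A /B !expr2.
    rewrite mulf_neq0 //.
      apply/eqP => h; apply: Dz; left; rewrite /=.
      have c0 : c != 0.
        by case: cAp => // A0; apply: contraNneq A0 => c0; move: h; rewrite c0 mul0r addr0 => ->.
      by apply: (mulfI c0); rewrite mulrC [RHS]mulrC divfK //; lra.
    apply/eqP => h; apply: Dz; right; rewrite /=.
    have A0 : A p != 0.
      case: cAp => // c0; apply: contra_eq_neq h => A0; rewrite A0 mul0r subr0.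
      by rewrite mulf_neq0 // gt_eqF.
    by apply: (mulfI A0); rewrite mulrC [RHS]mulrC divfK //; lra.
have line c1 c2 : (c1, c2) != (0, 0) :> R * R ->
    (@vol2 R).-negligible [set p : R * R | c1 * p.1 + c2 * p.2 = 0].
  move=> cc; exists [set p : R * R | c1 * p.1 + c2 * p.2 = 0]; split => //.
    rewrite (_ : mkset _ = setT `&` (fun p : R * R => c1 * p.1 + c2 * p.2) @^-1` [set 0]).
      apply: measurable_funD => //; by apply: measurable_funM.
    by rewrite setTI.
  exact: vol2_line_null.
have B0 p : ~ 0 < B p -> p = (0, 0).
  move=> /negP; rewrite -leNgt => Bp.
  have := sqr_ge0 p.1; have := sqr_ge0 p.2; rewrite /B in Bp => h1 h2.
  have /eqP : p.1 ^+ 2 = 0 by lra.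
  have /eqP : p.2 ^+ 2 = 0 by lra.
  by rewrite !sqrf_eq0 => /eqP h3 /eqP h4; case: p Bp h1 h2 h3 h4 => /= ? ? _ _ _ -> ->.
have [c0|c0] := eqVneq c 0.
  have s12 : (s.1.1, s.1.2) != (0, 0).
    apply/eqP => -[e1 e2]; have := dotss s1; rewrite /dot e1 e2 -/c c0 => /eqP.
    by rewrite !mulr0 !addr0 eq_sym oner_eq0.
  apply: (negligibleS _ (line _ _ s12)) => p /= /not_andP[/B0 ->|].
    by rewrite !mulr0 addr0.
  by move=> /not_orP[_ /negP/negPn/eqP].
(* For [c != 0] the origin is the only bad point; any line through it will do as a null set. *)
have l10 : (1, 0) != (0, 0) :> R * R by rewrite xpair_eqE oner_eq0.
apply: (negligibleS _ (line _ _ l10)) => p /= /not_andP[/B0 ->|].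
  by rewrite !mulr0 addr0.
by move=> /not_orP[/negP]; rewrite c0.
Qed.

End sphere_dot.

(** * The collision form *)

Lemma measurable_fun_fubini_F d1 d2 (T1 : measurableType d1)
    (T2 : measurableType d2) (R : realType)
    (m2 : {sigma_finite_measure set T2 -> \bar R}) (f : T1 * T2 -> \bar R) :
  measurable_fun setT f -> measurable_fun setT (fun x => \int[m2]_y f (x, y))%E.
Proof.
move=> mf; rewrite (_ : (fun x => _) = (fubini_F m2 f^\+ \- fubini_F m2 f^\-)%E).
  apply: emeasurable_funB; apply: measurable_fun_fubini_tonelli_F => //.
    exact: measurable_funepos.
  exact: measurable_funeneg.
apply/funext => x; rewrite integralE /fubini_F; congr (_ - _)%E.
  by apply: eq_integral => y _; rewrite !funeposE.
by apply: eq_integral => y _; rewrite !funenegE.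
Qed.

(** The coefficients are bounded only almost everywhere; truncation produces functions bounded
    everywhere that agree with them almost everywhere. *)
Definition clamp (R : realType) (K t : R) : R := Num.max (- K) (Num.min K t).

Lemma clamp_le (R : realType) (K t : R) : 0 <= K -> `|clamp K t| <= K.
Proof.
move=> K0; rewrite /clamp ler_norml le_max lexx /= ge_max ge_min lexx /= andbT.
by rewrite (le_trans _ K0) // lerNl oppr0.
Qed.

Lemma clampE (R : realType) (K t : R) : `|t| <= K -> clamp K t = t.
Proof. by rewrite /clamp ler_norml => /andP[? ?]; rewrite min_r // max_r. Qed.

Lemma measurable_clamp d (T : measurableType d) (R : realType) (D : set T)
    (K : R) (f : T -> R) : measurable_fun D f ->
  measurable_fun D (fun x => clamp K (f x)).
Proof.
move=> mf; apply: measurable_maxr => //.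
exact: measurable_minr.
Qed.

(** * Exchange of the two directions in the scattering integral *)

Section swap.
Variable R : realType.
Notation m3 := (@phase_measure R \x @sphere_measure R)%E.

Definition swap_dir (x : (R3 R * R3 R) * R3 R) : (R3 R * R3 R) * R3 R :=
  ((x.1.1, x.2), x.1.2).

Lemma measurable_swap_dir : measurable_fun setT swap_dir.
Proof.
apply: measurable_fun_pair.
  apply: measurable_fun_pair; last exact: measurable_snd.
  exact: (measurableT_comp measurable_fst measurable_fst).
exact: (measurableT_comp measurable_snd measurable_fst).
Qed.

(** Applying Tonelli twice isolates, for fixed position, a double integral over directions, whose
    order Tonelli exchanges once more. *)
Lemma ge0_integral_swap_dir (f : (R3 R * R3 R) * R3 R -> \bar R) :
  measurable_fun setT f -> (forall x, 0 <= f x)%E ->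
  (\int[m3]_x f (swap_dir x) = \int[m3]_x f x)%E.
Proof.
move=> mf f0.
have iter (g : (R3 R * R3 R) * R3 R -> \bar R) : measurable_fun setT g ->
    (forall x, 0 <= g x)%E -> (\int[m3]_x g x = \int[@vol3 R]_r
      \int[@sphere_measure R]_s' \int[@sphere_measure R]_s g ((r, s'), s))%E.
  move=> mg g0; rewrite fubini_tonelli1 // /fubini_F.
  rewrite [LHS](@fubini_tonelli1 _ _ _ _ _ (@vol3 R) (@sphere_measure R)
    (fun x => \int[@sphere_measure R]_s g (x, s))%E) //.
    exact: measurable_fun_fubini_F.
  by move=> x; apply: integral_ge0.
have mfs : measurable_fun setT (fun x => f (swap_dir x)).
  exact: (measurableT_comp mf measurable_swap_dir).
rewrite (iter f mf f0) (iter _ mfs (fun x => f0 (swap_dir x))).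
apply: eq_integral => r _; rewrite /swap_dir /=.
apply: (@fubini_tonelli _ _ _ _ _ (@sphere_measure R) (@sphere_measure R)
  (fun z => f ((r, z.2), z.1))) => //.
apply: (measurableT_comp mf); apply: measurable_fun_pair; last exact: measurable_fst.
by apply: measurable_fun_pair.
Qed.

Lemma integral_swap_dir (f : (R3 R * R3 R) * R3 R -> \bar R) :
  measurable_fun setT f -> (\int[m3]_x f (swap_dir x) = \int[m3]_x f x)%E.
Proof.
move=> mf; rewrite integralE [RHS]integralE; congr (_ - _)%E.
- rewrite -(ge0_integral_swap_dir (f:=f^\+)%E) //; last exact: measurable_funepos.
  by apply: eq_integral => x _; rewrite !funeposE.
- rewrite -(ge0_integral_swap_dir (f:=f^\-)%E) //; last exact: measurable_funeneg.
  by apply: eq_integral => x _; rewrite !funenegE.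
Qed.

Lemma ae_fst d1 d2 (T1 : measurableType d1) (T2 : measurableType d2)
    (m1 : {measure set T1 -> \bar R})
    (m2 : {sigma_finite_measure set T2 -> \bar R}) (P : T1 -> Prop) :
  {ae m1, forall x, P x} -> {ae (m1 \x m2)%E, forall x, P x.1}.
Proof.
move=> [N [mN N0 PN]]; exists (N `*` setT); split.
- exact: measurableX.
- by rewrite product_measure1E // N0 mul0e.
- by move=> x /= nP; split => //; exact: PN.
Qed.

Lemma ae_xsection d1 d2 (T1 : measurableType d1) (T2 : measurableType d2)
    (m1 : {sigma_finite_measure set T1 -> \bar R})
    (m2 : {sigma_finite_measure set T2 -> \bar R}) (N : set (T1 * T2)) :
  measurable N -> (m1 \x m2)%E N = 0%E -> {ae m1, forall x, m2 (xsection N x) = 0%E}.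
Proof.
move=> mN N0.
have mF : measurable_fun setT (m2 \o xsection N) by exact: measurable_fun_xsection.
have : (\int[m1]_x `|(m2 \o xsection N) x| = 0)%E.
  by rewrite -N0; apply: eq_integral => x _; rewrite gee0_abs //=; exact: measure_ge0.
move/(ae_eq_integral_abs m1 measurableT mF).
by apply: filterS => x /= /(_ Logic.I).
Qed.

Definition cos_angle (x : (R3 R * R3 R) * R3 R) : R3 R * R :=
  (x.1.1, dot x.1.2 x.2).

Lemma measurable_cos_angle : measurable_fun setT cos_angle.
Proof.
apply: measurable_fun_pair.
  exact: (measurableT_comp measurable_fst measurable_fst).
have m12 : measurable_fun setT (fun x : (R3 R * R3 R) * R3 R => x.1.2).
  exact: (measurableT_comp measurable_snd measurable_fst).
have c1 : measurable_fun setT (fun x : R3 R => x.1.1).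
  exact: (measurableT_comp measurable_fst measurable_fst).
have c2 : measurable_fun setT (fun x : R3 R => x.1.2).
  exact: (measurableT_comp measurable_snd measurable_fst).
have c3 : measurable_fun setT (fun x : R3 R => x.2) by exact: measurable_snd.
have m2 : measurable_fun setT (fun x : (R3 R * R3 R) * R3 R => x.2) by exact: measurable_snd.
apply: measurable_funD; first apply: measurable_funD.
- exact: (measurable_funM (measurableT_comp c1 m12) (measurableT_comp c1 m2)).
- exact: (measurable_funM (measurableT_comp c2 m12) (measurableT_comp c2 m2)).
- exact: (measurable_funM (measurableT_comp c3 m12) (measurableT_comp c3 m2)).
Qed.

(* The bounds on the kernel hold for almost every (r, t), those on the
   scattering operator are needed for almost every (r, s', s): the cosine of
   the angle has to pull null sets back to null sets. *)
Lemma ae_cos_angle (P : R3 R -> R -> Prop) :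
  {ae (@vol3 R \x @leb R)%E, forall y, P y.1 y.2} ->
  {ae @phase_measure R, forall x, sphere x.2 ->
    {ae @sphere_measure R, forall s, P x.1 (dot x.2 s)}}.
Proof.
move=> [N [mN N0 PN]].
have h := ae_fst (@sphere_measure R) (@ae_xsection _ _ _ _ (@vol3 R) (@leb R) N mN N0).
have {}h : {ae @phase_measure R, forall x, leb (xsection N x.1) = 0%E} by exact: h.
apply: filterS h => -[r s'] /= Nr s1.
exists [set s | xsection N r (dot s' s)]; split.
- rewrite -[X in measurable X]setTI; apply: measurable_dotr => //.
  exact: measurable_xsection.
- by apply: sphere_dot_null => //; exact: measurable_xsection.
- move=> s /= nP; rewrite /xsection /= inE; exact: PN.
Qed.

End swap.

Lemma measurable_Rintegral d1 d2 (T1 : measurableType d1)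
    (T2 : measurableType d2) (R : realType)
    (m2 : {sigma_finite_measure set T2 -> \bar R}) (f : T1 * T2 -> R) :
  measurable_fun setT f -> measurable_fun setT (fun x => \int[m2]_y f (x, y)).
Proof.
move=> mf; apply: (measurableT_comp (@fine_measurable R setT measurableT)).
by apply: (@measurable_fun_fubini_F _ _ _ _ _ m2 (EFin \o f)); apply/measurable_EFinP.
Qed.

Lemma restrictE (T : Type) (R : realType) (D : set T) (u : T -> R) x :
  (u \_ D) x = if x \in D then u x else 0.
Proof. by rewrite patchE. Qed.

Lemma L2_restrict d (T : measurableType d) (R : realType)
    (m : {measure set T -> \bar R}) (D : set T) (u : T -> R) : measurable D ->
  L2 m D u -> L2 m setT (u \_ D).
Proof.
move=> mD [mu u2]; split.
  by apply/(measurable_restrict _ mD measurableT); rewrite setTI.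
rewrite (_ : (\int[m]_x _)%E = (\int[m]_(x in D) (u x ^+ 2)%:E)%E) //.
rewrite [RHS]integral_mkcond; apply: eq_integral => x _.
by rewrite !patchE; case: ifPn => // _; rewrite expr0n.
Qed.

Lemma sphere_dot_le1 (R : realType) (s s' : R3 R) : sphere s -> sphere s' ->
  -1 <= dot s s' <= 1.
Proof.
move=> s1 s'1; rewrite -ler_norml -(@expr_le1 _ 2) // real_normK ?num_real //.
by apply: le_trans (dot_cs _ _) _; rewrite !dotss // mulr1.
Qed.

(** For unit vectors, [|s - s'| ^ 2 = 2 - 2 * dot s s']. *)
Lemma sphere_dot1 (R : realType) (s s' : R3 R) : sphere s -> sphere s' ->
  dot s s' = 1 -> s' = s.
Proof.
move=> /dotss + /dotss; case: s s' => [[a b] c] [[a' b'] c'].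
rewrite /dot /= => e1 e2 e3.
have : (a - a') ^+ 2 + (b - b') ^+ 2 + (c - c') ^+ 2 = 0.
  by rewrite !expr2; lra.
have := sqr_ge0 (a - a'); have := sqr_ge0 (b - b'); have := sqr_ge0 (c - c').
move=> h1 h2 h3 h4.
have /eqP : (a - a') ^+ 2 = 0 by lra.
have /eqP : (b - b') ^+ 2 = 0 by lra.
have /eqP : (c - c') ^+ 2 = 0 by lra.
by rewrite !sqrf_eq0 !subr_eq0 => /eqP -> /eqP -> /eqP ->.
Qed.

Lemma dotN (R : realType) (s s' : R3 R) : dot s (- s') = - dot s s'.
Proof. by rewrite /dot /=; ring. Qed.

Lemma dotC (R : realType) (s s' : R3 R) : dot s s' = dot s' s.
Proof. by rewrite /dot /=; ring. Qed.

Lemma sphere_opp (R : realType) (s : R3 R) : sphere s -> sphere (- s).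
Proof. by rewrite /sphere /= enorm_opp. Qed.

Section collision_form.
Variables (R : realType) (Om Oml : set (R3 R)) (mu : R3 R -> R) (mubar : R)
  (k : R3 R -> R -> R) (kbar a : R).
Hypotheses (oOm : open Om) (oOml : open Oml).
Hypotheses (mu_ok : absorption_ok Om mu mubar) (k_ok : scattering_ok Om mu k kbar).

Notation m3 := (@phase_measure R \x @sphere_measure R)%E.

(** Extension by zero makes the kernel measurable on the whole space; [kc] then truncates it, at the
    absolute value of [kbar] because [clamp] wants a nonnegative level. *)
Let kt : R3 R * R -> R := (fun y => k y.1 y.2) \_ (kernel_dom Om).
Let kc (y : R3 R * R) : R := clamp `|kbar| (kt y).

Let measurable_kt : measurable_fun setT kt.
Proof.
have [mk _ _] := k_ok.
apply/(measurable_restrict _ _ measurableT); last by rewrite setTI.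
by apply: measurableX; [exact: open_measurable_R3|exact: measurable_itv].
Qed.

Let measurable_kc : measurable_fun setT kc.
Proof. exact: measurable_clamp. Qed.

Let mu_ext_clamp (r : R3 R) : R :=
  clamp (Num.max `|mubar| `|a|) (absorption_ext Om a mu r).

Let measurable_absorption_ext : measurable_fun setT (absorption_ext Om a mu).
Proof.
have mO : measurable Om by exact: open_measurable_R3.
rewrite (_ : absorption_ext Om a mu =
    fun r => if (\1_Om r : R) == 1 then mu r else a); last first.
  apply/funext => r; rewrite /absorption_ext indicE; case: ifPn => _ //=.
    by rewrite eqxx.
  by rewrite eq_sym oner_eq0.
apply: measurable_fun_if => //.
- apply: (@measurable_fun_eqr _ _ _ setT) => //.
- rewrite setTI (_ : _ @^-1` _ = Om); first by case: mu_ok.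
  apply/seteqP; split => r /=; rewrite indicE.
    by case: (boolP (r \in Om)) => [/set_mem //|_]; rewrite eq_sym oner_eq0.
  by move=> Or; rewrite mem_set // eqxx.
Qed.

Let measurable_mu_ext_clamp : measurable_fun setT mu_ext_clamp.
Proof. exact: measurable_clamp. Qed.

Let ae_mu : {ae @phase_measure R, forall x, absorption_ext Om a mu x.1 = mu_ext_clamp x.1}.
Proof.
apply: (@ae_fst _ _ _ _ _ (@vol3 R) (@sphere_measure R)
  (fun r => absorption_ext Om a mu r = mu_ext_clamp r)).
have [_] := mu_ok; apply: filterS => r mur.
rewrite /mu_ext_clamp clampE // /absorption_ext; case: ifPn => [/set_mem Or|_].
  have /andP[m0 mb] := mur Or; rewrite ger0_norm // le_max.
  by rewrite (le_trans mb) // ler_norm.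
by rewrite le_max lexx orbT.
Qed.

(** A point [z] is [((r, s'), s)]: [u] is taken at [(r, s)] and [v] at [(r, s')], so that
    integrating over [s] gives the scattering of [u] at [(r, s')] times [v]. *)
Let kernel_int (h : R3 R * R -> R) (u v : R3 R * R3 R -> R)
    (z : (R3 R * R3 R) * R3 R) : R :=
  h (cos_angle z) * (u \_ (phase Oml)) (z.1.1, z.2) * (v \_ (phase Oml)) z.1.

Let mphase : measurable (phase Oml).
Proof. exact: measurable_phase. Qed.

Let measurable_restr u : L2_phase Oml u -> measurable_fun setT (u \_ (phase Oml)).
Proof. by move=> /(L2_restrict mphase) []. Qed.

Let measurable_rs : measurable_fun setT
  (fun z : (R3 R * R3 R) * R3 R => (z.1.1, z.2)).
Proof.
apply: measurable_fun_pair; last exact: measurable_snd.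
exact: (measurableT_comp measurable_fst measurable_fst).
Qed.

Let measurable_kernel_int (h : R3 R * R -> R) (u v : R3 R * R3 R -> R) :
  measurable_fun setT h -> L2_phase Oml u ->
  L2_phase Oml v -> measurable_fun setT (kernel_int h u v).
Proof.
move=> mh /measurable_restr mu_ /measurable_restr mv.
apply: measurable_funM; last exact: (measurableT_comp mv measurable_fst).
apply: measurable_funM; last exact: (measurableT_comp mu_ measurable_rs).
exact: (measurableT_comp mh (@measurable_cos_angle R)).
Qed.

Let integral_sqr3 u : L2_phase Oml u ->
  (\int[m3]_z ((u \_ (phase Oml)) z.1 ^+ 2)%:E < +oo)%E.
Proof.
move=> Lu; have [mu_ u2] := L2_restrict mphase Lu.
rewrite fubini_tonelli1 //; last 2 first.
- apply/measurable_EFinP; apply: measurable_funX.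
  exact: (measurableT_comp mu_ measurable_fst).
- by move=> x; rewrite lee_fin sqr_ge0.
rewrite /fubini_F /=.
have sfin : @sphere_measure R setT \is a fin_num by exact: fin_num_measure.
under eq_integral do rewrite integral_cst //=.
rewrite ge0_integralZr //; last 2 first.
- by apply/measurable_EFinP; exact: measurable_funX.
- by move=> x _; rewrite lee_fin sqr_ge0.
have ufin : (\int[@phase_measure R]_x ((u \_ (phase Oml)) x ^+ 2)%:E)%E \is a fin_num.
  by rewrite ge0_fin_numE //; apply: integral_ge0 => x _; rewrite lee_fin sqr_ge0.
by rewrite -(fineK ufin) -(fineK sfin) -EFinM ltry.
Qed.

(** Up to the factor [K] the integrand is dominated by the sum of two squares. Exchanging directions
    turns the square of [u] into a function of the first component alone, integrable because the
    sphere has finite measure. *)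
Let integrable_kernel_int (h : R3 R * R -> R) (u v : R3 R * R3 R -> R) (K : R) :
  0 <= K -> (forall y, `|h y| <= K) ->
  measurable_fun setT h -> L2_phase Oml u ->
  L2_phase Oml v -> m3.-integrable setT (EFin \o kernel_int h u v).
Proof.
move=> K0 hK mh Lu Lv.
have mK : measurable_fun setT (EFin \o kernel_int h u v).
  by apply/measurable_EFinP; exact: measurable_kernel_int.
apply/integrableP; split => //.
pose U z := (u \_ (phase Oml)) (z : (R3 R * R3 R) * R3 R).1.
pose V z := (v \_ (phase Oml)) (z : (R3 R * R3 R) * R3 R).1.
have mU : measurable_fun setT U.
  exact: (measurableT_comp (measurable_restr Lu) measurable_fst).
have mV : measurable_fun setT V.
  exact: (measurableT_comp (measurable_restr Lv) measurable_fst).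
have mU2 : measurable_fun setT (fun z => (U z ^+ 2)%:E).
  by apply/measurable_EFinP; exact: measurable_funX.
have mV2 : measurable_fun setT (fun z => (V z ^+ 2)%:E).
  by apply/measurable_EFinP; exact: measurable_funX.
have mU2s : measurable_fun setT (fun z => (U (swap_dir z) ^+ 2)%:E).
  exact: (measurableT_comp mU2 (@measurable_swap_dir R)).
apply: (@le_lt_trans _ _
  (\int[m3]_z (K%:E * ((U (swap_dir z) ^+ 2)%:E + (V z ^+ 2)%:E)))%E).
  apply: ge0_le_integral => //.
  - exact: measurableT_comp.
  - by apply: emeasurable_funM => //; exact: emeasurable_funD.
  - move=> z _; rewrite /= lee_fin /kernel_int !normrM -mulrA ler_pM ?mulr_ge0 //.
    rewrite -/(V z) -(real_normK (num_real (V z))).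
    rewrite (_ : (u \_ _) _ = U (swap_dir z)) //.
    rewrite -(real_normK (num_real (U (swap_dir z)))).
    have := sqr_ge0 (`|U (swap_dir z)| - `|V z|).
    have := sqr_ge0 (`|U (swap_dir z)|); have := sqr_ge0 (`|V z|).
    by rewrite !expr2; nra.
rewrite ge0_integralZl //; last 2 first.
- exact: emeasurable_funD.
- by move=> z _; rewrite adde_ge0 // lee_fin sqr_ge0.
rewrite ge0_integralD //; last 2 first.
- by move=> z _; rewrite lee_fin sqr_ge0.
- by move=> z _; rewrite lee_fin sqr_ge0.
rewrite (@integral_swap_dir _ (fun z => (U z ^+ 2)%:E)) //.
apply: lte_mul_pinfty => //.
by apply: lte_add_pinfty; exact: integral_sqr3.
Qed.

Let kc_int u v := kernel_int kc u v.

Let integrable_kc u v : L2_phase Oml u -> L2_phase Oml v ->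
  m3.-integrable setT (EFin \o kc_int u v).
Proof.
by apply: (@integrable_kernel_int _ _ _ `|kbar|) => // y; exact: clamp_le.
Qed.

Let T u v : R := \int[m3]_z kc_int u v z.

Let T_sym u v : L2_phase Oml u -> L2_phase Oml v -> T u v = T v u.
Proof.
move=> Lu Lv; congr fine.
rewrite -(@integral_swap_dir _ (EFin \o kc_int v u)).
  apply: eq_integral => -[[r s'] s] _ /=; congr EFin.
  by rewrite /kc_int /kernel_int /cos_angle /swap_dir /= dotC -!mulrA [X in _ * X]mulrC.
by apply/measurable_EFinP; exact: measurable_kernel_int.
Qed.

Let T_lin c u v w : L2_phase Oml u -> L2_phase Oml v -> L2_phase Oml w ->
  T (fun x => c * u x + v x) w = c * T u w + T v w.
Proof.
move=> Lu Lv Lw; rewrite /T -RintegralZl //; last exact: integrable_kc.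
rewrite -RintegralD //; last exact: integrable_kc.
  apply: eq_Rintegral => z _; rewrite /kc_int /kernel_int !restrictE.
  by case: ifPn => _; case: ifPn => _; ring.
rewrite (_ : _ \o _ = (fun z => c%:E * (EFin \o kc_int u w) z)%E) //.
by apply: integrableZl => //; exact: integrable_kc.
Qed.

(* Off the two points [x.2] and [- x.2] of the sphere the kernel is evaluated
   inside ]-1, 1[; on these two points nothing is known about [k]. *)
Let scatteringE u x : L2_phase Oml u -> phase Oml x ->
  (scattering Om k u x) =
  \int[@sphere_measure R]_s (kt (x.1, dot x.2 s) * (u \_ (phase Oml)) (x.1, s)).
Proof.
case: x => r s' Lu [/= Or s'1]; rewrite /scattering /=.
set f := fun s => scattering_ext Om k r (dot s' s) * u (r, s).
set g := fun s => kt (r, dot s' s) * (u \_ (phase Oml)) (r, s).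
have mg : measurable_fun setT g.
  apply: measurable_funM.
    apply: (measurableT_comp measurable_kt); apply: measurable_fun_pair => //.
    exact: measurable_dotr.
  apply: (measurableT_comp (measurable_restr Lu)); exact: measurable_fun_pair.
pose S2 : set (R3 R) := [set s'] `|` [set - s'].
have mset1 (s : R3 R) : measurable [set s].
  rewrite (_ : [set s] = ([set s.1.1] `*` [set s.1.2]) `*` [set s.2]).
    by do ![apply: measurableX]; exact: measurable_set1.
  by case: s => [[b c] d]; apply/seteqP; split => [_ -> //|[[? ?] ?] /= [[-> ->] ->]].
have mS2 : measurable S2 by exact: measurableU.
have fg s : sphere s -> ~ S2 s -> f s = g s.
  move=> s1 nS; have /andP[d1 d2] := sphere_dot_le1 s'1 s1.
  have n1 : dot s' s != 1.
    by apply/eqP => h; apply: nS; left; exact: (sphere_dot1 s'1 s1 h).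
  have n2 : dot s' s != -1.
    apply/eqP => h; apply: nS; right; rewrite /= -(opprK s); congr (- _).
    by apply: (sphere_dot1 s'1 (sphere_opp s1)); rewrite dotN h opprK.
  rewrite /f /g restrictE mem_set; last by split.
  rewrite /scattering_ext /kt restrictE; case: ifPn => [/set_mem Omr|Omr].
    rewrite mem_set //; split => //=; rewrite in_itv /= lt_neqAle eq_sym n2 d1.
    by rewrite lt_neqAle n1 d2.
  by rewrite memNset ?mul0r // => -[/= /mem_set]; rewrite (negbTE Omr).
(* Off [S2] measurability is inherited from [g]; on the finite set [S2] every function is
   measurable. *)
have mf : measurable_fun (@sphere R) f.
  have -> : @sphere R = (@sphere R `\` S2) `|` (@sphere R `&` S2).
    by rewrite setUC setUIDK.
  have mD : measurable (@sphere R `\` S2).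
    by apply: measurableD => //; exact: measurable_sphere.
  have mI : measurable (@sphere R `&` S2).
    by apply: measurableI => //; exact: measurable_sphere.
  apply/(measurable_funU _ mD mI); split.
    apply: (eq_measurable_fun g) => [s /set_mem[s1 nS]|]; first by rewrite fg.
    exact: measurable_funTS.
  apply: (@measurable_funS _ _ _ _ S2) => //.
  by apply/measurable_funU => //; split; exact: measurable_fun_set1.
have mfr : measurable_fun setT (f \_ (@sphere R)).
  by apply/(measurable_restrict _ (@measurable_sphere R) measurableT); rewrite setTI.
rewrite -/g Rintegral_mkcond; congr fine; apply: ae_eq_integral => //.
- exact/measurable_EFinP.
- exact/measurable_EFinP.
exists [set s | [set 1; -1] (dot s' s)]; split.
- rewrite -[X in measurable X]setTI; apply: measurable_dotr => //.
  exact: measurableU.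
- apply: sphere_dot_null => //; first exact: measurableU.
  apply: (@leb_null_sub _ _ [set 1; -1]) => //; first exact: measurableU.
  by apply: negligibleU; exact: leb_set1_negligible.
- move=> s /= h; apply: contrapT => nh; apply: h => _; congr EFin.
  rewrite restrictE; case: ifPn => [/set_mem s1|/negP ns1].
    apply: fg => // -[] /= ss; apply: nh; [left|right]; rewrite /= ss ?dotN dotss //.
  rewrite /g restrictE memNset ?mulr0 // => -[_ /= s1]; apply: ns1; exact: mem_set.
Qed.

Let kint u v x : R := \int[@sphere_measure R]_s kc_int u v (x, s).

Let measurable_kint u v : L2_phase Oml u -> L2_phase Oml v ->
  measurable_fun setT (kint u v).
Proof.
by move=> Lu Lv; apply: measurable_Rintegral; exact: measurable_kernel_int.
Qed.

Let integrable_kint u v : L2_phase Oml u -> L2_phase Oml v ->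
  (@phase_measure R).-integrable setT (EFin \o kint u v).
Proof.
move=> Lu Lv; have iF := integrable_fubini_F (integrable_kc Lu Lv).
apply: le_integrable iF => //.
- by apply/measurable_EFinP; exact: measurable_kint.
(* [fine] sends an infinite value to 0, so the domination holds also where the section is not
   integrable. *)
- move=> x _ /=; rewrite /kint /Rintegral /fubini_F /=.
  by case: (integral _ _ _) => [r||] //=; rewrite ?normr0 ?leey // lexx.
Qed.

Let integral_kint u v : L2_phase Oml u -> L2_phase Oml v ->
  \int[@phase_measure R]_(x in phase Oml) kint u v x = T u v.
Proof.
move=> Lu Lv; rewrite Rintegral_mkcond.
rewrite (_ : _ \_ _ = kint u v); last first.
  apply/funext => x; rewrite restrictE; case: ifPn => // nx.
  rewrite /kint /kc_int /kernel_int /=.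
  under eq_Rintegral do rewrite [(v \_ _) x]restrictE (negbTE nx) mulr0.
  by rewrite /Rintegral integral0.
have iF := integrable_kc Lu Lv.
rewrite /T [RHS]/Rintegral -(integral12_prod_meas1 iF); congr fine.
apply: ae_eq_integral => //.
- by apply/measurable_EFinP; exact: measurable_kint.
- exact: measurable_fubini_F iF.
apply: filterS (ae_integrable1 iF) => x ix _.
by rewrite /kint /Rintegral fineK //; exact: integrable_fin_num ix.
Qed.

Let mukint u v := ip_phase Oml (fun x => mu_ext_clamp x.1 * u x) v.

Let L2_mu u : L2_phase Oml u -> L2_phase Oml (fun x => mu_ext_clamp x.1 * u x).
Proof.
move=> [mu_ u2].
have mA : measurable_fun (phase Oml) (fun x => mu_ext_clamp x.1 * u x).
  apply: measurable_funM => //; apply: measurable_funTS.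
  exact: (measurableT_comp measurable_mu_ext_clamp measurable_fst).
split => //; set K := Num.max `|mubar| `|a|.
have K0 : 0 <= K by rewrite le_max normr_ge0.
apply: (@le_lt_trans _ _ (\int[@phase_measure R]_(x in phase Oml)
  ((K ^+ 2)%:E * (u x ^+ 2)%:E))%E).
  apply: ge0_le_integral => //.
  - by move=> x _; rewrite lee_fin sqr_ge0.
  - by apply/measurable_EFinP; exact: measurable_funX.
  - by apply: measurable_funeM; apply/measurable_EFinP; exact: measurable_funX.
  - move=> x _; rewrite -EFinM lee_fin exprMn ler_wpM2r ?sqr_ge0 //.
    by rewrite -(real_normK (num_real (mu_ext_clamp _))) ler_sqr ?nnegrE // clamp_le.
rewrite ge0_integralZl //.
- have ufin : (\int[@phase_measure R]_(x in phase Oml) (u x ^+ 2)%:E)%E \is a fin_num.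
    by rewrite ge0_fin_numE //; apply: integral_ge0 => x _; rewrite lee_fin sqr_ge0.
  by rewrite -(fineK ufin) -EFinM ltry.
- by apply/measurable_EFinP; exact: measurable_funX.
- by move=> x _; rewrite lee_fin sqr_ge0.
- by rewrite lee_fin sqr_ge0.
Qed.

Let ae_kt : {ae @phase_measure R, forall x, sphere x.2 ->
  {ae @sphere_measure R, forall s, kt (x.1, dot x.2 s) = kc (x.1, dot x.2 s)}}.
Proof.
apply: (@ae_cos_angle _ (fun r t => kt (r, t) = kc (r, t))).
have [_ + _] := k_ok; apply: filterS => -[r t] /= h.
rewrite /kc /kt restrictE; case: ifPn => [/set_mem rt|_].
  have /andP[k0 kb] := h rt; rewrite clampE // ger0_norm //.
  exact: le_trans kb (ler_norm _).
by rewrite clampE // normr0.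
Qed.

Let ae_collision u v : L2_phase Oml u -> L2_phase Oml v ->
  {ae @phase_measure R, forall x, phase Oml x ->
    collision Om a mu k u x * v x = mu_ext_clamp x.1 * u x * v x - kint u v x}.
Proof.
move=> Lu Lv; have iF := integrable_kc Lu Lv.
apply: filterS3 (ae_integrable1 iF) ae_kt ae_mu => x ix ktx mux Dx.
have [_ x1] := Dx.
rewrite /collision mux mulrBl; congr (_ - _).
rewrite scatteringE //.
have mks (h : R3 R * R -> R) : measurable_fun setT h ->
    measurable_fun setT (fun s => h (x.1, dot x.2 s) * (u \_ (phase Oml)) (x.1, s)).
  move=> mh; apply: measurable_funM.
    apply: (measurableT_comp mh); apply: measurable_fun_pair => //.
    exact: measurable_dotr.
  apply: (measurableT_comp (measurable_restr Lu)); exact: measurable_fun_pair.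
have -> : \int[@sphere_measure R]_s (kt (x.1, dot x.2 s) * (u \_ (phase Oml)) (x.1, s)) =
    \int[@sphere_measure R]_s (kc (x.1, dot x.2 s) * (u \_ (phase Oml)) (x.1, s)).
  congr fine; apply: ae_eq_integral => //.
  - by apply/measurable_EFinP; exact: mks.
  - by apply/measurable_EFinP; exact: mks.
  - by apply: filterS (ktx x1) => s ktc _; rewrite ktc.
have vx : (v \_ (phase Oml)) x = v x by rewrite restrictE mem_set.
(* Integrability is known only for the section multiplied by [v x]. If [v x] is 0 both sides vanish;
   otherwise one divides by it before taking it out of the integral. *)
have [v0|v0] := eqVneq (v x) 0.
  rewrite v0 mulr0 /kint /kc_int /kernel_int /=.
  under eq_Rintegral do rewrite vx v0 mulr0.
  by rewrite /Rintegral integral0.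
rewrite /kint /kc_int /kernel_int /= vx RintegralZr //.
have := integrableZr measurableT (v x)^-1 ix.
apply: eq_integrable => // s _; rewrite /= /kc_int /kernel_int /= vx -EFinM.
by rewrite mulfK.
Qed.

Let measurable_collision u : L2_phase Oml u ->
  measurable_fun (phase Oml) (collision Om a mu k u).
Proof.
move=> Lu; have [mu_ _] := Lu.
apply: measurable_funB.
  apply: measurable_funM => //; apply: measurable_funTS.
  exact: (measurableT_comp measurable_absorption_ext measurable_fst).
apply: (eq_measurable_fun (fun x => \int[@sphere_measure R]_s
    (kt (x.1, dot x.2 s) * (u \_ (phase Oml)) (x.1, s)))) => [x /set_mem Dx|].
  by rewrite scatteringE.
apply: measurable_funTS; apply: (@measurable_Rintegral _ _ _ _ _ _
  (fun z => kt (cos_angle z) * (u \_ (phase Oml)) (z.1.1, z.2))).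
apply: measurable_funM; last exact: (measurableT_comp (measurable_restr Lu) measurable_rs).
exact: (measurableT_comp measurable_kt (@measurable_cos_angle R)).
Qed.

(** Replacing the coefficients by their truncations changes the integrand on a null set only;
    measurability of both integrands then suffices to identify the integrals. *)
Let ip_collisionE u v : L2_phase Oml u -> L2_phase Oml v ->
  ip_phase Oml (collision Om a mu k u) v = mukint u v - T u v.
Proof.
move=> Lu Lv; rewrite -integral_kint // /mukint /ip -RintegralB //; last 2 first.
- exact: L2_mul_integrable (L2_mu Lu) Lv.
- exact: integrableS (integrable_kint Lu Lv).
congr fine; apply: ae_eq_integral => //.
- apply/measurable_EFinP; apply: measurable_funM; first exact: measurable_collision.
  by case: Lv.
- apply/measurable_EFinP; apply: measurable_funB.
    have [mv _] := Lv; have [mA _] := L2_mu Lu; exact: measurable_funM.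
  by apply: measurable_funTS; exact: measurable_kint.
by apply: filterS (ae_collision Lu Lv) => x h Dx; rewrite h.
Qed.

Lemma ip_collision_sym u v : L2_phase Oml u -> L2_phase Oml v ->
  ip_phase Oml (collision Om a mu k u) v = ip_phase Oml (collision Om a mu k v) u.
Proof.
move=> Lu Lv; rewrite !ip_collisionE // T_sym //; congr (_ - _).
by apply: eq_Rintegral => x _; ring.
Qed.

Lemma ip_collision_linl c u v w : L2_phase Oml u -> L2_phase Oml v ->
  L2_phase Oml w ->
  ip_phase Oml (collision Om a mu k (fun x => c * u x + v x)) w =
  c * ip_phase Oml (collision Om a mu k u) w + ip_phase Oml (collision Om a mu k v) w.
Proof.
move=> Lu Lv Lw; rewrite !ip_collisionE //; last exact: L2_lin.
rewrite T_lin // /mukint.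
have -> : (fun x : R3 R * R3 R => mu_ext_clamp x.1 * (c * u x + v x)) =
    fun x => c * (mu_ext_clamp x.1 * u x) + mu_ext_clamp x.1 * v x.
  by apply/funext => x; ring.
by rewrite ip_linl //; [ring|exact: L2_mu|exact: L2_mu].
Qed.

End collision_form.

(** * Weak derivatives *)

Section directional.
Variables (R : realType) (V : normedModType R).
Implicit Types (f : V -> R) (x v : V).

Lemma is_derive_line f x v (t : R) : derivable f (t *: v + x) v ->
  is_derive t 1 (fun h => f (h *: v + x)) ('D_v f (t *: v + x)).
Proof.
have e : (fun h : R => h^-1 *: ((fun h => f (h *: v + x)) (h *: 1 + t) - f (t *: v + x))) =
    (fun h : R => h^-1 *: (f (h *: v + (t *: v + x)) - f (t *: v + x))).
  by apply/funext => h; rewrite [h *: 1]mulr1 scalerDl addrA.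
by move=> df; constructor; rewrite /derivable /derive /= ?e.
Qed.

(** Quotients along a sequence exhibit a derivative as a pointwise limit, hence as a measurable
    function, even when the direction varies with the point. *)
Lemma derive_quotient_cvg f x v : derivable f x v ->
  (n.+1%:R * (f (n.+1%:R^-1 *: v + x) - f x)) @[n --> \oo] --> 'D_v f x.
Proof.
move=> df; apply/cvgrPdist_lt => e e0.
have /cvgrPdist_lt /(_ e e0) := df.
rewrite near_withinE => /nbhs_ballP[r /= r0 rP].
near=> n.
have n0 : 0 < n.+1%:R^-1 :> R by rewrite invr_gt0.
have := rP n.+1%:R^-1; rewrite /ball /= sub0r normrN invrK; apply.
  rewrite gtr0_norm //; near: n; exact: near_infty_natSinv_lt (PosNum r0).
by rewrite gt_eqF.
Unshelve. all: by end_near.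
Qed.

Lemma deriveNdir f x v : derivable f x v -> 'D_(- v) f x = - 'D_v f x.
Proof.
move=> df; apply/cvg_lim => //.
apply/cvgrPdist_lt => e e0.
have /cvgrPdist_lt /(_ e e0) := df.
rewrite !near_withinE => /nbhs_ballP[r /= r0 rP].
apply/nbhs_ballP; exists r => //= h; rewrite /ball /= sub0r normrN => hr h0.
have := rP (- h); rewrite /ball /= sub0r normrN normrN oppr_eq0 => /(_ hr h0).
rewrite -normrN opprB scalerN -scaleNr => H; apply: le_lt_trans H.
rewrite le_eqVlt; apply/orP; left; apply/eqP; congr `|_|.
by rewrite invrN !scaleNr addrC.
Qed.

Lemma derive_lipschitz f v (M : R) x (a b : R) :
  (forall y, derivable f y v) -> (forall t, `|'D_v f (t *: v + x)| <= M) ->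
  `|f (a *: v + x) - f (b *: v + x)| <= M * `|a - b|.
Proof.
move=> df dM; wlog ab : a b / b <= a.
  have [ab|/ltW ba] := leP b a; first exact.
  by move=> /(_ b a ba); rewrite distrC (distrC b).
have cf : continuous (fun h : R => f (h *: v + x)).
  move=> t; apply/differentiable_continuous/derivable1_diffP.
  by have [] := is_derive_line (df (t *: v + x)).
have [c _ ->] := MVT_segment ab (fun t _ => is_derive_line (df (t *: v + x)))
  (continuous_subspaceT cf).
by rewrite normrM ler_wpM2r.
Qed.

End directional.

(** * Test functions and their derivatives along the direction variable *)

Section test_functions.
Variables (R : realType) (Om : set (R3 R)).
Hypotheses (oOm : open Om) (bOm : bounded_set Om).

Let mphase : measurable (phase Om).
Proof. exact: measurable_phase. Qed.

Lemma L2_bounded (f : R3 R * R3 R -> R) M : measurable_fun (phase Om) f ->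
  (forall x, phase Om x -> `|f x| <= M) -> L2_phase Om f.
Proof.
move=> mf fM; split => //.
apply: (@le_lt_trans _ _ (\int[@phase_measure R]_(x in phase Om) (M ^+ 2)%:E)%E).
  apply: ge0_le_integral => //.
  - by move=> x _; rewrite lee_fin sqr_ge0.
  - by apply/measurable_EFinP; exact: measurable_funX.
  - move=> x Dx; rewrite lee_fin -(real_normK (num_real (f x))).
    have := fM x Dx; have := normr_ge0 (f x) => h1 h2.
    by rewrite ler_sqr ?nnegrE // (le_trans h1).
have pfin : phase_measure (phase Om) \is a fin_num.
  by rewrite ge0_fin_numE // phase_measure_lty.
by rewrite integral_cst //= -(fineK pfin) -EFinM ltry.
Qed.

Definition pos_axis (i : 'I_3) : R3 R :=
  ((((i : nat) == 0%N)%:R, ((i : nat) == 1%N)%:R), ((i : nat) == 2%N)%:R).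

Lemma bounded_off_compact (f : R3 R * R3 R -> R) (K : set (R3 R)) :
  continuous f -> compact K -> (forall x, ~ K x.1 -> f x = 0) ->
  exists2 M, 0 <= M & forall x, sphere x.2 -> `|f x| <= M.
Proof.
move=> cf cK f0.
have cKS : compact (K `*` @sphere R).
  by apply: compact_setX => //; exact: compact_sphere.
have /compact_bounded[M [_ MK]] := continuous_compact (continuous_subspaceT cf) cKS.
exists (`|M| + 1) => [|x x1]; first by rewrite addr_ge0.
have [Kx|nKx] := pselect (K x.1); last by rewrite f0 // normr0 addr_ge0.
by apply: MK; [rewrite ltr_pwDr // ler_norm|exists x].
Qed.

Lemma derive_off_compact (f : R3 R * R3 R -> R) (K : set (R3 R)) v x :
  compact K -> (forall x, ~ K x.1 -> f x = 0) -> ~ K x.1 -> 'D_v f x = 0.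
Proof.
move=> cK f0 nKx; rewrite (@near_eq_derive _ _ _ f (cst 0)); last first.
  have oK : open (~` K).
    by apply: closed_openC; apply: compact_closed => //; exact: norm_hausdorff.
  have nK : \forall y \near x.1, ~ K y by apply: open_nbhs_nbhs; split.
  have : \forall y \near x, ~ K y.1.
    exists (~` K, setT); first by split => //; exact: filterT.
    by move=> y [].
  by apply: filterS => y /f0.
by rewrite derive_cst.
Qed.

(** [test_fun] gives continuity of the derivative for each fixed direction only. Splitting a
    displacement along the three axes reduces a bound uniform in the direction to three bounded
    functions. *)
Lemma test_fun_lipschitz phi : test_fun Om phi -> exists2 M, 0 <= M &
  forall r s v (h : R), sphere s -> sphere v ->
    `|phi (h *: v + r, s) - phi (r, s)| <= M * `|h|.
Proof.
move=> [cphi dphi cdphi [K [cK _ K0]]].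
have bd i : exists2 M, 0 <= M &
    forall x, sphere x.2 -> `|'D_(pos_axis i, 0) phi x| <= M.
  apply: (@bounded_off_compact _ K) => // x; exact: derive_off_compact.
have [M0 M00 h0] := bd ord0; have [M1 M10 h1] := bd (inord 1).
have [M2 M20 h2] := bd (inord 2).
have step i M r s (t : R) : sphere s ->
    (forall x, sphere x.2 -> `|'D_(pos_axis i, 0) phi x| <= M) ->
    `|phi (t *: pos_axis i + r, s) - phi (r, s)| <= M * `|t|.
  move=> s1 hM.
  have := @derive_lipschitz R _ phi (pos_axis i, 0) M (r, s) t 0.
  have e (c : R) : c *: (pos_axis i, 0 : R3 R) + (r, s) = (c *: pos_axis i + r, s).
    by congr (_, _); rewrite /= scaler0 add0r.
  rewrite !e scale0r add0r subr0; apply => [y|c]; first exact: dphi.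
  by rewrite e; exact: hM.
exists (M0 + M1 + M2); first by rewrite !addr_ge0.
move=> r s v h s1 v1.
have [v11 v12 v2] := sphere_le1 v1.
pose r1 := (h * v.1.1) *: pos_axis ord0 + r.
pose r2 := (h * v.1.2) *: pos_axis (inord 1) + r1.
pose r3 := (h * v.2) *: pos_axis (inord 2) + r2.
have -> : h *: v + r = r3.
  rewrite /r3 /r2 /r1 /pos_axis !inordK //.
  case: v {v1 v11 v12 v2 r1 r2 r3} => [[a b] c]; case: r => [[x y] z].
  by congr (_, _, _); rewrite /= !scaler0 ?add0r [_ *: (1 : R^o)]mulr1.
have b (t M : R) : `|t| <= 1 -> 0 <= M -> M * `|h * t| <= M * `|h|.
  by move=> t1 MM; rewrite normrM ler_wpM2l // ler_piMr.
have k1 := step ord0 M0 r s (h * v.1.1) s1 h0.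
have k2 := step (inord 1) M1 r1 s (h * v.1.2) s1 h1.
have k3 := step (inord 2) M2 r2 s (h * v.2) s1 h2.
have := b _ _ v11 M00; have := b _ _ v12 M10; have := b _ _ v2 M20.
rewrite -/r1 in k1; rewrite -/r2 in k2; rewrite -/r3 in k3.
have -> : phi (r3, s) - phi (r, s) = (phi (r3, s) - phi (r2, s)) +
   ((phi (r2, s) - phi (r1, s)) + (phi (r1, s) - phi (r, s))) by ring.
have := ler_normD (phi (r3, s) - phi (r2, s))
  ((phi (r2, s) - phi (r1, s)) + (phi (r1, s) - phi (r, s))).
have := ler_normD (phi (r2, s) - phi (r1, s)) (phi (r1, s) - phi (r, s)).
by lra.
Qed.

Lemma test_fun_L2 phi : test_fun Om phi -> L2_phase Om phi.
Proof.
move=> [cphi _ _ [K [cK _ K0]]].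
have [M _ hM] := bounded_off_compact cphi cK K0.
apply: (@L2_bounded _ M) => [|x [_ x1]]; last exact: hM.
by apply: measurable_funTS; exact: continuous_measurable_R3R3.
Qed.

(** The direction moves with the point: measurability comes from difference quotients, boundedness
    from the Lipschitz constant, which survives the limit. *)
Lemma test_fun_derive_L2 phi : test_fun Om phi ->
  L2_phase Om (fun x => 'D_(x.2, 0) phi x).
Proof.
move=> tphi; have [cphi dphi _ _] := tphi.
have [M M0 lip] := test_fun_lipschitz tphi.
pose q (n : nat) (x : R3 R * R3 R) := n.+1%:R * (phi (n.+1%:R^-1 *: x.2 + x.1, x.2) - phi x).
have qD x : q n x @[n --> \oo] --> 'D_(x.2, 0) phi x.
  rewrite [X in X @ _ --> _](_ : _ = fun n => n.+1%:R *
    (phi (n.+1%:R^-1 *: (x.2, 0) + x) - phi x)).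
    exact: derive_quotient_cvg (dphi x x.2).
  apply/funext => n; rewrite /q; congr (_ * (phi _ - _)).
  by case: x => r s; congr (_, _); rewrite /= scaler0 add0r.
apply: (@L2_bounded _ M) => [|x [_ x1]].
  apply: (@measurable_fun_cvg _ _ _ _ q) => [n|x _]; last exact: qD.
  apply: measurable_funTS; apply: continuous_measurable_R3R3 => x.
  apply: cvgM; first exact: cvg_cst.
  apply: cvgB; last exact: cphi.
  apply: (@continuous_comp _ _ _
    (fun x : R3 R * R3 R => (n.+1%:R^-1 *: x.2 + x.1, x.2)) phi); last exact: cphi.
  have c1 : n.+1%:R^-1 *: y.2 + y.1 @[y --> x] --> n.+1%:R^-1 *: x.2 + x.1.
    apply: cvgD; last exact: cvg_fst.
    by apply: cvgZr; exact: cvg_snd.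
  have c2 : y.2 @[y --> x] --> x.2 by exact: cvg_snd.
  move=> A [[P Q] /= [nP nQ] PQA]. 
  have h1 : nbhs x [set y : R3 R * R3 R | P (n.+1%:R^-1 *: y.2 + y.1)] := c1 _ nP.
  have h2 : nbhs x [set y : R3 R * R3 R | Q y.2] := c2 _ nQ.
  suff : nbhs x [set y : R3 R * R3 R | A (n.+1%:R^-1 *: y.2 + y.1, y.2)] by [].
  by apply: filterS2 h1 h2 => y Py Qy; exact: PQA.
apply: (@closed_cvg _ _ _ _ (q^~ x) (fun y => `|y| <= M) _ _ _ (qD x)).
  suff : closed ((fun y : R => `|y|) @^-1` [set y | y <= M]) by [].
  by apply: closed_comp; [move=> y _; exact: norm_continuous|exact: closed_le].
apply: nearW => n; rewrite /q normrM.
have := lip x.1 x.2 x.2 n.+1%:R^-1 x1 x1; rewrite -surjective_pairing.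
have n0 : 0 < n.+1%:R :> R by [].
have ni : 0 < n.+1%:R^-1 :> R by rewrite invr_gt0.
rewrite (gtr0_norm n0) (gtr0_norm ni) => h.
by rewrite mulrC -ler_pdivlMr.
Qed.

Lemma is_sgrad_lin c u d v e : L2_phase Om u -> L2_phase Om d ->
  L2_phase Om v -> L2_phase Om e -> is_sgrad Om u d -> is_sgrad Om v e ->
  is_sgrad Om (fun x => c * u x + v x) (fun x => c * d x + e x).
Proof.
move=> Lu Ld Lv Le ud ve phi tphi; have Lp := test_fun_L2 tphi.
have LD := test_fun_derive_L2 tphi.
by rewrite !ip_linl // ud // ve //; ring.
Qed.

End test_functions.

Section pos_C1.
Variable R : realType.

Lemma continuousMr (T : topologicalType) (f g : T -> R) :
  continuous f -> continuous g -> continuous (fun x => f x * g x).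
Proof. by move=> cf cg x; apply: cvgM; [exact: cf|exact: cg]. Qed.

Lemma continuousNr (T : topologicalType) (f : T -> R) :
  continuous f -> continuous (fun x => - f x).
Proof. by move=> cf x; apply: cvgN; exact: cf. Qed.

Lemma continuousDr (T : topologicalType) (f g : T -> R) :
  continuous f -> continuous g -> continuous (fun x => f x + g x).
Proof. by move=> cf cg x; apply: cvgD; [exact: cf|exact: cg]. Qed.

Lemma continuousVr (T : topologicalType) (f : T -> R) : (forall x, f x != 0) ->
  continuous f -> continuous (fun x => (f x)^-1).
Proof. by move=> f0 cf x; apply: cvgV => //; exact: cf. Qed.

Implicit Types f g : R3 R * R3 R -> R.

(** The regularity required in [test_fun] without the support condition, so that constants, sums,
    products and inverses of nonvanishing functions stay in the class. *)
Definition pos_C1 f := [/\ continuous f,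
  forall x v, derivable f x (v, 0) & forall v, continuous (fun x => 'D_(v, 0) f x)].

Lemma pos_C1_mul f g : pos_C1 f -> pos_C1 g -> pos_C1 (f * g).
Proof.
move=> [cf df cdf] [cg dg cdg]; split.
- exact: (continuousMr cf cg).
- by move=> x v; exact: derivableM.
- move=> v; have -> : (fun x => 'D_(v, 0) (f * g) x) =
      fun x => f x * 'D_(v, 0) g x + g x * 'D_(v, 0) f x.
    by apply/funext => x; rewrite deriveM.
  exact: (continuousDr (continuousMr cf (cdg v)) (continuousMr cg (cdf v))).
Qed.

Lemma pos_C1_cst c : pos_C1 (cst c).
Proof.
split; first by move=> x; exact: cvg_cst.
- by move=> x v; exact: derivable_cst.
- move=> v; rewrite (_ : (fun x => _) = cst 0); first by move=> x; exact: cvg_cst.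
  by apply/funext => x; rewrite derive_cst.
Qed.

Lemma pos_C1_prod n (F : 'I_n -> R3 R * R3 R -> R) : (forall i, pos_C1 (F i)) ->
  pos_C1 (\prod_(i < n) F i).
Proof.
move=> hF; apply: (big_ind pos_C1) => //; first exact: pos_C1_cst.
exact: pos_C1_mul.
Qed.

Lemma pos_C1_add f g : pos_C1 f -> pos_C1 g -> pos_C1 (f + g).
Proof.
move=> [cf df cdf] [cg dg cdg]; split; first exact: continuousDr.
- by move=> x v; exact: derivableD.
- move=> v; have -> : (fun x => 'D_(v, 0) (f + g) x) =
      fun x => 'D_(v, 0) f x + 'D_(v, 0) g x.
    by apply/funext => x; rewrite deriveD.
  exact: (continuousDr (cdf v) (cdg v)).
Qed.

Lemma pos_C1_inv f : (forall x, f x != 0) -> pos_C1 f ->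
  pos_C1 (fun x => (f x)^-1).
Proof.
move=> f0 [cf df cdf]; have cV := continuousVr f0 cf.
split; [exact: cV| |move=> v].
- by move=> x v; exact: (derivableV (f0 x) (df x v)).
- have -> : (fun x => 'D_(v, 0) (fun y => (f y)^-1) x) =
      fun x => - ((f x)^-1 * (f x)^-1) * 'D_(v, 0) f x.
    apply/funext => x; rewrite (deriveV (f0 x) (df x v)).
    by rewrite /GRing.scale /= expr2 invfM.
  exact: (continuousMr (continuousNr (continuousMr cV cV)) (cdf v)).
Qed.

(** As [c] decreases to 0 these ratios increase to the indicator of the set where [f] is
    positive. *)
Lemma pos_C1_ratio f c : 0 < c -> (forall x, 0 <= f x) -> pos_C1 f ->
  pos_C1 (fun x => f x / (f x + c)).
Proof.
move=> c0 f0 Cf.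
have fc0 x : (f + cst c) x != 0 by rewrite gt_eqF // ltr_wpDl //; exact: f0.
exact: (pos_C1_mul Cf (pos_C1_inv fc0 (pos_C1_add Cf (pos_C1_cst c)))).
Qed.

(** A simple function of class C^1 that is positive exactly on the positive half-line. *)
Definition sqp (y : R) : R := Num.max y 0 ^+ 2.

Lemma sqp_taylor y k : `|sqp (y + k) - sqp y - 2 * Num.max y 0 * k| <= k ^+ 2.
Proof.
rewrite /sqp ler_norml; have := sqr_ge0 k; have := sqr_ge0 y.
have := sqr_ge0 (y + k).
case: (leP y 0) => y0; case: (leP (y + k) 0) => yk; rewrite !expr2 => *;
  apply/andP; split; nra.
Qed.

(** [L] is affine with linear part [l], so the quadratic remainder in [sqp_taylor] yields the
    derivative [2 * Num.max (L x) 0 * l v]. *)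
Lemma pos_C1_sqp (L l : R3 R * R3 R -> R) : continuous L ->
  (forall h v x, L (h *: v + x) = L x + h * l v) -> pos_C1 (sqp \o L).
Proof.
move=> cL Ll.
have cmax : continuous (fun x => Num.max (L x) 0).
  by move=> x; apply: (@continuous_max R _ L (cst 0) x);
    [exact: cL|exact: cvg_cst].
have D x v : (fun h : R => h^-1 *: (((sqp \o L) \o shift x) (h *: v) - (sqp \o L) x)) @ 0^'
    --> 2 * Num.max (L x) 0 * l v.
  apply/cvgrPdist_le => e e0; rewrite near_withinE; apply/nbhs_ballP.
  have l0 : 0 < l v ^+ 2 + 1 by rewrite ltr_wpDl // sqr_ge0.
  (* The difference quotient is off by at most [|h| * l v ^ 2]; the added 1 covers [l v = 0]. *)
  exists (e / (l v ^+ 2 + 1)) => /=; first by rewrite divr_gt0.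
  move=> h; rewrite /ball /= sub0r normrN => he h0.
  rewrite Ll; have := sqp_taylor (L x) (h * l v).
  have hn : 0 < `|h| by rewrite normr_gt0.
  move=> T; rewrite -(ler_pM2l hn) -normrM mulrBr.
  rewrite (_ : h * (h^-1 *: _) = sqp (L x + h * l v) - sqp (L x)); last first.
    by rewrite /GRing.scale /= mulVKf.
  rewrite distrC (_ : h * (2 * _ * _) = 2 * Num.max (L x) 0 * (h * l v));
    last by rewrite mulrCA.
  apply: le_trans T _.
  rewrite exprMn -(real_normK (num_real h)) expr2 -mulrA ler_wpM2l //.
  rewrite ltW //; apply: le_lt_trans (_ : `|h| * (l v ^+ 2 + 1) < _).
    by rewrite ler_wpM2l // lerDl.
  by rewrite -ltr_pdivlMr.
have DE x v : 'D_v (sqp \o L) x = 2 * Num.max (L x) 0 * l v.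
  exact: cvg_lim (D x v).
split.
- have -> : sqp \o L = fun x => Num.max (L x) 0 * Num.max (L x) 0.
    by apply/funext => x; rewrite /comp /sqp expr2.
  exact: (continuousMr cmax cmax).
- by move=> x v; apply/cvg_ex; eexists; exact: D.
- move=> v; have -> : (fun x => 'D_(v, 0) (sqp \o L) x) =
      fun x => Num.max (L x) 0 * (2 * l (v, 0)).
    by apply/funext => x; rewrite DE; ring.
  by apply: (continuousMr cmax); exact: cst_continuous.
Qed.

End pos_C1.

(** * Boxes in the six coordinates and test functions approximating their indicators *)

Section six_boxes.
Variable R : realType.
Local Notation X := (R3 R * R3 R)%type.

Definition coord (i : 'I_6) (x : X) : R :=
  nth 0 [:: x.1.1.1; x.1.1.2; x.1.2; x.2.1.1; x.2.1.2; x.2.2] i.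

Lemma coord_lin i h v x : coord i (h *: v + x) = coord i x + h * coord i v.
Proof. by rewrite addrC; case: i => [[|[|[|[|[|[|//]]]]]] ?]. Qed.

Lemma continuous_coord i : continuous (coord i).
Proof.
have c1 (T1 T2 : topologicalType) : continuous (@fst T1 T2).
  by move=> x; exact: cvg_fst.
have c2 (T1 T2 : topologicalType) : continuous (@snd T1 T2).
  by move=> x; exact: cvg_snd.
move: i; have cc (T1 T2 T3 : topologicalType) (f : T1 -> T2) (g : T2 -> T3) :
    continuous f -> continuous g -> continuous (fun x => g (f x)).
  by move=> cf cg x; apply: (@continuous_comp _ _ _ f g); [exact: cf|exact: cg].
case=> [[|[|[|[|[|[|//]]]]]] ?]; rewrite /coord /=.
- exact: (cc _ _ _ _ _ (c1 (R3 R) (R3 R)) (cc _ _ _ _ _ (c1 (R * R)%type R) (c1 R R))).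
- exact: (cc _ _ _ _ _ (c1 (R3 R) (R3 R)) (cc _ _ _ _ _ (c1 (R * R)%type R) (c2 R R))).
- exact: (cc _ _ _ _ _ (c1 (R3 R) (R3 R)) (c2 (R * R)%type R)).
- exact: (cc _ _ _ _ _ (c2 (R3 R) (R3 R)) (cc _ _ _ _ _ (c1 (R * R)%type R) (c1 R R))).
- exact: (cc _ _ _ _ _ (c2 (R3 R) (R3 R)) (cc _ _ _ _ _ (c1 (R * R)%type R) (c2 R R))).
- exact: (cc _ _ _ _ _ (c2 (R3 R) (R3 R)) (c2 (R * R)%type R)).
Qed.

Lemma measurable_coord i : measurable_fun setT (coord i).
Proof. exact: (continuous_measurable_R3R3 (@continuous_coord i)). Qed.

Definition box6 (a b : 'I_6 -> R) : set X :=
  [set x | forall i, a i < coord i x < b i].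

Definition boxes6 : set (set X) := [set B | exists a b, B = box6 a b].

Lemma boxes6I : setI_closed boxes6.
Proof.
move=> _ _ [a [b ->]] [a' [b' ->]].
exists (fun i => Num.max (a i) (a' i)), (fun i => Num.min (b i) (b' i)).
apply/seteqP; split => x /=.
  by move=> [h h'] i; have := h i; have := h' i; rewrite gt_max lt_min;
    move=> /andP[-> ->] /andP[-> ->].
by move=> h; split => i; have := h i; rewrite gt_max lt_min;
  move=> /andP[/andP[? ?] /andP[? ?]]; apply/andP.
Qed.

Lemma measurable_box6 a b : measurable (box6 a b).
Proof.
rewrite (_ : box6 a b = \bigcap_(i in [set: 'I_6]) (coord i @^-1` `]a i, b i[%classic)).
  apply: fin_bigcap_measurable => // i _; rewrite -[X in measurable X]setTI.
  by apply: measurable_coord => //; exact: measurable_itv.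
apply/seteqP; split => x /= h i; first by move=> _; rewrite /= in_itv /=; exact: h.
by have := h i Logic.I; rewrite /= in_itv.
Qed.

Lemma bigcup_box6 : \bigcup_n box6 (fun=> - n%:R) (fun=> n%:R) = setT.
Proof.
apply/seteqP; split => // x _.
pose M := \big[Num.max/0]_(i < 6) `|coord i x|.
exists (Num.truncn M).+1 => // i; rewrite -ltr_norml.
apply: (@le_lt_trans _ _ M); last exact: truncnS_gt.
by rewrite /M; exact: le_bigmax.
Qed.

Lemma measurable_boxes6 : @measurable _ X = <<s boxes6 >>.
Proof.
apply/seteqP; split; last first.
  apply: smallest_sub; first exact: sigma_algebra_measurable.
  by move=> _ [a [b ->]]; exact: measurable_box6.
have cm i : measurable_fun setT (fun x : g_sigma_algebraType boxes6 => coord i x).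
  refine (@measurability _ _ _ _ _ _ _ (RGenOInfty.measurableE R) _).
  move=> _ [_ [c ->] <-]; rewrite setTI.
  (* A half-space is a countable union of boxes whose sides other than the bounding one grow with
     [n]. *)
  rewrite (_ : _ @^-1` _ = \bigcup_n
    box6 (fun j => if j == i then c else - n%:R) (fun=> n%:R)).
    apply: bigcupT_measurable => n; apply: sub_sigma_algebra.
    by exists (fun j => if j == i then c else - n%:R), (fun=> n%:R).
  apply/seteqP; split => x /=; rewrite in_itv /= andbT.
    move=> cx; have : [set: X] x by [].
    rewrite -bigcup_box6 => -[n _ xn]; exists n => // j.
    by have := xn j; case: eqP => [->|] //; rewrite cx => /andP[_ ->].
  by move=> [n _ /(_ i)]; rewrite eqxx => /andP[].
have mid : measurable_fun setT
    (fun x : g_sigma_algebraType boxes6 => (x : X)).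
  apply/measurable_fun_pairP; split; apply/measurable_fun_pairP; split;
    try (apply/measurable_fun_pairP; split).
  - exact: (cm (@Ordinal 6 0 isT)).
  - exact: (cm (@Ordinal 6 1 isT)).
  - exact: (cm (@Ordinal 6 2 isT)).
  - exact: (cm (@Ordinal 6 3 isT)).
  - exact: (cm (@Ordinal 6 4 isT)).
  - exact: (cm (@Ordinal 6 5 isT)).
by move=> A mA; have := mid measurableT A mA; rewrite setTI.
Qed.

(** One factor for each of the twelve faces: the product is positive exactly on the open box. *)
Definition bump (a b : 'I_6 -> R) : X -> R :=
  \prod_(i < 6) ((@sqp R \o (fun x => coord i x - a i)) *
                 (@sqp R \o (fun x => b i - coord i x))).

Lemma bumpE a b x : bump a b x =
  \prod_(i < 6) (sqp (coord i x - a i) * sqp (b i - coord i x)).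
Proof.
apply: (big_ind2 (fun (f : X -> R) (c : R) => f x = c)) => //.
by move=> f c g d <- <-.
Qed.

Lemma pos_C1_bump a b : pos_C1 (bump a b).
Proof.
apply: pos_C1_prod => i; apply: pos_C1_mul.
- apply: (@pos_C1_sqp _ _ (coord i)) => [x|h v x]; last by rewrite coord_lin; ring.
  by apply: cvgB; [exact: continuous_coord|exact: cvg_cst].
- apply: (@pos_C1_sqp _ _ (fun x => - coord i x)) => [x|h v x]; last by rewrite coord_lin; ring.
  by apply: cvgB; [exact: cvg_cst|exact: continuous_coord].
Qed.

Lemma sqp_ge0 (y : R) : 0 <= sqp y.
Proof. exact: sqr_ge0. Qed.

Lemma sqp_gt0 (y : R) : (0 < sqp y) = (0 < y).
Proof.
rewrite /sqp; have [y0|y0] := leP y 0; first by rewrite expr0n ltxx.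
by rewrite exprn_gt0.
Qed.

Lemma bump_ge0 a b x : 0 <= bump a b x.
Proof. by rewrite bumpE prodr_ge0 // => i _; rewrite mulr_ge0 ?sqp_ge0. Qed.

Lemma bump_gt0 a b x : 0 < bump a b x <-> box6 a b x.
Proof.
rewrite bumpE; split => [h i|h].
  apply: contraPT h => nx.
  rewrite (bigD1 i) //= (_ : sqp _ * sqp _ = 0) ?mul0r ?ltxx //.
  apply/eqP; rewrite mulf_eq0; move: nx; rewrite negb_and -!leNgt.
  case/orP => h; apply/orP; [left|right]; rewrite eq_le sqp_ge0 andbT;
    by rewrite leNgt sqp_gt0 -leNgt subr_le0.
by apply: prodr_gt0 => i _; rewrite mulr_gt0 // sqp_gt0 subr_gt0;
  have /andP[] := h i.
Qed.

(** These ratios are bounded by 1 and tend pointwise to the indicator of the box, as dominated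
    convergence requires. *)
Definition bump_seq a b (n : nat) (x : X) : R :=
  bump a b x / (bump a b x + n.+1%:R^-1).

Lemma bump_seq_le1 a b n x : `|bump_seq a b n x| <= 1.
Proof.
have n0 : 0 < n.+1%:R^-1 :> R by rewrite invr_gt0.
have b0 := bump_ge0 a b x.
have bn : 0 < bump a b x + n.+1%:R^-1 by rewrite ltr_wpDl.
rewrite /bump_seq ger0_norm; last by rewrite divr_ge0 // ltW.
by rewrite ler_pdivrMr // mul1r lerDl ltW.
Qed.

Lemma bump_seq_cvg a b x : bump_seq a b n x @[n --> \oo] --> (\1_(box6 a b) x : R).
Proof.
have [bx|nbx] := pselect (box6 a b x).
  have b0 : 0 < bump a b x by apply/bump_gt0.
  rewrite indicE mem_set //= -[X in _ --> X](divff (lt0r_neq0 b0)).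
  apply: cvgM; first exact: cvg_cst.
  apply: cvgV; first exact: lt0r_neq0.
  rewrite -[X in _ --> X]addr0; apply: cvgD; first exact: cvg_cst.
  exact: cvg_harmonic.
have b0 : bump a b x = 0.
  apply/eqP; rewrite eq_le bump_ge0 andbT leNgt; apply/negP.
  by move/bump_gt0.
rewrite indicE memNset //= [X in X @ _ --> _](_ : _ = cst 0); first exact: cvg_cst.
by apply/funext => n; rewrite /bump_seq b0 mul0r.
Qed.

Lemma test_fun_bump_seq (Om : set (R3 R)) a b n (K : set (R3 R)) :
  compact K -> K `<=` Om -> (forall x, box6 a b x -> K x.1) ->
  test_fun Om (bump_seq a b n).
Proof.
move=> cK KO abK.
have n0 : 0 < n.+1%:R^-1 :> R by rewrite invr_gt0.
have [h1 h2 h3] := pos_C1_ratio n0 (bump_ge0 a b) (pos_C1_bump a b).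
split => //; exists K; split => // x nKx.
rewrite /bump_seq (_ : bump a b x = 0) ?mul0r //.
apply/eqP; rewrite eq_le bump_ge0 andbT leNgt; apply/negP.
by move/bump_gt0/abK.
Qed.

End six_boxes.

Section density.
Context d (T : measurableType d) (R : realType) (mu : {measure set T -> \bar R}).
Variable f : T -> \bar R.
Hypotheses (mf : measurable_fun setT f) (f0 : forall x, (0 <= f x)%E).

Definition density_measure (A : set T) : \bar R := (\int[mu]_(x in A) f x)%E.

Let density_measure0 : density_measure set0 = 0%E.
Proof. exact: integral_set0. Qed.

Let density_measure_ge0 A : (0 <= density_measure A)%E.
Proof. exact: integral_ge0. Qed.

Let density_measure_sigma_additive : semi_sigma_additive density_measure.
Proof. exact: semi_sigma_additive_nng_induced. Qed.

HB.instance Definition _ := isMeasure.Build _ _ _ density_measure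
  density_measure0 density_measure_ge0 density_measure_sigma_additive.

(** The measure structure depends on the proofs [mf] and [f0]; the pair hands it out together with
    its defining formula. *)
Lemma density_measure_def :
  { m : {measure set T -> \bar R} | forall A, m A = (\int[mu]_(x in A) f x)%E }.
Proof. by exists density_measure. Qed.

End density.

(** The positive and negative parts of [h] are densities of two finite measures that agree on a
    generating pi-system, hence on all measurable sets; so [h] has integral 0 over each of them. *)
Lemma integral_pi_system_eq0 d (T : measurableType d) (R : realType)
    (mu : {measure set T -> \bar R}) (G : set (set T)) (g : (set T)^nat)
    (h : T -> R) : measurable = <<s G >> -> setI_closed G ->
  (forall n, G (g n)) -> \bigcup_n (g n) = setT ->
  mu.-integrable setT (EFin \o h) ->
  (forall A, G A -> (\int[mu]_(x in A) (h x)%:E = 0)%E) ->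
  {ae mu, forall x, h x = 0}.
Proof.
move=> mG GI Gg gT ih h0.
have mh := measurable_int _ ih.
have mp := measurable_funepos mh; have mn := measurable_funeneg mh.
have [mpos mposE] := density_measure_def mu mp (fun x => funepos_ge0 _ x).
have [mneg mnegE] := density_measure_def mu mn (fun x => funeneg_ge0 _ x).
have mGm A : G A -> measurable A by move=> GA; rewrite mG; exact: sub_sigma_algebra.
have ip A : measurable A -> mu.-integrable A (EFin \o h).
  by move=> mA; exact: integrableS ih.
have fpos A : measurable A -> mpos A \is a fin_num.
  by move=> mA; rewrite mposE; apply: integrable_fin_num => //;
    apply: integrable_funepos => //; exact: ip.
have fneg A : measurable A -> mneg A \is a fin_num.
  by move=> mA; rewrite mnegE; apply: integrable_fin_num => //;
    apply: integrable_funeneg => //; exact: ip.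
have hE A : (\int[mu]_(x in A) (h x)%:E = mpos A - mneg A)%E.
  by rewrite integralE mposE mnegE.
have eqm A : measurable A -> mpos A = mneg A.
  apply: (measure_unique G g mG GI Gg gT) => [B GB|k]; last first.
    by rewrite -ge0_fin_numE ?measure_ge0 // fpos //; apply: mGm; exact: Gg.
  have fp := fpos _ (mGm _ GB); have fn := fneg _ (mGm _ GB).
  have := h0 _ GB; rewrite hE -(fineK fp) -(fineK fn) -EFinB => -[/eqP].
  by rewrite subr_eq0 => /eqP ->.
have /= := @integral_ae_eq _ _ _ mu setT measurableT (cst 0%E) (EFin \o h) ih.
move=> H; have {}H : ae_eq mu setT (EFin \o h) (cst 0%E).
  apply: H => // E _ mE; rewrite integral0 hE eqm // subee //; exact: fneg.
by apply: filterS H => x /= /(_ Logic.I) [].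
Qed.

(** * A square-integrable function orthogonal to all test functions vanishes *)

Section weak_derivative_unique.
Variables (R : realType) (Om : set (R3 R)).
Hypotheses (oOm : open Om) (bOm : bounded_set Om).
Variable d : R3 R * R3 R -> R.
Hypotheses (Ld : L2_phase Om d)
  (d0 : forall phi, test_fun Om phi -> ip_phase Om d phi = 0).

Let mphase : measurable (phase Om).
Proof. exact: measurable_phase. Qed.

Let L1d : (@phase_measure R).-integrable (phase Om) (EFin \o d).
Proof.
have L1 : L2_phase Om (fun=> 1 : R).
  by apply: (@L2_bounded _ _ _ _ _ 1) => // x _; rewrite normr1.
have := L2_mul_integrable mphase Ld L1.
by apply: eq_integrable => // x _ /=; rewrite mulr1.
Qed.

(** Orthogonality to [bump_seq a b n] passes to the limit by dominated convergence with majorant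
    [|d|], integrable because the phase space has finite measure. *)
Let integral_box6 a b (K : set (R3 R)) :
  compact K -> K `<=` Om -> (forall x, box6 a b x -> K x.1) ->
  (\int[@phase_measure R]_(x in phase Om) (d x * \1_(box6 a b) x)%:E = 0)%E.
Proof.
move=> cK KO abK; have [md _] := Ld.
have tb n := test_fun_bump_seq n cK KO abK.
pose f_ n x := (d x * bump_seq a b n x)%:E.
have mf_ n : measurable_fun (phase Om) (f_ n).
  apply/measurable_EFinP; apply: measurable_funM => //.
  by have [] := test_fun_L2 oOm bOm (tb n).
have mf : measurable_fun (phase Om) (fun x => (d x * \1_(box6 a b) x)%:E).
  apply/measurable_EFinP; apply: measurable_funM => //.
  by apply: measurable_funTS; apply: measurable_indic; exact: measurable_box6.
have ff x : phase Om x -> f_ ^~ x @ \oo --> (d x * \1_(box6 a b) x)%:E.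
  move=> _; apply: cvg_EFin; first exact: nearW.
  by apply: cvgM; [exact: cvg_cst|exact: bump_seq_cvg].
have ig : (@phase_measure R).-integrable (phase Om) (fun x => `|d x|%:E).
  by have := integrable_abse L1d.
have fg n x : phase Om x -> (`|f_ n x| <= `|d x|%:E)%E.
  by move=> _; rewrite /= lee_fin normrM ler_piMr // bump_seq_le1.
have [_ _ cvgi] := dominated_convergence mphase mf_ mf (aeW _ ff) ig
  (aeW _ (fun x n => fg n x)).
have i0 n : (\int[@phase_measure R]_(x in phase Om) f_ n x = 0)%E.
  have := d0 (tb n); rewrite /ip /Rintegral => h.
  have := integrable_fin_num mphase (L2_mul_integrable mphase Ld (test_fun_L2 oOm bOm (tb n))).
  by move/fineK; rewrite -[RHS]/(_)%E => <-; rewrite /= h.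
rewrite -(cvg_lim _ cvgi) //.
rewrite (_ : (fun n => _) = cst 0%E) ?lim_cst //.
by apply/funext => n; exact: i0.
Qed.

Local Notation box_index := (((rat * rat) * (rat * rat)) * (rat * rat))%type.

(** Lower corner of the intersection with [obox q] in position. The list has three entries, so for
    the direction coordinates [nth] returns its default [a i], left unchanged. *)
Let lo (q : box_index) (a : 'I_6 -> R) (i : 'I_6) : R :=
  nth (a i) [:: Num.max (a i) (ratr q.1.1.1); Num.max (a i) (ratr q.1.2.1);
    Num.max (a i) (ratr q.2.1)] i.
Let hi (q : box_index) (b : 'I_6 -> R) (i : 'I_6) : R :=
  nth (b i) [:: Num.min (b i) (ratr q.1.1.2); Num.min (b i) (ratr q.1.2.2);
    Num.min (b i) (ratr q.2.2)] i.

Let lo_hi q a b x : box6 (lo q a) (hi q b) x <-> box6 a b x /\ obox q x.1.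
Proof.
split => [h|[h [[/= h1 h2] h3]] i]; last first.
  have := h i; move: h1 h2 h3; rewrite /oitv /= !in_itv /=.
  case: i => [[|[|[|[|[|[|//]]]]]] ?]; rewrite /lo /hi /coord /=;
    by do ![move=> /andP[? ?]]; apply/andP; rewrite ?gt_max ?lt_min; split=> //; apply/andP.
split.
  move=> i; have := h i.
  case: i => [[|[|[|[|[|[|//]]]]]] ?]; rewrite /lo /hi /coord /= ?gt_max ?lt_min //;
  by move=> /andP[/andP[-> _] /andP[-> _]].
have := h (@Ordinal 6 0 isT); have := h (@Ordinal 6 1 isT); have := h (@Ordinal 6 2 isT).
rewrite /lo /hi /coord /= !gt_max !lt_min.
move=> /andP[/andP[_ ?] /andP[_ ?]] /andP[/andP[_ ?] /andP[_ ?]] /andP[/andP[_ ?] /andP[_ ?]].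
by split; [split|]; rewrite /oitv /= in_itv /=; apply/andP.
Qed.

(** Cutting any box down to [obox q] puts its positions in the compact [cbox q], so [d] restricted
    to [obox q] has integral 0 over every box, and the boxes form a generating pi-system. *)
Let ae_obox q : cbox q `<=` Om ->
  {ae @phase_measure R, forall x, phase Om x -> obox q x.1 -> d x = 0}.
Proof.
move=> qO; pose E : set (R3 R * R3 R) := phase Om `&` (obox q `*` setT).
have mE : measurable E.
  by apply: measurableI => //; apply: measurableX => //; exact: measurable_obox.
have ih : (@phase_measure R).-integrable setT (EFin \o (d \_ E)).
  rewrite (_ : _ \o _ = (EFin \o d) \_ E); last by rewrite restrict_EFin.
  apply/(integrable_mkcond _ mE); apply: integrableS L1d => //.
  exact: subIsetl.
have := integral_pi_system_eq0 (@measurable_boxes6 R) (@boxes6I R) _ (bigcup_box6 R) ih.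
move=> H; have {}H : {ae @phase_measure R, forall x, (d \_ E) x = 0}.
  apply: H => [n|_ [a [b ->]]]; first by eexists; eexists.
  rewrite -[RHS](@integral_box6 (lo q a) (hi q b) (cbox q)) //; last 2 first.
  - exact: compact_cbox.
  - by move=> x /lo_hi[_]; exact: obox_cbox.
  rewrite integral_mkcond [RHS]integral_mkcond; apply: eq_integral => x _.
  rewrite !patchE indicE; case: ifPn => [/set_mem abx|abx]; last first.
    case: ifPn => // _; rewrite memNset ?mulr0 // => /lo_hi[/mem_set].
    by rewrite (negbTE abx).
  case: ifPn => [/set_mem[Dx [qx _]]|nE].
    by rewrite !mem_set ?mulr1 //; apply/lo_hi.
  case: ifPn => // /set_mem Dx; rewrite memNset ?mulr0 // => /lo_hi[_ qx].
  by move/negP : nE; apply; apply: mem_set; split.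
by apply: filterS H => x + Dx qx; rewrite restrictE mem_set.
Qed.

Lemma test_fun_orthogonal_ae0 : {ae @phase_measure R, forall x, phase Om x -> d x = 0}.
Proof.
(* Boxes that leave [Om] contribute the empty set, so that the countable union may run over all
   indices. *)
have N q : (@phase_measure R).-negligible
    [set x | cbox q `<=` Om /\ phase Om x /\ obox q x.1 /\ d x <> 0].
  have [qO|nqO] := pselect (cbox q `<=` Om).
    apply: negligibleS (ae_obox qO) => x [_ [Dx [qx dx]]] /= h.
    by apply: dx; exact: h.
  rewrite (_ : mkset _ = set0); first exact: negligible_set0.
  by rewrite -subset0 => x [].
apply: negligibleS (negligible_bigcup_countType N) => x /= /not_implyP[Dx dx].
have [q [qx qO]] := @countable_base_R3 R Om x.1 oOm Dx.1.
by exists q.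
Qed.

End weak_derivative_unique.

Lemma ip_scalel d (T : measurableType d) (R : realType)
    (mu : {measure set T -> \bar R}) (D : set T) (c : R) (u v : T -> R) :
  measurable D -> L2 mu D u -> L2 mu D v ->
  ip mu D (fun x => c * u x) v = c * ip mu D u v.
Proof.
move=> mD Lu Lv; rewrite /ip -RintegralZl //; last exact: L2_mul_integrable.
by apply: eq_Rintegral => x _; rewrite mulrA.
Qed.

Section sgrad_theory.
Variables (R : realType) (Om : set (R3 R)).
Hypotheses (oOm : open Om) (bOm : bounded_set Om).

Let mphase : measurable (phase Om).
Proof. exact: measurable_phase. Qed.

Lemma sgradP u : W2 Om u -> L2_phase Om (sgrad Om u) /\ is_sgrad Om u (sgrad Om u).
Proof.
move=> [_ ex]; rewrite /sgrad.
exact: (@xgetPex _ (fun=> 0) [set d | L2_phase Om d /\ is_sgrad Om u d] ex).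
Qed.

Lemma is_sgrad_unique u d e : L2_phase Om u -> L2_phase Om d -> L2_phase Om e ->
  is_sgrad Om u d -> is_sgrad Om u e -> ae_phase_eq Om d e.
Proof.
move=> Lu Ld Le ud ue.
have L := L2_lin mphase (-1) Le Ld.
have := test_fun_orthogonal_ae0 oOm bOm L.
move=> H; have {}H : {ae @phase_measure R, forall x, phase Om x -> -1 * e x + d x = 0}.
  apply: H => phi tphi; have Lp := test_fun_L2 oOm bOm tphi.
  have := ud _ tphi; have := ue _ tphi; rewrite ip_linl //; lra.
by apply: filterS H => x h Dx; have := h Dx; lra.
Qed.

Lemma W2_lin c u v : W2 Om u -> W2 Om v -> W2 Om (fun x => c * u x + v x).
Proof.
move=> Wu Wv; have [Lu _] := Wu; have [Lv _] := Wv.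
have [Ld ud] := sgradP Wu; have [Le ve] := sgradP Wv.
split; first exact: (L2_lin mphase c Lu Lv).
exists (fun x => c * sgrad Om u x + sgrad Om v x); split.
  exact: (L2_lin mphase c Ld Le).
exact: (is_sgrad_lin oOm bOm c Lu Ld Lv Le ud ve).
Qed.

(** [sgrad] selects some representative, unrelated for different arguments; uniqueness gives
    linearity almost everywhere. *)
Lemma sgrad_lin c u v : W2 Om u -> W2 Om v ->
  ae_phase_eq Om (sgrad Om (fun x => c * u x + v x))
    (fun x => c * sgrad Om u x + sgrad Om v x).
Proof.
move=> Wu Wv; have [Lu _] := Wu; have [Lv _] := Wv.
have [Ld ud] := sgradP Wu; have [Le ve] := sgradP Wv.
have Wuv := W2_lin c Wu Wv; have [Lf uvf] := sgradP Wuv.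
have Luv : L2_phase Om (fun x => c * u x + v x).
  exact: (L2_lin mphase c Lu Lv).
have Lde : L2_phase Om (fun x => c * sgrad Om u x + sgrad Om v x).
  exact: (L2_lin mphase c Ld Le).
apply: (is_sgrad_unique Luv Lf Lde uvf).
exact: (is_sgrad_lin oOm bOm c Lu Ld Lv Le ud ve).
Qed.

Lemma flip_line (h : R) (v : R3 R) x :
  flip (h *: (v, 0) + x) = h *: (v, 0) + flip x.
Proof. by congr (_, _); rewrite /= !scaler0 !add0r. Qed.

Lemma flip_derive_quotient (phi : R3 R * R3 R -> R) x v :
  (fun h : R => h^-1 *: (((phi \o @flip R) \o shift x) (h *: (v, 0)) - (phi \o @flip R) x)) =
  (fun h : R => h^-1 *: ((phi \o shift (flip x)) (h *: (v, 0)) - phi (flip x))).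
Proof. by apply/funext => h; rewrite /= flip_line. Qed.

Lemma derive_flip (phi : R3 R * R3 R -> R) x v :
  'D_(v, 0) (phi \o @flip R) x = 'D_(v, 0) phi (flip x).
Proof. by rewrite /derive flip_derive_quotient. Qed.

Lemma continuous_flip : continuous (@flip R).
Proof.
move=> x A [[P Q] /= [nP nQ] PQA].
have c1 : y.1 @[y --> x] --> x.1 by exact: cvg_fst.
have h1 : nbhs x [set y : R3 R * R3 R | P y.1] := c1 _ nP.
have c2 : - y.2 @[y --> x] --> - x.2 by apply: cvgN; exact: cvg_snd.
have h2 : nbhs x [set y : R3 R * R3 R | Q (- y.2)] := c2 _ nQ.
suff : nbhs x [set y : R3 R * R3 R | A (flip y)] by [].
by apply: filterS2 h1 h2 => y Py Qy; exact: PQA.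
Qed.

Lemma test_fun_flip phi : test_fun Om phi -> test_fun Om (phi \o @flip R).
Proof.
move=> [cphi dphi cdphi [K [cK KO K0]]]; split.
- by move=> x; apply: continuous_comp; [exact: continuous_flip|exact: cphi].
- by move=> x v; rewrite /derivable flip_derive_quotient; exact: dphi.
- move=> v; rewrite (_ : (fun x => _) = (fun x => 'D_(v, 0) phi x) \o @flip R).
    by move=> x; apply: continuous_comp; [exact: continuous_flip|exact: cdphi].
  by apply/funext => x; rewrite derive_flip.
- by exists K; split => // x; exact: (K0 (flip x)).
Qed.

(** Testing with the reflected test function reverses the direction of differentiation, so minus the
    reflected derivative is again a weak derivative of [u]; uniqueness identifies the two. *)
Lemma sgrad_odd u : W2 Om u -> even_fun Om u -> odd_fun Om (sgrad Om u).
Proof.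
move=> Wu eu; have [Lu _] := Wu; have [Ld ud] := sgradP Wu.
set d := sgrad Om u.
have Ldf := L2_flip oOm Ld; have Luf := L2_flip oOm Lu.
have Lm : L2_phase Om (fun x => -1 * (d \o @flip R) x) by exact: L2_scale.
suff um : is_sgrad Om u (fun x => -1 * (d \o @flip R) x).
  have := is_sgrad_unique Lu Ld Lm ud um.
  apply: filterS => x h Dx; have := h Dx; rewrite -/d /= mulN1r => ->.
  by rewrite opprK.
move=> phi tphi.
have tf := test_fun_flip tphi; have Lp := test_fun_L2 oOm bOm tphi.
have LD := test_fun_derive_L2 oOm bOm tphi.
have := ud _ tf; rewrite -/d.
rewrite -(ip_flip oOm Ld (test_fun_L2 oOm bOm tf)).
rewrite -(ip_flip oOm Lu (test_fun_derive_L2 oOm bOm tf)).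
have -> : (phi \o @flip R) \o @flip R = phi.
  by apply/funext => x; rewrite /= flipK.
have -> : (fun x => 'D_(x.2, 0) (phi \o @flip R) x) \o @flip R =
    (fun x => -1 * 'D_(x.2, 0) phi x).
  apply/funext => x; rewrite /= derive_flip flipK mulN1r.
  rewrite (_ : (- x.2, 0) = - (x.2, 0)); last by congr (_, _); rewrite oppr0.
  by rewrite deriveNdir //; case: tphi.
rewrite (@ip_aeq _ _ _ _ _ mphase (u \o @flip R) u _
  (fun x => -1 * 'D_(x.2, 0) phi x)) //; last 3 first.
- exact: L2_scale.
- exact: L2_scale.
- exact: aeW.
rewrite (ipC _ _ u (fun x => -1 * _)) !ip_scalel // !mulN1r => /oppr_inj h.
by rewrite opprK ipC.
Qed.

End sgrad_theory.

(** * Traces *)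

Section trace_theory.
Variables (R : realType) (Om : set (R3 R)).
Hypotheses (oOm : open Om)
  (cOm : convex_set (Om : set (convex_lmodType (R3 R)))).

Lemma midpoint_in (x y : R3 R) : Om x -> Om y -> Om (2^-1 *: x + 2^-1 *: y).
Proof.
move=> Ox Oy.
have h0 : 0 <= 2^-1 :> R by rewrite invr_ge0.
have h1 : 2^-1 <= 1 :> R by rewrite invf_le1 // ler1n.
have := cOm (Itv01 h0 h1) (mem_set Ox) (mem_set Oy).
rewrite inE /conv /= => h; move: h; congr Om; congr (_ + _ *: _).
by rewrite /unstable.onem; lra.
Qed.

(** If both half-lines entered [Om], the boundary point would be the midpoint of two points of [Om],
    hence an interior point. *)
Lemma bd_phase_side x (e e' : R) : bd_phase Om x ->
  e = 1 \/ e = -1 -> e' = 1 \/ e' = -1 ->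
  (\forall t \near 0^'+, Om (x.1 + (e * t) *: x.2)) ->
  (\forall t \near 0^'+, Om (x.1 + (e' * t) *: x.2)) -> e = e'.
Proof.
move=> [[_ nO] _] he he' H H'.
have side : (\forall t \near 0^'+, Om (x.1 + (1 * t) *: x.2)) ->
    (\forall t \near 0^'+, Om (x.1 + (-1 * t) *: x.2)) -> False.
  move=> h1 h2; have [t [/= Ot Ot']] := filter_ex (filterI h1 h2).
  apply: nO; have -> : Om° = Om by apply/interior_id.
  have := midpoint_in Ot Ot'; congr Om.
  by rewrite -scalerDr addrACA mul1r mulN1r scaleNr subrr addr0 -mulr2n -(scaler_nat 2 x.1) scalerA
    mulVf ?pnatr_eq0 // scale1r.
case: he he' H H' => -> [] -> // H H'; exfalso; exact: side.
Qed.

(** The quantity whose limit defines [is_trace], with the side [e] and the candidate value [c] as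
    parameters. *)
Definition mean_dev (u : R3 R * R3 R -> R) (x : R3 R * R3 R) (e c t : R) : \bar R :=
  ((t^-1)%:E * \int[@leb R]_(tau in `]0%R, t[)
         `|u (x.1 + (e * tau) *: x.2, x.2) - c|%:E)%E.

Let measurable_path (u : R3 R * R3 R -> R) (x : R3 R * R3 R) (e t : R) :
  measurable_fun (phase Om) u -> sphere x.2 ->
  (forall tau, 0 < tau < t -> Om (x.1 + (e * tau) *: x.2)) ->
  measurable_fun (`]0, t[%classic : set R) (fun tau : R => u (x.1 + (e * tau) *: x.2, x.2)).
Proof.
move=> mu_ x1 Ot.
have ml : measurable_fun (`]0, t[%classic : set R)
    (fun tau : R => (x.1 + (e * tau) *: x.2, x.2) : R3 R * R3 R).
  apply: measurable_funTS; apply: measurable_fun_pair; last exact: measurable_cst.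
  have ma (a b : R) : measurable_fun setT (fun tau : R => a + e * tau * b).
    by apply: measurable_funD => //; do ![apply: measurable_funM => //].
  by apply: measurable_fun_pair; [apply: measurable_fun_pair|]; exact: ma.
apply: (measurable_comp (measurable_phase oOm) _ mu_ ml).
by move=> _ [tau /= + <-]; rewrite in_itv /= => h; split => //=; exact: Ot.
Qed.

Lemma near_path (x : R3 R * R3 R) (e : R) : (\forall t \near 0^'+, Om (x.1 + (e * t) *: x.2)) ->
  \forall t \near (0 : R)^'+, 0 < t /\ forall tau, 0 < tau < t -> Om (x.1 + (e * tau) *: x.2).
Proof.
rewrite near_withinE => /nbhs_ballP[r /= r0 rP].
near=> t; have t0 : 0 < t by near: t; exact: nbhs_right_gt.
split => // tau /andP[tau0 taut]; apply: rP => //.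
rewrite /ball /= sub0r normrN gtr0_norm //; apply: lt_trans taut _.
by near: t; exact: nbhs_right_lt.
Unshelve. all: by end_near.
Qed.

(** The two limits could a priori be taken on different sides; [bd_phase_side] excludes this. On
    short segments, which stay in [Om] and along which [u] and [v] are measurable, the triangle
    inequality bounds the deviation, and a squeeze concludes. *)
Lemma is_trace_lin (c : R) (u g v h : R3 R * R3 R -> R) : measurable_fun (phase Om) u ->
  measurable_fun (phase Om) v -> is_trace Om u g -> is_trace Om v h ->
  is_trace Om (fun x => c * u x + v x) (fun x => c * g x + h x).
Proof.
move=> mu_ mv; apply: filterS2 => x ux vx Dx.
have [e [he ne ue]] := ux Dx; have [e' [he' ne' ve]] := vx Dx.
have ee := bd_phase_side Dx he he' ne ne'; rewrite -{}ee {e' he' ne'} in ve.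
exists e; split => //; have [_ x1] := Dx.
change (mean_dev u x e (g x) t @[t --> 0^'+] --> 0%E) in ue.
change (mean_dev v x e (h x) t @[t --> 0^'+] --> 0%E) in ve.
change (mean_dev (fun x => c * u x + v x) x e (c * g x + h x) t @[t --> 0^'+] --> 0%E).
have lim0 : ((`|c|%:E * mean_dev u x e (g x) t + mean_dev v x e (h x) t)%E
    @[t --> 0^'+] --> 0%E).
  rewrite -[X in _ --> X]adde0; apply: cvgeD => //.
  by rewrite -[X in _ --> X](mule0 `|c|%:E); exact: cvgeZl.
apply: (squeeze_cvge _ (cvg_cst 0%E) lim0).
have := near_path ne; apply: filterS => t [t0 Ot].
have ti0 : (0 <= (t^-1)%:E)%E by rewrite lee_fin invr_ge0 ltW.
have mI : measurable (`]0, t[%classic : set R) by exact: measurable_itv.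
have muI := measurable_path mu_ x1 Ot; have mvI := measurable_path mv x1 Ot.
have mu1 : measurable_fun (`]0, t[%classic : set R)
    (fun tau : R => `|u (x.1 + (e * tau) *: x.2, x.2) - g x|%:E).
  apply/measurable_EFinP; apply: measurableT_comp => //.
  by apply: measurable_funB.
have mv1 : measurable_fun (`]0, t[%classic : set R)
    (fun tau : R => `|v (x.1 + (e * tau) *: x.2, x.2) - h x|%:E).
  apply/measurable_EFinP; apply: measurableT_comp => //.
  by apply: measurable_funB.
apply/andP; split.
  by rewrite mule_ge0 // integral_ge0.
rewrite /mean_dev muleCA -ge0_muleDr; last 2 first.
- by rewrite mule_ge0 // integral_ge0.
- exact: integral_ge0.
rewrite lee_wpmul2l // -ge0_integralZl // -ge0_integralD //; last first.
  exact: measurable_funeM.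
apply: ge0_le_integral => //.
- apply/measurable_EFinP; apply: measurableT_comp => //.
  apply: measurable_funB => //; apply: measurable_funD => //.
  exact: measurable_funM.
- by apply: emeasurable_funD => //; exact: measurable_funeM.
- move=> tau _; rewrite -EFinM -EFinD lee_fin -normrM.
  apply: le_trans (ler_normD _ _).
  by rewrite le_eqVlt; apply/orP; left; apply/eqP; congr `|_|; ring.
Qed.

(** The mean deviation of the zero function from [g x] is constantly [|g x|], so its limit 0 forces
    [g x = 0]. *)
Lemma is_trace0 g : is_trace Om (fun=> 0) g ->
  {ae @bd_measure R, forall x, bd_phase Om x -> g x = 0}.
Proof.
apply: filterS => x gx Dx; have [e [_ _ lim0]] := gx Dx.
have limg : (mean_dev (fun=> 0) x e (g x) t @[t --> 0^'+] --> `|g x|%:E).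
  apply: cvg_near_cst; near=> t.
  have t0 : 0 < t by near: t; exact: nbhs_right_gt.
  rewrite /mean_dev sub0r normrN integral_cst; last exact: measurable_itv.
  rewrite [X in (_ * (_ * X))%E](_ : _ = t%:E); last first.
    by rewrite -[LHS]/(lebesgue_measure `]0, t[%classic) lebesgue_measure_itv /=
      lte_fin t0 sube0.
  rewrite -!EFinM.
  by rewrite mulrCA mulVf ?mulr1 // gt_eqF.
have e0 : `|g x|%:E = 0%E by exact: (cvg_unique (@ereal_hausdorff R) limg lim0).
by apply/eqP; rewrite -normr_eq0 -eqe; apply/eqP.
Unshelve. all: by end_near.
Qed.

Lemma is_trace_unique (u g h : R3 R * R3 R -> R) : measurable_fun (phase Om) u ->
  is_trace Om u g -> is_trace Om u h ->
  {ae @bd_measure R, forall x, bd_phase Om x -> g x = h x}.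
Proof.
move=> mu_ ug uh; have := is_trace_lin (-1) mu_ mu_ uh ug.
rewrite (_ : (fun x => -1 * u x + u x) = fun=> 0); last first.
  by apply/funext => x; ring.
move/is_trace0; apply: filterS => x k Dx; have := k Dx; lra.
Qed.

Definition has_trace (u : R3 R * R3 R -> R) :=
  exists g, L2_bd Om g /\ is_trace Om u g.

Lemma traceP u : has_trace u -> L2_bd Om (trace Om u) /\ is_trace Om u (trace Om u).
Proof.
move=> ex; rewrite /trace.
exact: (@xgetPex _ (fun=> 0) [set g | L2_bd Om g /\ is_trace Om u g] ex).
Qed.

Let mbd : measurable (bd_phase Om).
Proof. exact: measurable_bd_phase. Qed.

Lemma has_trace_lin (c : R) (u v : R3 R * R3 R -> R) : measurable_fun (phase Om) u ->
  measurable_fun (phase Om) v -> has_trace u -> has_trace v ->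
  has_trace (fun x => c * u x + v x).
Proof.
move=> mu_ mv /traceP[Lg ug] /traceP[Lh vh].
exists (fun x => c * trace Om u x + trace Om v x); split.
  exact: (L2_lin mbd c Lg Lh).
exact: (is_trace_lin c mu_ mv ug vh).
Qed.

Lemma trace_lin (c : R) (u v : R3 R * R3 R -> R) : measurable_fun (phase Om) u ->
  measurable_fun (phase Om) v -> has_trace u -> has_trace v ->
  {ae @bd_measure R, forall x, bd_phase Om x ->
    trace Om (fun x => c * u x + v x) x = c * trace Om u x + trace Om v x}.
Proof.
move=> mu_ mv tu tv; have [Lg ug] := traceP tu; have [Lh vh] := traceP tv.
have [Lf uvf] := traceP (has_trace_lin c mu_ mv tu tv).
apply: (is_trace_unique _ uvf (is_trace_lin c mu_ mv ug vh)).
by apply: measurable_funD => //; exact: measurable_funM.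
Qed.

End trace_theory.

(** * The abstract mixed problem *)

Section symmetric_forms.
Variables (R : realType) (E : lmodType R) (K : set E) (f : E -> E -> R).
Hypotheses (K_lin : forall c u v, K u -> K v -> K (c *: u + v))
  (f_sym : forall u v, K u -> K v -> f u v = f v u)
  (f_lin : forall c u v w, K u -> K v -> K w ->
     f (c *: u + v) w = c * f u w + f v w)
  (f_ge0 : forall u, K u -> 0 <= f u u).

Lemma form_linr c u v w : K u -> K v -> K w ->
  f w (c *: u + v) = c * f w u + f w v.
Proof.
move=> Ku Kv Kw; rewrite f_sym //; last exact: K_lin.
by rewrite f_lin // (f_sym Ku Kw) (f_sym Kv Kw).
Qed.

Lemma form_cauchy_schwarz u v : K u -> K v ->
  `|f u v| <= Num.sqrt (f u u) * Num.sqrt (f v v).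
Proof.
move=> Ku Kv; rewrite -ler_sqr ?nnegrE ?mulr_ge0 ?sqrtr_ge0 //.
rewrite real_normK ?num_real // exprMn !sqr_sqrtr ?f_ge0 //.
apply: discriminant_le (f_ge0 Ku) _ => t.
have := f_ge0 (K_lin t Ku Kv); rewrite f_lin ?form_linr //; last exact: K_lin.
by rewrite (f_sym Kv Ku); congr (_ <= _); ring.
Qed.

Lemma form_null u v : K u -> K v -> f u u = 0 -> f u v = 0.
Proof.
move=> Ku Kv u0; apply/eqP; rewrite -normr_le0.
by apply: le_trans (form_cauchy_schwarz Ku Kv) _; rewrite u0 sqrtr0 mul0r.
Qed.

Lemma form_triangle u v : K u -> K v ->
  Num.sqrt (f (u + v) (u + v)) <= Num.sqrt (f u u) + Num.sqrt (f v v).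
Proof.
move=> Ku Kv; have Kuv : K (u + v) by rewrite -[u]scale1r; exact: K_lin.
rewrite -ler_sqr ?nnegrE ?addr_ge0 ?sqrtr_ge0 //.
rewrite sqrrD !sqr_sqrtr ?f_ge0 //.
have -> : f (u + v) (u + v) = f u u + 2 * f u v + f v v.
  have e z : K z -> f (u + v) z = f u z + f v z.
    by move=> Kz; rewrite -[u in LHS]scale1r f_lin // mul1r.
  rewrite e // (f_sym Ku Kuv) (f_sym Kv Kuv) !e // (f_sym Kv Ku); ring.
have := form_cauchy_schwarz Ku Kv; have := ler_norm (f u v).
by lra.
Qed.

End symmetric_forms.

(* If [A y = 0] then the combination of the [e j] with coefficients [y] is in
   the kernel of [F], so that the right-hand side is orthogonal to the kernel of
   the matrix of [B], even though the [e i] may be dependent. *)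
Lemma finite_galerkin (R : realType) (E : lmodType R) (K : set E)
    (B : E -> E -> R) (F : E -> R) (n : nat) (e : 'I_n -> E) :
  K 0 -> (forall c u v, K u -> K v -> K (c *: u + v)) ->
  (forall c u v w, K u -> K v -> K w -> B (c *: u + v) w = c * B u w + B v w) ->
  (forall c u v w, K u -> K v -> K w -> B w (c *: u + v) = c * B w u + B w v) ->
  (forall c u v, K u -> K v -> F (c *: u + v) = c * F u + F v) ->
  (forall y, K y -> B y y = 0 -> F y = 0) ->
  (forall i, K (e i)) ->
  exists c : 'I_n -> R, forall j, B (\sum_i c i *: e i) (e j) = F (e j).
Proof.
move=> K0 Kl Bl Br Fl BF Ke.
have lin0 (G : E -> R) : (forall c u v, K u -> K v -> G (c *: u + v) = c * G u + G v) -> G 0 = 0.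
  by move=> Gl; have := Gl 1 0 0 K0 K0; rewrite scaler0 addr0 mul1r; lra.
have sumK (c : 'I_n -> R) : K (\sum_i c i *: e i).
  by apply: big_ind => // [u v Ku Kv|i _];
    [rewrite -[u]scale1r; exact: Kl|rewrite -[_ *: _]addr0; exact: Kl].
have sumG (G : E -> R) (c : 'I_n -> R) :
    (forall c u v, K u -> K v -> G (c *: u + v) = c * G u + G v) ->
    G (\sum_i c i *: e i) = \sum_i c i * G (e i).
  move=> Gl; suff [_ ->] : K (\sum_i c i *: e i) /\
      G (\sum_i c i *: e i) = \sum_i c i * G (e i) by [].
  apply: (big_ind2 (fun u r => K u /\ G u = r)); first by split => //; exact: lin0.
    move=> u r v s [Ku <-] [Kv <-]; rewrite -[u]scale1r.
    by split; [exact: Kl|rewrite Gl // mul1r scale1r].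
  move=> i _; rewrite -[_ *: _]addr0; split; first exact: Kl.
  by rewrite Gl // (lin0 _ Gl) addr0.
pose A : 'M[R]_n := \matrix_(i, j) B (e i) (e j).
pose f : 'rV[R]_n := \row_j F (e j).
(* A row lies in the row space of [A] exactly when it annihilates the columns of the cokernel
   matrix, which are the vectors [y] with [A y = 0]. *)
have /submxP[z zA] : (f <= A)%MS.
  rewrite submxE; apply/eqP/matrixP => i j; rewrite mxE [RHS]mxE.
  set y := fun k => cokermx A k j.
  have Ay k : \sum_l B (e k) (e l) * y l = 0.
    transitivity ((A *m cokermx A) k j); last by rewrite mulmx_coker mxE.
    by rewrite mxE; apply: eq_bigr => l _; rewrite [A k l]mxE.
  have By k : B (e k) (\sum_l y l *: e l) = 0.
    rewrite (@sumG (B (e k))); first by rewrite -[RHS](Ay k); apply: eq_bigr => l _; rewrite mulrC.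
    by move=> c u v Ku Kv; exact: Br.
  have := BF _ (sumK y).
  rewrite (@sumG (B ^~ (\sum_l y l *: e l))); last first.
    by move=> c u v Ku Kv; apply: Bl.
  rewrite big1 => [/(_ erefl)|k _]; last by rewrite By mulr0.
  rewrite (sumG _ _ Fl) => h; apply: etrans h.
  by apply: eq_bigr => k _; rewrite [f i k]mxE mulrC.
exists (fun i => z 0 i) => j.
rewrite (@sumG (B ^~ (e j))); last by move=> c u v Ku Kv; exact: Bl.
transitivity ((z *m A) 0 j); last by rewrite -zA mxE.
by rewrite mxE; apply: eq_bigr => i _; rewrite [A i j]mxE.
Qed.

(** Here [G], [k], [p], [x] stand for [Gamma^(1/2)], [gamma^(-1/2)], [gamma^-1] and [G * k]. The
    left side is [7 + 5 Gamma + 6 G + 9 x + 5 k + 2 p], at most [12.5 (1 + Gamma) + 9 p]. *)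
Lemma quasi_optimality_arith (R : realFieldType) (G k p Gamma x : R) :
  2 * G <= 1 + Gamma -> 2 * k <= 1 + p -> 2 * x <= Gamma + p -> 0 <= p ->
  0 < Gamma ->
  4 + (4 * Gamma + 2 * G + x) + 1 + Gamma + (4 * G + 2 + k) +
    2 * (4 * x + 2 * k + p) <= 13 * (1 + p + Gamma).
Proof. by lra. Qed.

Section mixed_problem.
Variables (R : realType) (E : lmodType R) (W L : set E) (ip a b : E -> E -> R)
  (g : E -> E) (gamma Gamma : R).
Hypotheses (WL : W `<=` L)
  (W_lin : forall c u v, W u -> W v -> W (c *: u + v))
  (L_lin : forall c u v, L u -> L v -> L (c *: u + v))
  (gL : forall u, W u -> L (g u))
  (ip_sym : forall u v, L u -> L v -> ip u v = ip v u)
  (ip_lin : forall c u v w, L u -> L v -> L w ->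
     ip (c *: u + v) w = c * ip u w + ip v w)
  (ip_ge0 : forall u, L u -> 0 <= ip u u)
  (a_sym : forall u v, L u -> L v -> a u v = a v u)
  (a_lin : forall c u v w, L u -> L v -> L w ->
     a (c *: u + v) w = c * a u w + a v w)
  (b_sym : forall u v, W u -> W v -> b u v = b v u)
  (b_lin : forall c u v w, W u -> W v -> W w ->
     b (c *: u + v) w = c * b u w + b v w)
  (b_ge0 : forall u, W u -> 0 <= b u u)
  (g_lin : forall c u v z, W u -> W v -> L z ->
     ip (g (c *: u + v)) z = c * ip (g u) z + ip (g v) z)
  (gamma0 : 0 < gamma) (Gamma0 : 0 < Gamma)
  (a_bounds : forall v, L v -> gamma * ip v v <= a v v <= Gamma * ip v v).

Let t := 1 + gamma^-1 + Gamma.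
Let k := Num.sqrt gamma^-1.
Let G := Num.sqrt Gamma.
Let N u := Num.sqrt (ip u u).
Let Nb u := Num.sqrt (b u u).
Let Na u := Num.sqrt (a u u).

Definition mixed_sol (qp qm : E) (X Y : set E) (wp wm : E) := [/\ X wp, Y wm,
  forall vp, X vp -> a wp vp + b wp vp - ip wm (g vp) = ip qp vp &
  forall vm, Y vm -> ip (g wp) vm + a wm vm = ip qm vm].

Definition mixed_norm (wp wm : E) : R :=
  Num.sqrt (ip (g wp) (g wp) + b wp wp + ip wp wp + ip wm wm).

Let a_ge0 u : L u -> 0 <= a u u.
Proof.
move=> Lu; have /andP[h _] := a_bounds Lu; apply: le_trans h.
by rewrite mulr_ge0 ?ip_ge0 // ltW.
Qed.

Let k0 : 0 <= k. Proof. exact: sqrtr_ge0. Qed.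
Let G0 : 0 <= G. Proof. exact: sqrtr_ge0. Qed.
Let k2 : k ^+ 2 = gamma^-1. Proof. by rewrite sqr_sqrtr // invr_ge0 ltW. Qed.
Let G2 : G ^+ 2 = Gamma. Proof. by rewrite sqr_sqrtr // ltW. Qed.
Let N_ge0 u : 0 <= N u. Proof. exact: sqrtr_ge0. Qed.
Let Na_ge0 u : 0 <= Na u. Proof. exact: sqrtr_ge0. Qed.
Let Nb_ge0 u : 0 <= Nb u. Proof. exact: sqrtr_ge0. Qed.

Let N_le_Na u : L u -> N u <= k * Na u.
Proof.
move=> Lu; rewrite /N /k /Na -sqrtrM ?invr_ge0 ?(ltW gamma0) // ler_wsqrtr //.
have /andP[h _] := a_bounds Lu.
by rewrite mulrC ler_pdivlMr // mulrC.
Qed.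

Let Na_le_N u : L u -> Na u <= G * N u.
Proof.
move=> Lu; rewrite /N /G /Na -sqrtrM ?(ltW Gamma0) // ler_wsqrtr //.
by have /andP[_ h] := a_bounds Lu.
Qed.

Let ip_cs u v : L u -> L v -> `|ip u v| <= N u * N v.
Proof. exact: form_cauchy_schwarz. Qed.

Let a_cs u v : L u -> L v -> `|a u v| <= Na u * Na v.
Proof. exact: form_cauchy_schwarz. Qed.

Let b_cs u v : W u -> W v -> `|b u v| <= Nb u * Nb v.
Proof. exact: form_cauchy_schwarz. Qed.

Let L_sub u v : L u -> L v -> L (u - v).
Proof. by move=> Lu Lv; rewrite addrC -scaleN1r; exact: L_lin. Qed.

Let W_sub u v : W u -> W v -> W (u - v).
Proof. by move=> Lu Lv; rewrite addrC -scaleN1r; exact: W_lin. Qed.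

Let ip_sub u v w : L u -> L v -> L w -> ip (u - v) w = ip u w - ip v w.
Proof. by move=> Lu Lv Lw; rewrite addrC -scaleN1r ip_lin //; ring. Qed.

Let a_sub u v w : L u -> L v -> L w -> a (u - v) w = a u w - a v w.
Proof. by move=> Lu Lv Lw; rewrite addrC -scaleN1r a_lin //; ring. Qed.

Let b_sub u v w : W u -> W v -> W w -> b (u - v) w = b u w - b v w.
Proof. by move=> Lu Lv Lw; rewrite addrC -scaleN1r b_lin //; ring. Qed.

Let g_sub u v w : W u -> W v -> L w -> ip (g (u - v)) w = ip (g u) w - ip (g v) w.
Proof. by move=> Lu Lv Lw; rewrite addrC -scaleN1r g_lin //; ring. Qed.

Let sum_le_norms u v : W u -> L v ->
  mixed_norm u v <= N (g u) + Nb u + N u + N v.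
Proof.
move=> Wu Lv.
have i1 := ip_ge0 (gL Wu); have i2 := b_ge0 Wu.
have i3 := ip_ge0 (WL Wu); have i4 := ip_ge0 Lv.
have sub (x y : R) : 0 <= x -> 0 <= y -> Num.sqrt (x + y) <= Num.sqrt x + Num.sqrt y.
  move=> x0 y0; rewrite -ler_sqr ?nnegrE ?addr_ge0 ?sqrtr_ge0 //.
  rewrite sqrrD !sqr_sqrtr ?addr_ge0 // addrAC lerDl.
  by rewrite mulrn_wge0 // mulr_ge0 ?sqrtr_ge0.
apply: le_trans (sub _ _ _ i4) _; first by rewrite !addr_ge0.
rewrite lerD2r; apply: le_trans (sub _ _ _ i3) _; first by rewrite addr_ge0.
by rewrite lerD2r; exact: sub.
Qed.

Let norms_le u v : W u -> L v -> [/\ N (g u) <= mixed_norm u v,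
  Nb u <= mixed_norm u v, N u <= mixed_norm u v & N v <= mixed_norm u v].
Proof.
move=> Wu Lv.
have i1 := ip_ge0 (gL Wu); have i2 := b_ge0 Wu.
have i3 := ip_ge0 (WL Wu); have i4 := ip_ge0 Lv.
by split; apply: ler_wsqrtr; lra.
Qed.

(** These turn the square roots produced by the energy estimates into terms linear in [Gamma] and
    [gamma^-1]. *)
Let am_gm : [/\ 2 * G <= 1 + Gamma, 2 * k <= 1 + gamma^-1 & 2 * (G * k) <= Gamma + gamma^-1].
Proof.
have := sqr_ge0 (G - 1); have := sqr_ge0 (k - 1); have := sqr_ge0 (G - k).
rewrite -k2 -G2 !expr2; set x := G * k; move=> h1 h2 h3.
by split; [nra|nra|rewrite /x in h1 *; nra].
Qed.

(** The abstract form of equality almost everywhere. *)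
Definition ip_equiv u v := ip (u - v) (u - v) = 0.

Let ip_equivE u v z : L u -> L v -> L z -> ip_equiv u v -> ip u z = ip v z.
Proof.
move=> Lu Lv Lz uv; have h := form_null L_lin ip_sym ip_lin ip_ge0 (L_sub Lu Lv) Lz uv.
by move: h; rewrite ip_sub // => /eqP; rewrite subr_eq0 => /eqP.
Qed.

(** The upper bound by [Gamma] makes [a] vanish on differences of norm zero; Cauchy-Schwarz for [a]
    does the rest. *)
Let a_equivE u v z : L u -> L v -> L z -> ip_equiv u v -> a u z = a v z.
Proof.
move=> Lu Lv Lz uv.
have a0 : a (u - v) (u - v) = 0.
  have /andP[_ h] := a_bounds (L_sub Lu Lv); apply/eqP.
  by rewrite eq_le (a_ge0 (L_sub Lu Lv)) andbT; move: h; rewrite uv mulr0.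
have h := form_null L_lin a_sym a_lin a_ge0 (L_sub Lu Lv) Lz a0.
by move: h; rewrite a_sub // => /eqP; rewrite subr_eq0 => /eqP.
Qed.

(** * Estimates for a generic pair of trial and test spaces *)

Section energy.
Variables (X Y : set E).
Hypotheses (XW : X `<=` W) (YL : Y `<=` L)
  (gXY : forall w, X w -> exists2 v, Y v & ip_equiv v (g w)).

(** [g w] agrees with an element of [Y] only up to norm zero, and all three terms are blind to such
    a change. *)
Let test_grad qm wp wm w : W wp -> L wm -> L qm -> X w ->
  (forall vm, Y vm -> ip (g wp) vm + a wm vm = ip qm vm) ->
  ip (g wp) (g w) + a wm (g w) = ip qm (g w).
Proof.
move=> Wwp Lwm Lqm Xw h; have [v Yv vw] := gXY Xw.
have Lv := YL Yv; have Lg := gL (XW Xw); have Lgp := gL Wwp.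
have := h _ Yv; rewrite (ip_sym Lgp Lv) (a_sym Lwm Lv) (ip_sym Lqm Lv).
rewrite (ip_equivE _ _ _ vw) // (ip_equivE Lv Lg Lqm vw) (a_equivE Lv Lg Lwm vw).
by rewrite (ip_sym Lg Lgp) (a_sym Lg Lwm) (ip_sym Lg Lqm).
Qed.

Lemma mixed_stability qp qm wp wm Q : L qp -> L qm ->
  Num.sqrt (ip qp qp) <= Q -> Num.sqrt (ip qm qm) <= Q ->
  mixed_sol qp qm X Y wp wm -> mixed_norm wp wm <= 6 * t * Q.
Proof.
move=> Lqp Lqm; rewrite -/(N qp) -/(N qm) => qpQ qmQ [Xw Yw e1 e2].
have Ww := XW Xw; have Lw := WL Ww; have Lm := YL Yw; have Lg := gL Ww.
have Q0 : 0 <= Q by exact: le_trans qpQ.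
have ap0 := a_ge0 Lw; have am0 := a_ge0 Lm; have b0 := b_ge0 Ww.
pose E2 := a wp wp + a wm wm + b wp wp.
have E20 : 0 <= E2 by rewrite !addr_ge0.
pose En := Num.sqrt E2; have En0 : 0 <= En by exact: sqrtr_ge0.
have En2 : En ^+ 2 = E2 by rewrite sqr_sqrtr.
have e1' := e1 _ Xw; have e2' := e2 _ Yw.
have e3 := test_grad Ww Lm Lqm Xw e2.
have apE : Na wp <= En by apply: ler_wsqrtr; rewrite /E2; lra.
have amE : Na wm <= En by apply: ler_wsqrtr; rewrite /E2; lra.
have bE : Nb wp <= En by apply: ler_wsqrtr; rewrite /E2; lra.
have NpE : N wp <= k * En by apply: le_trans (N_le_Na Lw) _; exact: ler_wpM2l.
have NmE : N wm <= k * En by apply: le_trans (N_le_Na Lm) _; exact: ler_wpM2l.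
(* Adding the two equations tested with their own solution cancels the gradient terms and leaves [E2
   = ip qp wp + ip qm wm <= 2 * Q * k * En]; then divide by [En]. *)
have EQ : En <= 2 * Q * k.
  have [->|En_neq0] := eqVneq En 0; first by rewrite !mulr_ge0.
  have Enp : 0 < En by rewrite lt_neqAle eq_sym En_neq0.
  rewrite -(ler_pM2r Enp) -expr2 En2.
  have h1 : ip qp wp <= Q * (k * En).
    by apply: le_trans (ler_norm _) _; apply: le_trans (ip_cs Lqp Lw) _; exact: ler_pM.
  have h2 : ip qm wm <= Q * (k * En).
    by apply: le_trans (ler_norm _) _; apply: le_trans (ip_cs Lqm Lm) _; exact: ler_pM.
  have := ip_sym Lm Lg; rewrite /E2; lra.
have SQ : N (g wp) <= Q + G * En.
  have [->|S_neq0] := eqVneq (N (g wp)) 0; first by rewrite addr_ge0 // mulr_ge0.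
  have Sp : 0 < N (g wp) by rewrite lt_neqAle eq_sym S_neq0 N_ge0.
  rewrite -(ler_pM2r Sp) -expr2 {1}/N sqr_sqrtr ?ip_ge0 //.
  have h1 : ip qm (g wp) <= Q * N (g wp).
    apply: le_trans (ler_norm _) _; apply: le_trans (ip_cs Lqm Lg) _.
    exact: ler_wpM2r.
  have h2 : - a wm (g wp) <= En * (G * N (g wp)).
    apply: le_trans (ler_norm _) _; rewrite normrN.
    apply: le_trans (a_cs Lm Lg) _; apply: ler_pM => //; exact: Na_le_N.
  by rewrite mulrDl; lra.
(* The four parts add up to at most [Q + G * En + En + 2 * k * En], hence to
   [Q * (2 + Gamma + 6 * gamma^-1)]: this is the origin of 6. *)
apply: le_trans (sum_le_norms Ww Lm) _.
have [ag1 ag2 ag3] := am_gm.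
have kE : k * En <= 2 * Q * gamma^-1.
  by rewrite -k2 expr2 mulrA mulrC ler_wpM2r.
have GE : G * En <= Q * (2 * (G * k)).
  have := ler_wpM2l G0 EQ; rewrite (_ : G * (2 * Q * k) = Q * (2 * (G * k))) //; ring.
have r1 := ler_wpM2l Q0 ag2; have r2 := ler_wpM2l Q0 ag3.
have QG : 0 <= Q * Gamma by rewrite mulr_ge0 // ltW.
have Qg : 0 <= Q * gamma^-1 by rewrite mulr_ge0 // invr_ge0 ltW.
rewrite /t; lra.
Qed.

(** Both equations for the difference, tested with itself, show that its energy is 0. *)
Lemma mixed_unique qp qm wp wm wp' wm' : L qp -> L qm ->
  mixed_sol qp qm X Y wp wm -> mixed_sol qp qm X Y wp' wm' ->
  (forall c u v, X u -> X v -> X (c *: u + v)) ->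
  (forall c u v, Y u -> Y v -> Y (c *: u + v)) ->
  ip_equiv wp wp' /\ ip_equiv wm wm'.
Proof.
move=> Lqp Lqm [Xw Yw e1 e2] [Xw' Yw' e1' e2'] Xl Yl.
have Xd : X (wp - wp') by rewrite addrC -scaleN1r; exact: Xl.
have Yd : Y (wm - wm') by rewrite addrC -scaleN1r; exact: Yl.
have Wd := XW Xd; have Ld := WL Wd; have Ldm := YL Yd; have Lg := gL Wd.
have [Ww Ww'] := (XW Xw, XW Xw'); have [Lw Lw'] := (WL Ww, WL Ww').
have [Lm Lm'] := (YL Yw, YL Yw').
have := e1 _ Xd; have := e1' _ Xd; have := e2 _ Yd; have := e2' _ Yd => h1 h2 h3 h4.
have E0 : a (wp - wp') (wp - wp') + a (wm - wm') (wm - wm') + b (wp - wp') (wp - wp') = 0.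
  rewrite a_sub // [a (wm - wm') _]a_sub // b_sub //.
  have := g_sub Ww Ww' Ldm; have := ip_sub Lm Lm' Lg; have := ip_sym Lg Ldm; lra.
have := a_ge0 Ld; have := a_ge0 Ldm; have := b_ge0 Wd => b0 am0 ap0.
have /andP[hp _] := a_bounds Ld; have /andP[hm _] := a_bounds Ldm.
have zero u : L u -> gamma * ip u u <= 0 -> ip u u = 0.
  by move=> Lu; rewrite pmulr_rle0 // => h; apply/eqP; rewrite eq_le h ip_ge0.
by split; apply: zero => //; lra.
Qed.

(* With [xi = v - wh] and [delta = w - v], the error [w - wh] is
   [delta + xi]; Galerkin orthogonality expresses the energy of [xi], which lies
   in the discrete space, through [delta]. *)
Lemma mixed_quasi_optimal qp qm (Y' : set E) wp wm wp' wm' vp vm : L qp -> L qm ->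
  Y' `<=` L -> Y `<=` Y' ->
  mixed_sol qp qm W Y' wp wm -> mixed_sol qp qm X Y wp' wm' ->
  X vp -> Y vm ->
  (forall c u v, X u -> X v -> X (c *: u + v)) ->
  (forall c u v, Y u -> Y v -> Y (c *: u + v)) ->
  mixed_norm (wp - wp') (wm - wm') <= 13 * t * mixed_norm (wp - vp) (wm - vm).
Proof.
move=> Lqp Lqm Y'L YY' [Ww Yw e1 e2] [Xw' Yw' e1' e2'] Xv Yv Xl Yl.
have Lm := Y'L _ Yw; have Ww' := XW Xw'; have Lm' := YL Yw'.
have Wv := XW Xv; have Lvm := YL Yv.
have [Lw Lw' Lv] := And3 (WL Ww) (WL Ww') (WL Wv).
pose xp := vp - wp'; pose xm := vm - wm'; pose dp := wp - vp; pose dm := wm - vm.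
have Xx : X xp by rewrite /xp addrC -scaleN1r; exact: Xl.
have Yx : Y xm by rewrite /xm addrC -scaleN1r; exact: Yl.
have [Wx Lxm] : W xp /\ L xm by split; [exact: XW|exact: YL].
have [Wd Ldm] : W dp /\ L dm by split; [exact: W_sub|exact: L_sub].
have [We Lem] : W (wp - wp') /\ L (wm - wm') by split; [exact: W_sub|exact: L_sub].
have [Lx Ld Le] := And3 (WL Wx) (WL Wd) (WL We).
have [Lgx Lgd Lge] := And3 (gL Wx) (gL Wd) (gL We).
have orth1 : a dp xp + a xp xp + (b dp xp + b xp xp) - (ip dm (g xp) + ip xm (g xp)) = 0.
  have := e1 _ Wx; have := e1' _ Xx.
  have := a_sub Lw Lv Lx; have := a_sub Lv Lw' Lx.
  have := b_sub Ww Wv Wx; have := b_sub Wv Ww' Wx.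
  have := ip_sub Lm Lvm Lgx; have := ip_sub Lvm Lm' Lgx.
  rewrite -/xp -/xm -/dp -/dm; lra.
have e2x z : Y z -> ip (g (wp - wp')) z + a (wm - wm') z = 0.
  move=> Yz; have Lz := YL Yz; rewrite g_sub // a_sub //.
  by have := e2 _ (YY' _ Yz); have := e2' _ Yz; lra.
have split2 z : L z -> ip (g (wp - wp')) z + a (wm - wm') z =
    ip (g dp) z + ip (g xp) z + (a dm z + a xm z).
  by move=> Lz; rewrite /dp /xp /dm /xm !g_sub // !a_sub //; ring.
have orth2 : ip (g dp) xm + ip (g xp) xm + (a dm xm + a xm xm) = 0.
  by rewrite -split2 // e2x.
(* The error satisfies the second equation on [Y] with zero data, and [test_grad] extends this to
   the gradient of [xp]. *)
have orth3 : ip (g dp) (g xp) + ip (g xp) (g xp) + (a dm (g xp) + a xm (g xp)) = 0.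
  rewrite -split2 //; have L0 : L (0 : E) by rewrite -(subrr wm); exact: L_sub.
  have ip00 z : L z -> ip 0 z = 0.
    by move=> Lz; have := ip_sub Lz Lz Lz; rewrite !subrr.
  rewrite -[RHS](ip00 (g xp)) //; apply: (test_grad We Lem L0 Xx) => vm' Yvm'.
  by rewrite e2x // ip00 //; exact: YL.
pose D := mixed_norm dp dm; have D0 : 0 <= D by exact: sqrtr_ge0.
have [D1 D2 D3 D4] := norms_le Wd Ldm; rewrite -/D in D1 D2 D3 D4.
have ap0 := a_ge0 Lx; have am0 := a_ge0 Lxm; have b0 := b_ge0 Wx.
pose E2 := a xp xp + a xm xm + b xp xp.
have E20 : 0 <= E2 by rewrite !addr_ge0.
pose En := Num.sqrt E2; have En0 : 0 <= En by exact: sqrtr_ge0.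
have En2 : En ^+ 2 = E2 by rewrite sqr_sqrtr.
have apE : Na xp <= En by apply: ler_wsqrtr; rewrite /E2; lra.
have amE : Na xm <= En by apply: ler_wsqrtr; rewrite /E2; lra.
have bE : Nb xp <= En by apply: ler_wsqrtr; rewrite /E2; lra.
have NpE : N xp <= k * En by apply: le_trans (N_le_Na Lx) _; exact: ler_wpM2l.
have NmE : N xm <= k * En by apply: le_trans (N_le_Na Lxm) _; exact: ler_wpM2l.
have adp : Na dp <= G * D by apply: le_trans (Na_le_N Ld) _; exact: ler_wpM2l.
have adm : Na dm <= G * D by apply: le_trans (Na_le_N Ldm) _; exact: ler_wpM2l.
pose S := N (g xp); have S0 : 0 <= S by exact: N_ge0.
have S2 : S ^+ 2 = ip (g xp) (g xp) by rewrite sqr_sqrtr // ip_ge0.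
have neg (x y : R) : `|x| <= y -> - x <= y.
  by move=> h; apply: le_trans h; rewrite -normrN ler_norm.
have SE : S <= G * En + D + Gamma * D.
  have [->|S_neq0] := eqVneq S 0; first by rewrite !addr_ge0 // mulr_ge0 // ltW.
  have Sp : 0 < S by rewrite lt_neqAle eq_sym S_neq0.
  have h1 : - ip (g dp) (g xp) <= D * S.
    by apply: neg; apply: le_trans (ip_cs Lgd Lgx) _; exact: ler_wpM2r.
  have agx : Na (g xp) <= G * S by exact: Na_le_N.
  have h2 : - a dm (g xp) <= G * D * (G * S).
    by apply: neg; apply: le_trans (a_cs Ldm Lgx) _; exact: ler_pM.
  have h3 : - a xm (g xp) <= En * (G * S).
    by apply: neg; apply: le_trans (a_cs Lxm Lgx) _; exact: ler_pM.
  rewrite -(ler_pM2r Sp) -expr2 S2.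
  rewrite (_ : (G * En + D + Gamma * D) * S = En * (G * S) + D * S + G * D * (G * S)).
    by lra.
  by rewrite -G2; ring.
(* [M] is the sum of [3 * G + 1 + k], the coefficient of [D * En] in the quadratic inequality for
   [En], and of [1 + G], which absorbs the term in [D ^ 2]. *)
pose M := 4 * G + 2 + k.
have M0 : 0 <= M by rewrite !addr_ge0 // mulr_ge0.
have EM : En <= M * D.
  have h1 : - a dp xp <= G * D * En.
    by apply: neg; apply: le_trans (a_cs Ld Lx) _; exact: ler_pM.
  have h2 : - a dm xm <= G * D * En.
    by apply: neg; apply: le_trans (a_cs Ldm Lxm) _; exact: ler_pM.
  have h3 : - b dp xp <= D * En.
    by apply: neg; apply: le_trans (b_cs Wd Wx) _; exact: ler_pM.
  have h4 : ip dm (g xp) <= D * S.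
    by apply: le_trans (ler_norm _) _; apply: le_trans (ip_cs Ldm Lgx) _; exact: ler_wpM2r.
  have h5 : - ip (g dp) xm <= D * (k * En).
    by apply: neg; apply: le_trans (ip_cs Lgd Lxm) _; exact: ler_pM.
  have h6 : D * S <= D * (G * En + D + Gamma * D) by exact: ler_wpM2l.
  have En2le : En ^+ 2 <= (3 * G + 1 + k) * (D * En) + (1 + Gamma) * D ^+ 2.
    rewrite En2 /E2 (_ : _ + _ = G * D * En + G * D * En + D * En + D * (k * En) +
      D * (G * En + D + Gamma * D)); last by ring.
    have := ip_sym Lgx Lxm; lra.
  (* If [En] exceeded [M * D], then also [(1 + G) * D <= En], so
     [(1 + Gamma) * D ^ 2 <= (1 + G) * D * En] and the inequality would read
     [En ^ 2 <= M * D * En]. *)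
  rewrite leNgt; apply/negP => MDE.
  have D_En : (1 + G) * D <= En.
    apply: le_trans (ltW MDE); rewrite ler_wpM2r // /M.
    by have := k0; have := G0; lra.
  have h7 : (1 + Gamma) * D ^+ 2 <= ((1 + G) * D) * ((1 + G) * D).
    rewrite -G2 (_ : _ * _ * _ = (1 + G) ^+ 2 * D ^+ 2); last by ring.
    by rewrite ler_wpM2r ?sqr_ge0 // sqrrD; rewrite expr1n mul1r; have := G0; lra.
  have h8 : ((1 + G) * D) * ((1 + G) * D) <= ((1 + G) * D) * En.
    by rewrite ler_wpM2l // mulr_ge0 // addr_ge0.
  have Enp : 0 < En by apply: le_lt_trans MDE; rewrite mulr_ge0.
  have h9 : M * D * En < En ^+ 2 by rewrite expr2 ltr_pM2r.
  have h10 : M * D * En = (3 * G + 1 + k) * (D * En) + (1 + G) * D * En.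
    by rewrite /M; ring.
  by lra.
(* As [g] is linear only under [ip], the triangle inequality is applied to [g dp + g xp], which has
   the same norm. *)
have tri1 : N (g (wp - wp')) <= N (g dp) + S.
  have e : ip (g (wp - wp')) (g (wp - wp')) = ip (g dp + g xp) (g dp + g xp).
    have Ls : L (g dp + g xp) by rewrite -[g dp]scale1r; exact: L_lin.
    have ed z : L z -> ip (g (wp - wp')) z = ip (g dp + g xp) z.
      move=> Lz; rewrite -[g dp]scale1r ip_lin // mul1r /dp /xp !g_sub //; ring.
    by rewrite ed // ip_sym // ed.
  by rewrite {1}/N e; exact: (form_triangle L_lin ip_sym ip_lin ip_ge0).
have ep : wp - wp' = dp + xp by rewrite /dp /xp addrA subrK.
have em : wm - wm' = dm + xm by rewrite /dm /xm addrA subrK.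
have tri2 : Nb (wp - wp') <= Nb dp + Nb xp.
  by rewrite ep; exact: (form_triangle W_lin b_sym b_lin b_ge0).
have tri3 : N (wp - wp') <= N dp + N xp.
  by rewrite ep; exact: (form_triangle L_lin ip_sym ip_lin ip_ge0).
have tri4 : N (wm - wm') <= N dm + N xm.
  by rewrite em; exact: (form_triangle L_lin ip_sym ip_lin ip_ge0).
apply: le_trans (sum_le_norms We Lem) _.
rewrite -/D.
have kE : k * En <= k * M * D by rewrite -mulrA ler_wpM2l.
have GE : G * En <= G * M * D by rewrite -mulrA ler_wpM2l.
apply: (@le_trans _ _ ((4 + G * M + 1 + Gamma + M + 2 * (k * M)) * D)).
  by lra.
rewrite ler_wpM2r //.
have [ag1 ag2 ag3] := am_gm.
have GM : G * M = 4 * Gamma + 2 * G + G * k by rewrite -G2 /M; ring.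
have kM : k * M = 4 * (G * k) + 2 * k + gamma^-1 by rewrite -k2 /M; ring.
have gi : 0 <= gamma^-1 by rewrite invr_ge0 ltW.
rewrite GM kM /M /t.
exact: quasi_optimality_arith ag1 ag2 ag3 gi Gamma0.
Qed.

End energy.

(** The two equations become one for the sum [B] of their left-hand sides on [E * E], with
    generators [(bw i, 0)] and [(0, bv i)]; testing with either kind recovers the equations
    separately. *)
Lemma mixed_exists qp qm n m (bw : 'I_n -> E) (bv : 'I_m -> E) :
  L qp -> L qm -> (forall i, W (bw i)) -> (forall i, L (bv i)) ->
  W 0 ->
  exists (c : 'I_n -> R) (d : 'I_m -> R),
    mixed_sol qp qm
      [set w | exists c, w = \sum_i c i *: bw i]
      [set v | exists d, v = \sum_i d i *: bv i]
      (\sum_i c i *: bw i) (\sum_i d i *: bv i).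
Proof.
move=> Lqp Lqm Wb Lb W0; have L0 := WL W0.
pose e (i : 'I_(n + m)) : E * E :=
  match fintype.split i with inl j => (bw j, 0) | inr j => (0, bv j) end.
pose K : set (E * E) := [set p | W p.1 /\ L p.2].
pose B (p q : E * E) := a p.1 q.1 + b p.1 q.1 - ip p.2 (g q.1) +
  (ip (g p.1) q.2 + a p.2 q.2).
pose F (p : E * E) := ip qp p.1 + ip qm p.2.
have lr := form_linr L_lin.
have Fl c u v : K u -> K v -> F (c *: u + v) = c * F u + F v.
  move=> [Wu Lu] [Wv Lv]; rewrite /F /= (lr _ ip_sym ip_lin) ?(lr _ ip_sym ip_lin) //;
    by [exact: WL|ring].
have Bl c u v w : K u -> K v -> K w -> B (c *: u + v) w = c * B u w + B v w.
  move=> [Wu Lu] [Wv Lv] [Ww Lw]; have [? ? ?] := And3 (WL Wu) (WL Wv) (WL Ww).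
  have ? := gL Ww.
  by rewrite /B /= !a_lin // b_lin // ip_lin // g_lin //; ring.
have Br c u v w : K u -> K v -> K w -> B w (c *: u + v) = c * B w u + B w v.
  move=> [Wu Lu] [Wv Lv] [Ww Lw]; have [? ? ?] := And3 (WL Wu) (WL Wv) (WL Ww).
  have [? ? ?] := And3 (gL Ww) (gL Wu) (gL Wv).
  have ? := gL (W_lin c Wu Wv).
  rewrite /B /= !(lr _ a_sym a_lin) // (form_linr W_lin b_sym b_lin) //.
  rewrite (ip_sym Lw (gL (W_lin c Wu Wv))) g_lin // !(ip_sym _ Lw) //.
  by rewrite (lr _ ip_sym ip_lin) //; ring.
(* On the diagonal the gradient terms of [B] cancel and only the energy is left, so both components
   of [y] have norm zero and the data vanish on them. *)
have BF y : K y -> B y y = 0 -> F y = 0.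
  move=> [Wy Ly]; have Ly1 := WL Wy; have Lg := gL Wy.
  rewrite /B (ip_sym Lg Ly) => B0.
  have := a_ge0 Ly1; have := a_ge0 Ly; have := b_ge0 Wy => h1 h2 h3.
  have /andP[g1 _] := a_bounds Ly1; have /andP[g2 _] := a_bounds Ly.
  have zero u : L u -> gamma * ip u u <= 0 -> ip u u = 0.
    by move=> Lu; rewrite pmulr_rle0 // => h; apply/eqP; rewrite eq_le h ip_ge0.
  have n1 : ip y.1 y.1 = 0 by apply: zero => //; lra.
  have n2 : ip y.2 y.2 = 0 by apply: zero => //; lra.
  rewrite /F (ip_sym Lqp Ly1) (ip_sym Lqm Ly).
  by rewrite (form_null L_lin ip_sym ip_lin ip_ge0 Ly1 Lqp n1)
    (form_null L_lin ip_sym ip_lin ip_ge0 Ly Lqm n2) addr0.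
have Ke i : K (e i).
  by rewrite /e; case: fintype.splitP => l _; split => //=.
have Kl c u v : K u -> K v -> K (c *: u + v).
  by move=> [Wu Lu] [Wv Lv]; split; [exact: W_lin|exact: L_lin].
have [c hc] := finite_galerkin (conj W0 L0 : K 0) Kl Bl Br Fl BF Ke.
have el (i : 'I_n) : e (lshift m i) = (bw i, 0).
  by rewrite /e (unsplitK (inl i : 'I_n + 'I_m)).
have er (i : 'I_m) : e (rshift n i) = (0, bv i).
  by rewrite /e (unsplitK (inr i : 'I_n + 'I_m)).
pose wp := \sum_i c (lshift m i) *: bw i.
pose wm := \sum_i c (rshift n i) *: bv i.
have sumE : \sum_i c i *: e i = (wp, wm).
  rewrite big_split_ord /=.
  have -> : \sum_i c (lshift m i) *: e (lshift m i) = (wp, 0).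
    rewrite /wp; apply: (big_ind2 (fun (p : E * E) u => p = (u, 0))) => //.
      by move=> _ u _ v -> ->; congr (_, _); rewrite /= addr0.
    by move=> i _; rewrite el; congr (_, _); rewrite /= scaler0.
  have -> : \sum_i c (rshift n i) *: e (rshift n i) = (0, wm).
    rewrite /wm; apply: (big_ind2 (fun (p : E * E) u => p = (0, u))) => //.
      by move=> _ u _ v -> ->; congr (_, _); rewrite /= addr0.
    by move=> i _; rewrite er; congr (_, _); rewrite /= scaler0.
  by congr (_, _); rewrite /= ?addr0 ?add0r.
rewrite sumE in hc.
have Wwp : W wp.
  apply: big_ind => // [u v Wu Wv|i _]; first by rewrite -[u]scale1r; exact: W_lin.
  by rewrite -[_ *: _]addr0; exact: W_lin.
have Lwm : L wm.
  apply: big_ind => // [u v Lu Lv|i _]; first by rewrite -[u]scale1r; exact: L_lin.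
  by rewrite -[_ *: _]addr0; exact: L_lin.
have Kw : K (wp, wm) by [].
exists (fun i => c (lshift m i)), (fun i => c (rshift n i)).
have K0 : K 0 by split.
have B0 : B (wp, wm) 0 = 0.
  by have := Br 1 0 0 _ K0 K0 Kw; rewrite scaler0 addr0 mul1r; lra.
have F0 : F 0 = 0 by have := Fl 1 0 0 K0 K0; rewrite scaler0 addr0 mul1r; lra.
have ip0 z : L z -> ip z 0 = 0.
  by move=> Lz; have := lr _ ip_sym ip_lin 1 0 0 z L0 L0 Lz; rewrite scaler0 addr0 mul1r; lra.
have a0 z : L z -> a z 0 = 0.
  by move=> Lz; have := lr _ a_sym a_lin 1 0 0 z L0 L0 Lz; rewrite scaler0 addr0 mul1r; lra.
have b0 : b wp 0 = 0.
  by have := form_linr W_lin b_sym b_lin 1 W0 W0 Wwp; rewrite scaler0 addr0 mul1r; lra.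
(* [g 0] need not be 0 itself; it is orthogonal to [L] by weak linearity. *)
have ipg0 : ip wm (g 0) = 0.
  have := g_lin 1 W0 W0 Lwm; rewrite scaler0 addr0 mul1r (ip_sym Lwm (gL W0)); lra.
split; [by eexists|by eexists| |].
- move=> _ [d ->]; suff [Wd] : W (\sum_i d i *: bw i) /\
      B (wp, wm) (\sum_i d i *: bw i, 0) = F (\sum_i d i *: bw i, 0).
    rewrite /B /F /= (ip0 _ (gL Wwp)) (a0 _ Lwm) (ip0 _ Lqm) !addr0.
    exact.
  apply: (big_ind (fun u => W u /\ B (wp, wm) (u, 0) = F (u, 0)))
    => [|u v [Wu Bu] [Wv Bv]|i _]; first by split; rewrite // B0 F0.
    split; first by rewrite -[u]scale1r; exact: W_lin.
    have -> : (u + v, 0) = 1 *: (u, 0) + (v, 0) :> E * E.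
      by congr (_, _); rewrite /= ?scale1r ?scaler0 ?addr0.
    by rewrite Br // Fl // Bu Bv.
  split; first by rewrite -[_ *: _]addr0; exact: W_lin.
  have -> : (d i *: bw i, 0) = d i *: (bw i, 0) + 0 :> E * E.
    by congr (_, _); rewrite /= ?scaler0 ?addr0.
  have Kb : K (bw i, 0) by split; [exact: Wb|].
  by rewrite Br // Fl // -el hc B0 F0.
- move=> _ [d ->]; suff [Ld] : L (\sum_i d i *: bv i) /\
      B (wp, wm) (0, \sum_i d i *: bv i) = F (0, \sum_i d i *: bv i).
    rewrite /B /F /= (a0 _ (WL Wwp)) b0 ipg0 (ip0 _ Lqp) subr0 !add0r.
    exact.
  apply: (big_ind (fun u => L u /\ B (wp, wm) (0, u) = F (0, u)))
    => [|u v [Lu Bu] [Lv Bv]|i _]; first by split; rewrite // B0 F0.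
    split; first by rewrite -[u]scale1r; exact: L_lin.
    have -> : (0, u + v) = 1 *: (0, u) + (0, v) :> E * E.
      by congr (_, _); rewrite /= ?scale1r ?scaler0 ?addr0.
    by rewrite Br // Fl // Bu Bv.
  split; first by rewrite -[_ *: _]addr0; exact: L_lin.
  have -> : (0, d i *: bv i) = d i *: (0, bv i) + 0 :> E * E.
    by congr (_, _); rewrite /= ?scaler0 ?addr0.
  have Kb : K (0, bv i) by split; [|exact: Lb].
  by rewrite Br // Fl // -er hc B0 F0.
Qed.

End mixed_problem.

(** * Well-posedness and quasi-optimality *)

Section phase_space.
Variables (R : realType) (Om : set (R3 R)).
Hypotheses (oOm : open Om) (bOm : bounded_set Om)
  (cOm : convex_set (Om : set (convex_lmodType (R3 R)))).
Implicit Types u v w z q : R3 R * R3 R -> R.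

Let mphase : measurable (phase Om).
Proof. exact: measurable_phase. Qed.

Let mbd : measurable (bd_phase Om).
Proof. exact: measurable_bd_phase. Qed.

Lemma Wplus_L2 u : Wplus Om u -> L2_phase Om u.
Proof. by case=> [[]]. Qed.

Lemma Wplus_lin c u v : Wplus Om u -> Wplus Om v ->
  Wplus Om (fun x => c * u x + v x).
Proof.
move=> [Wu eu tu] [Wv ev tv]; have [[mu_ _] _] := Wu; have [[mv _] _] := Wv.
split; first exact: (W2_lin oOm bOm c Wu Wv).
  by apply: filterS2 eu ev => x hu hv Dx; rewrite hu // hv.
exact: (has_trace_lin oOm cOm c mu_ mv tu tv).
Qed.

Lemma sgrad_L2 u : Wplus Om u -> L2_phase Om (sgrad Om u).
Proof. by move=> [Wu _ _]; have [] := sgradP Wu. Qed.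

Lemma trace_L2 u : Wplus Om u -> L2_bd Om (trace Om u).
Proof. by move=> [_ _ tu]; have [] := traceP tu. Qed.

Lemma ip_sgrad_lin c u v z : Wplus Om u -> Wplus Om v -> L2_phase Om z ->
  ip_phase Om (sgrad Om (fun x => c * u x + v x)) z =
  c * ip_phase Om (sgrad Om u) z + ip_phase Om (sgrad Om v) z.
Proof.
move=> Wu Wv Lz; have [Lu Lv] := (sgrad_L2 Wu, sgrad_L2 Wv).
rewrite -(ip_linl mphase c Lu Lv Lz).
apply: (ip_aeq mphase (sgrad_L2 (Wplus_lin c Wu Wv)) (L2_lin mphase c Lu Lv) Lz Lz).
  by case: Wu Wv => [Wu _ _] [Wv _ _]; exact: (sgrad_lin oOm bOm c Wu Wv).
exact: aeW.
Qed.

Lemma ip_trace_lin c u v w : Wplus Om u -> Wplus Om v -> Wplus Om w ->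
  ip_bd Om (trace Om (fun x => c * u x + v x)) (trace Om w) =
  c * ip_bd Om (trace Om u) (trace Om w) + ip_bd Om (trace Om v) (trace Om w).
Proof.
move=> Wu Wv Ww; have [Lu Lv] := (trace_L2 Wu, trace_L2 Wv).
have Lw := trace_L2 Ww.
rewrite -(ip_linl mbd c Lu Lv Lw).
apply: (ip_aeq mbd (trace_L2 (Wplus_lin c Wu Wv)) (L2_lin mbd c Lu Lv) Lw Lw).
  case: Wu Wv => [[[mu_ _] _] _ tu] [[[mv _] _] _ tv].
  exact: (trace_lin oOm cOm c mu_ mv tu tv).
exact: aeW.
Qed.

Lemma ip_phase_sub0 u v : L2_phase Om u -> L2_phase Om v ->
  ip_phase Om (u \- v) (u \- v) = 0 <-> ae_phase_eq Om u v.
Proof.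
move=> Lu Lv; have Luv := L2_sub mphase Lu Lv; split => [h|h].
  have := ip_eq0_ae mphase Luv h; apply: filterS => x /= e Dx.
  by apply/eqP; rewrite -subr_eq0; apply/eqP; exact: e.
have L0 := L2_0 (@phase_measure R) (phase Om).
have e0 : {ae @phase_measure R, forall x, phase Om x -> (u \- v) x = (fun=> 0) x}.
  by apply: filterS h => x e Dx; rewrite /= e // subrr.
rewrite (ip_aeq mphase Luv L0 Luv L0 e0 e0) /ip.
by under eq_Rintegral do rewrite mulr0; rewrite /Rintegral integral0.
Qed.

(** [e = 1] and [e = -1] give the even and the odd part. Reflection preserves the norm, so
    Cauchy-Schwarz bounds the cross term by the square of the norm of [q]. *)
Lemma parity_part_L2 (e : R) q : `|e| <= 1 -> L2_phase Om q ->
  let qe := fun x => 2^-1 * q x + (e * 2^-1) * q (flip x) in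
  L2_phase Om qe /\ l2norm_phase Om qe <= l2norm_phase Om q.
Proof.
move=> e1 Lq qe; have Lf := L2_flip oOm Lq.
have Lef := L2_scale mphase (e * 2^-1) Lf.
have Lqe : L2_phase Om qe := L2_lin mphase 2^-1 Lq Lef.
split => //; rewrite /l2norm ler_wsqrtr //.
have -> : ip_phase Om qe qe = 2^-1 * (2^-1 * ip_phase Om q q +
      (e * 2^-1) * ip_phase Om q (q \o @flip R)) +
    (e * 2^-1) * (2^-1 * ip_phase Om q (q \o @flip R) +
      (e * 2^-1) * ip_phase Om q q).
  rewrite (ip_linl mphase _ Lq Lef Lqe) (ip_scalel _ mphase Lf Lqe).
  rewrite !(ipC _ _ _ qe) !(ip_linl mphase _ Lq Lef) // !(ip_scalel _ mphase Lf) //.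
  by rewrite (ip_flip oOm Lq Lq) (ipC _ _ (q \o @flip R) q).
have := cauchy_schwarz_L2 mphase Lq Lf.
have -> : l2norm_phase Om (q \o @flip R) = l2norm_phase Om q.
  by rewrite /l2norm ip_flip.
rewrite -expr2 l2norm_sqr; set Q := ip_phase Om q q; set X := ip_phase Om q _ => XQ.
have Q0 : 0 <= Q by exact: ip_ge0.
have eX : e * X <= Q.
  apply: le_trans (ler_norm _) _; rewrite normrM.
  by apply: le_trans XQ; rewrite ler_piMl.
have e2 : e ^+ 2 <= 1 by rewrite -(real_normK (num_real e)) expr_le1.
have e2Q : e ^+ 2 * Q <= Q by rewrite ler_piMl.
rewrite (_ : _ + _ = (Q + 2 * (e * X) + e ^+ 2 * Q) / 4); last by field.
by rewrite ler_pdivrMr //; lra.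
Qed.

Lemma even_part_L2 q : L2_phase Om q ->
  L2_phase Om (even_part q) /\ l2norm_phase Om (even_part q) <= l2norm_phase Om q.
Proof.
move=> Lq; have -> : even_part q = fun x => 2^-1 * q x + (1 * 2^-1) * q (flip x).
  by apply/funext => x; rewrite /even_part /flip; field.
by apply: (parity_part_L2 _ Lq); rewrite normr1.
Qed.

Lemma odd_part_L2 q : L2_phase Om q ->
  L2_phase Om (odd_part q) /\ l2norm_phase Om (odd_part q) <= l2norm_phase Om q.
Proof.
move=> Lq; have -> : odd_part q = fun x => 2^-1 * q x + (-1 * 2^-1) * q (flip x).
  by apply/funext => x; rewrite /odd_part /flip; field.
by apply: (parity_part_L2 _ Lq); rewrite normrN1.
Qed.

Lemma l2norm_phase_sub (Om' : set (R3 R)) q : open Om' -> Om' `<=` Om ->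
  L2_phase Om q ->
  {ae @phase_measure R, forall x, phase Om x -> ~ Om' x.1 -> q x = 0} ->
  l2norm_phase Om q = l2norm_phase Om' q.
Proof.
move=> oO' O'O [mq q2] q0; have mO' := measurable_phase oO'.
congr Num.sqrt; rewrite /ip.
have mqq : measurable_fun (phase Om) (fun x => q x * q x).
  exact: measurable_funM.
have O'E : phase Om' = phase Om `&` phase Om'.
  by apply/seteqP; split => x; [move=> [h1 h2]; split; split => //; exact: O'O|case].
rewrite [in RHS]O'E (@Rintegral_mkcondr _ _ _ _ (phase Om) (phase Om')).
congr fine; apply: ae_eq_integral => //.
- exact/measurable_EFinP.
- apply/measurable_EFinP/(measurable_restrict _ mO' mphase).
  by apply: (measurable_funS mphase _ mqq); exact: subIsetl.
apply: filterS q0 => x h Dx; congr EFin; rewrite restrictE.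
case: ifPn => // /negP nx; rewrite h ?mulr0 // => Ox; apply: nx; apply: mem_set.
by case: Dx.
Qed.

End phase_space.

Definition stability_constant (R : realType) (gamma Gamma : R) : R :=
  6 * (1 + gamma^-1 + Gamma).

Definition quasi_optimality_constant (R : realType) (gamma Gamma : R) : R :=
  13 * (1 + gamma^-1 + Gamma).

(** With values in [R^o] the functions form a module, the setting of the abstract problem. *)
Lemma span_fin_dim (T : Type) (R : realType) (n : nat) (b : 'I_n -> T -> R) :
  [set v : T -> R | exists c : 'I_n -> R, v = fun x => \sum_(i < n) c i * b i x] =
  [set v : T -> R | exists c : 'I_n -> R, v = \sum_(i < n) c i *: (b i : T -> R^o)].
Proof.
have e (c : 'I_n -> R) : (fun x => \sum_(i < n) c i * b i x) =
    \sum_(i < n) c i *: (b i : T -> R^o).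
  by apply/funext => x; rewrite fct_sumE.
by apply/seteqP; split => v [c ->]; exists c; rewrite e.
Qed.

Lemma span_basis (R : realType) (E : lmodType R) (n : nat) (b : 'I_n -> E) i :
  exists c : 'I_n -> R, b i = \sum_j c j *: b j.
Proof.
exists (fun j => (j == i)%:R); rewrite (bigD1 i) //= eqxx scale1r big1 ?addr0 //.
by move=> j /negbTE ->; rewrite scale0r.
Qed.

Lemma fin_dim_lin (T : Type) (R : realType) (V : set (T -> R)) :
  fin_dim_subspace V -> forall (c : R) (u v : T -> R), V u -> V v ->
  V (fun x => c * u x + v x).
Proof.
move=> [n [b ->]] c u v [d ->] [e ->]; exists (fun i => c * d i + e i).
apply/funext => x; rewrite mulr_sumr -big_split /=.
by apply: eq_bigr => i _; ring.
Qed.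

Lemma fin_dim0 (T : Type) (R : realType) (V : set (T -> R)) :
  fin_dim_subspace V -> V (fun=> 0).
Proof.
move=> [n [b ->]]; exists (fun=> 0); apply/funext => x.
by rewrite big1 // => i _; rewrite mul0r.
Qed.

Theorem lemma5p6 (R : realType) :
  exists CD CD' : R -> R -> R, at_most_linear CD /\ at_most_linear CD' /\
  forall (Om Oml : set (R3 R)) (mu : R3 R -> R) (mubar : R)
    (k : R3 R -> R -> R) (kbar : R) (l eta a gamma Gamma : R)
    (Wh Vh : set (R3 R * R3 R -> R)) (q : R3 R * R3 R -> R),
  bounded_convex_domain Om ->
  absorption_ok Om mu mubar ->
  scattering_ok Om mu k kbar ->
  0 < l -> 0 < eta -> extended_domain Om Oml l eta ->
  0 < a -> 0 < gamma -> 0 < Gamma ->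
  collision_bounds Oml (collision Om a mu k) gamma Gamma ->
  galerkin_spaces Oml Wh Vh ->
  L2_phase Oml q ->
  {ae @phase_measure R, forall x, phase Oml x -> ~ Om x.1 -> q x = 0} ->
  let galerkin := mixed_solution Oml (collision Om a mu k) q Wh Vh in
  let continuous_sol :=
    mixed_solution Oml (collision Om a mu k) q (Wplus Oml) (Vminus Oml) in
  [/\ exists wp wm, galerkin wp wm,
      forall wp wm wp' wm', galerkin wp wm -> galerkin wp' wm' ->
        ae_phase_eq Oml wp wp' /\ ae_phase_eq Oml wm wm',
      forall whp whm, galerkin whp whm ->
        tnorm Oml whp whm <= CD gamma Gamma * l2norm_phase Om q,
      forall wp wm, continuous_sol wp wm ->
        tnorm Oml wp wm <= CD gamma Gamma * l2norm_phase Om q &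
      forall wp wm whp whm, continuous_sol wp wm -> galerkin whp whm ->
        tnorm Oml (wp \- whp) (wm \- whm) <= CD' gamma Gamma *
          inf [set tnorm Oml (wp \- vp) (wm \- vm) | vp in Wh & vm in Vh]].
Proof.
exists (@stability_constant R), (@quasi_optimality_constant R).
split; first by exists 6.
split; first by exists 13.
move=> Om Oml mu mubar k kbar l eta a gamma Gamma Wh Vh q [oOm _ _ _] mu_ok k_ok _ _
  [[oOml _ bOml cOml] _ clOm _ _] _ gamma0 Gamma0 C_bounds
  [fWh WhW fVh VhV Wh_grad] Lq q0 galerkin continuous_sol.
have Om_Oml : Om `<=` Oml by apply: subset_trans clOm; exact: subset_closure.
have mphase := measurable_phase oOml.
pose E := R3 R * R3 R -> R^o.
pose L : set E := L2_phase Oml.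
pose W : set E := Wplus Oml.
pose V : set E := Vminus Oml.
pose ipE (u v : E) : R := ip_phase Oml u v.
pose aE (u v : E) : R := ip_phase Oml (collision Om a mu k u) v.
pose bE (u v : E) : R := ip_bd Oml (trace Oml u) (trace Oml v).
pose gE (u : E) : E := sgrad Oml u.
have WL : W `<=` L by move=> u; exact: Wplus_L2.
have W_lin (c : R) (u v : E) : W u -> W v -> W (c *: u + v).
  exact: (Wplus_lin oOml bOml cOml).
have L_lin (c : R) (u v : E) : L u -> L v -> L (c *: u + v).
  exact: (L2_lin mphase).
have V_L : V `<=` L by move=> v [].
have gL (u : E) : W u -> L (gE u) by exact: sgrad_L2.
have ip_sym (u v : E) : L u -> L v -> ipE u v = ipE v u by move=> _ _; exact: ipC.
have ip_lin c (u v w : E) : L u -> L v -> L w -> ipE (c *: u + v) w = c * ipE u w + ipE v w.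
  exact: (ip_linl mphase).
have ip_pos (u : E) : L u -> 0 <= ipE u u by move=> _; exact: ip_ge0.
have a_sym (u v : E) : L u -> L v -> aE u v = aE v u.
  exact: (@ip_collision_sym R Om Oml mu mubar k kbar a oOm oOml mu_ok k_ok).
have a_lin c (u v w : E) : L u -> L v -> L w -> aE (c *: u + v) w = c * aE u w + aE v w.
  exact: (@ip_collision_linl R Om Oml mu mubar k kbar a oOm oOml mu_ok k_ok).
have b_sym (u v : E) : W u -> W v -> bE u v = bE v u by move=> _ _; exact: ipC.
have b_lin c (u v w : E) : W u -> W v -> W w -> bE (c *: u + v) w = c * bE u w + bE v w.
  exact: (ip_trace_lin oOml bOml cOml).
have b_pos (u : E) : W u -> 0 <= bE u u by move=> _; exact: ip_ge0.
have g_lin c (u v z : E) : W u -> W v -> L z ->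
    ipE (gE (c *: u + v)) z = c * ipE (gE u) z + ipE (gE v) z.
  exact: (ip_sgrad_lin oOml bOml cOml).
have a_bounds (v : E) : L v -> gamma * ipE v v <= aE v v <= Gamma * ipE v v.
  by move=> Lv; have := C_bounds v Lv; rewrite l2norm_sqr.
have [Lqp Nqp] := even_part_L2 oOml Lq; have [Lqm Nqm] := odd_part_L2 oOml Lq.
rewrite -(l2norm_phase_sub oOml oOm Om_Oml Lq q0).
have tnE (u v : E) : tnorm Oml u v = mixed_norm ipE bE gE u v.
  by rewrite /tnorm !l2norm_sqr.
have equiv (u v : E) : L u -> L v -> (ip_equiv ipE u v <-> ae_phase_eq Oml u v).
  by move=> Lu Lv; exact: (ip_phase_sub0 oOml Lu Lv).
have VhL : Vh `<=` L by exact: subset_trans VhV V_L.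
have Wh_lin (c : R) (u v : E) : Wh u -> Wh v -> Wh (c *: u + v).
  exact: fin_dim_lin.
have Vh_lin (c : R) (u v : E) : Vh u -> Vh v -> Vh (c *: u + v).
  exact: fin_dim_lin.
have gradh (w : E) : Wh w -> exists2 v : E, Vh v & ip_equiv ipE v (gE w).
  move=> Whw; have [v Vhv vw] := Wh_grad w Whw; exists v => //.
  by apply/equiv => //; [exact: VhL|apply: gL; exact: WhW].
(* The full spaces satisfy the compatibility condition as well, because the gradient of an even
   function is odd; the stability estimate therefore applies to them verbatim. *)
have gradc (w : E) : W w -> exists2 v : E, V v & ip_equiv ipE v (gE w).
  move=> Ww; have Lg := gL _ Ww; exists (gE w).
    by split => //; case: Ww => [W2w ew _]; exact: sgrad_odd.
  by apply/equiv => //; exact: aeW.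
split.
- have [n [bw WhE]] := fWh; have [m [bv VhE]] := fVh.
  rewrite span_fin_dim in WhE; rewrite span_fin_dim in VhE.
  have Wb i : W (bw i) by apply: WhW; rewrite WhE; exact: span_basis.
  have Lb i : L (bv i) by apply: VhL; rewrite VhE; exact: span_basis.
  have W0 : W 0 by apply: WhW; exact: fin_dim0.
  have [c [e]] := mixed_exists WL W_lin L_lin gL ip_sym ip_lin ip_pos a_sym a_lin
    b_sym b_lin b_pos g_lin gamma0 a_bounds Lqp Lqm Wb Lb W0.
  by rewrite -WhE -VhE => ce; eexists; eexists; exact: ce.
- move=> wp wm wp' wm' s s'.
  have [e1 e2] := mixed_unique WL gL ip_sym ip_lin ip_pos a_lin b_lin b_pos
    g_lin gamma0 a_bounds WhW VhL Lqp Lqm s s' Wh_lin Vh_lin.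
  have [[Whw Vhw _ _] [Whw' Vhw' _ _]] := (s, s').
  by split; apply/equiv => //; first [exact: VhL|apply: WL; exact: WhW].
- move=> wp wm s; rewrite tnE.
  exact: (mixed_stability WL L_lin gL ip_sym ip_lin ip_pos a_sym a_lin b_pos
    gamma0 Gamma0 a_bounds WhW VhL gradh Lqp Lqm Nqp Nqm s).
- move=> wp wm s; rewrite tnE.
  exact: (mixed_stability WL L_lin gL ip_sym ip_lin ip_pos a_sym a_lin b_pos
    gamma0 Gamma0 a_bounds (@subset_refl _ W) V_L gradc Lqp Lqm Nqp Nqm s).
- move=> wp wm whp whm s sh.
  have C0 : 0 < quasi_optimality_constant gamma Gamma.
    by rewrite mulr_gt0 // !addr_gt0 // invr_gt0.
  (* After division by the positive constant the error is a lower bound of the set; the Galerkin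
     solution itself shows that the set is not empty. *)
  rewrite mulrC -ler_pdivrMr //; apply: lb_le_inf.
    by have [h1 h2 _ _] := sh; exists (tnorm Oml (wp \- whp) (wm \- whm));
      exists whp => //; exists whm.
  move=> _ [vp Whv [vm Vhv <-]]; rewrite ler_pdivrMr // mulrC !tnE.
  exact: (mixed_quasi_optimal WL W_lin L_lin gL ip_sym ip_lin ip_pos a_sym a_lin
    b_sym b_lin b_pos g_lin gamma0 Gamma0 a_bounds WhW VhL gradh Lqp Lqm V_L VhV
    s sh Whv Vhv Wh_lin Vh_lin).
Qed.
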